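(* Let $V_1,V_2,V_3$ be complex vector spaces of dimension $3$ with bases $a_0,a_1,a_2$; $b_0,b_1,b_2$; $c_0,c_1,c_2$ respectively, and let $T\in V_1\otimes V_2\otimes V_3$ be a concise tensor. If the cubic curve $E^1_T$ is singular, then $T$ is, up to changing coordinates (that is, up to the action of $\mathrm{GL}(V_1)\times\mathrm{GL}(V_2)\times\mathrm{GL}(V_3)$) and swapping the second and third factor, one of the tensors in the list below, and the corresponding collineation variety $\mathscr{C}^1_2(T)$ on the first factor is, up to linear isomorphism, the one recorded after the arrow. Here $a_ib_jc_k$ stands for $a_i\otimes b_j\otimes c_k$, and we write $u=a_0b_0c_0+a_1b_1c_1+a_2b_2c_2$, $w=a_0b_1c_2+a_2b_0c_1+a_1b_2c_0$, $v=a_0b_1c_2+a_1b_2c_0+a_2b_0c_1-(a_0b_2c_1+a_1b_0c_2+a_2b_1c_0)$; $\lambda\in\mathbb{C}$, $\lambda\ne0$. Semistable tensors: - III.1: $u+\lambda w+a_0b_2c_1+a_1b_0c_2\ \to\ \nu_2(\mathbb{P}^2)$ - III.2: $u+\lambda w+a_0b_2c_1\ \to\ \nu_2(\mathbb{P}^2)$ - III.ps: $u+\lambda w\ \to\ \nu_2(\mathbb{P}^2)$ - IV.1(i): $u+a_0b_1c_2+a_0b_2c_1+a_1b_0c_2+a_1b_2c_0\ \to\ S_{(1,2)}$ - IV.1(ii): $u+a_1b_0c_2+a_2b_0c_1+a_0b_1c_2+a_2b_1c_0\ \to\ \nu_2(\mathbb{P}^2)$ - IV.1(iii): $u+a_2b_1c_0+a_1b_2c_0+a_2b_0c_1+a_0b_2c_1\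 \to\ \nu_2(\mathbb{P}^2)$ - IV.2(i): $u+a_0b_1c_2+a_0b_2c_1+a_1b_0c_2\ \to\ S_{(1,2)}$ - IV.2(iii): $u+a_1b_0c_2+a_2b_0c_1+a_0b_1c_2\ \to\ \nu_2(\mathbb{P}^2)$ - IV.2(vi): $u+a_2b_1c_0+a_1b_2c_0+a_2b_0c_1\ \to\ S_{(1,2)}$ - IV.4(i): $u+a_0b_1c_2+a_0b_2c_1\ \to\ \mathbb{P}^1\times\mathbb{P}^1$ - IV.4(ii): $u+a_1b_0c_2+a_2b_0c_1\ \to\ S_{(1,2)}$ - IV.4(iii): $u+a_2b_1c_0+a_1b_2c_0\ \to\ S_{(1,2)}$ - IV.5(i): $u+a_0b_1c_2+a_1b_2c_0\ \to\ S_{(1,2)}$ - IV.5(ii): $u+a_1b_0c_2+a_2b_1c_0\ \to\ S_{(1,2)}$ - IV.7(i): $u+a_0b_1c_2\ \to\ \mathbb{P}^1\times\mathbb{P}^1$ - IV.ps: $u\ \to\ \mathbb{P}^2$ - V.1: $v+a_0b_0c_0+a_1b_1c_2+a_1b_2c_1+a_2b_1c_1\ \to\ \nu_2(\mathbb{P}^2)$ - V.2: $v+a_0b_0c_1+a_0b_1c_0+a_1b_0c_0+a_1b_1c_2+a_1b_2c_1+a_2b_1c_1\ \to\ \nu_2(\mathbb{P}^2)$ - V.3: $v+a_0b_0c_0+a_1b_1c_1\ \to\ \nu_2(\mathbb{P}^2)$ - V.4: $v+a_0b_0c_1+a_0b_1c_0+a_1b_0c_0\ \to\ \nu_2(\mathbb{P}^2)$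 - V.5: $v+a_0b_0c_0\ \to\ \nu_2(\mathbb{P}^2)$ - V.ps: $v\ \to\ \nu_2(\mathbb{P}^2)$ Unstable tensors: - I.1(i): $a_0b_1c_2+a_0b_2c_1+a_1b_0c_2+a_1b_1c_1+a_1b_2c_0+a_2b_0c_0\ \to\ S_{(1,2)}$ - I.1(ii): $a_1b_0c_2+a_2b_0c_1+a_0b_1c_2+a_1b_1c_1+a_2b_1c_0+a_0b_2c_0\ \to\ \nu_2(\mathbb{P}^2)$ - I.2(i): $a_0b_1c_2+a_0b_2c_1+a_1b_0c_2+a_1b_1c_0+a_1b_1c_1+a_2b_0c_0\ \to\ S_{(1,2)}$ - I.2(iii): $a_2b_0c_1+a_1b_0c_2+a_2b_1c_0+a_0b_1c_1+a_1b_1c_1+a_0b_2c_0\ \to\ \nu_2(\mathbb{P}^2)$ - I.3(i): $a_0b_0c_2+a_0b_1c_1+a_0b_2c_0+a_1b_0c_1+a_1b_1c_2+a_2b_0c_0\ \to\ S_{(1,2)}$ - I.3(iii): $a_2b_0c_0+a_1b_0c_1+a_0b_0c_2+a_1b_1c_0+a_2b_1c_1+a_0b_2c_0\ \to\ \mathbb{P}^1\times\mathbb{P}^1$ - I.4(i): $a_0b_0c_2+a_0b_1c_1+a_1b_0c_1+a_1b_1c_0+a_2b_2c_0\ \to\ S_{(1,2)}$ - I.4(iii): $a_2b_0c_0+a_1b_0c_1+a_1b_1c_0+a_0b_1c_1+a_0b_2c_2\ \to\ S_{(0,2)}$ - I.5(i): $a_0b_0c_2+a_0b_2c_0+a_0b_2c_1+a_1b_1c_0+a_2b_0c_1\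 \to\ \mathbb{P}^1\times\mathbb{P}^1$ - I.5(iii): $a_2b_0c_0+a_0b_0c_2+a_1b_0c_2+a_0b_1c_1+a_1b_2c_0\ \to\ S_{(0,2)}$ - I.6(i): $a_0b_0c_2+a_0b_1c_1+a_1b_0c_1+a_1b_2c_0+a_2b_1c_0\ \to\ S_{(1,2)}$ - I.6(iii): $a_2b_0c_0+a_1b_0c_1+a_1b_1c_0+a_0b_1c_2+a_0b_2c_1\ \to\ S_{(0,2)}$ - I.7(i): $a_0b_0c_2+a_0b_1c_1+a_0b_2c_0+a_1b_0c_1+a_2b_1c_0\ \to\ \mathbb{P}^1\times\mathbb{P}^1$ - I.7(ii): $a_0b_0c_2+a_1b_0c_1+a_2b_0c_0+a_0b_1c_1+a_1b_2c_0\ \to\ S_{(0,2)}$ - I.8: $a_0b_0c_2+a_0b_2c_0+a_1b_1c_1+a_2b_0c_0\ \to\ \mathbb{P}^2$ - I.10: $a_0b_0c_2+a_0b_1c_1+a_0b_2c_0+a_1b_0c_1+a_1b_1c_0+a_2b_0c_0\ \to\ \mathbb{P}^2$ - I.11(i): $a_0b_0c_2+a_0b_2c_0+a_1b_0c_1+a_2b_1c_0\ \to\ \mathbb{P}^1\times\mathbb{P}^1$ - I.11(ii): $a_0b_0c_2+a_2b_0c_0+a_0b_1c_1+a_1b_2c_0\ \to\ \mathbb{P}^2$ - I.14(i): $a_0b_0c_2+a_0b_1c_0+a_0b_2c_1+a_1b_0c_0+a_2b_0c_1\ \to\ \mathbb{P}^2$ - I.14(iii): $a_2b_0c_0+a_0b_0c_1+a_1b_0c_2+a_0b_1c_0+a_1b_2c_0\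 \to$ plane conic
   Context: A tensor $T\in V_1\otimes V_2\otimes V_3$ is concise if its three flattening maps $V_1^*\to V_2\otimes V_3$, $V_2^*\to V_1\otimes V_3$, $V_3^*\to V_1\otimes V_2$ (given by contraction) are injective. The image $T(V_1^* )\subseteq V_2\otimes V_3$ is regarded as a $3\times3$ matrix of linear forms on $V_1^*$. $E^1_T\subseteq\mathbb{P}V_1^*$ is the zero scheme of the cubic form $\det(T(V_1^* ))$; ''singular'' means that it is not a smooth plane cubic (this includes the case where the determinant is identically zero). The collineation variety $\mathscr{C}^1_2(T)\subseteq\mathbb{P}(\Lambda^2V_2\otimes\Lambda^2V_3)\simeq\mathbb{P}^8$ is the Zariski closure of the image of the rational map $\mathbb{P}(V_1^* )\dashrightarrow\mathbb{P}(\Lambda^2V_2\otimes\Lambda^2V_3)$ whose coordinates are the $2\times2$ minors of this matrix. Up to linear isomorphism means: up to projective equivalence within its linear span. Swapping the second and third factor is done via a fixed isomorphism $V_2\simeq V_3$. Names of varieties: $\nu_2(\mathbb{P}^2)\subset\mathbb{P}^5$ is the Veronese surface; $S_{(1,2)}\subset\mathbb{P}^4$ is the cubic scroll, the closure of the image of $(x_0,x_1,x_2)\mapsto(x_0x_1,x_0x_2,x_1^2,x_1x_2,x_2^2)$; $\mathbb{P}^1\times\mathbb{P}^1\subset\mathbb{P}^3$ is the smooth quadric surface; $S_{(0,2)}\subset\mathbb{P}^3$ is the cone over a plane conic; $\mathbb{P}^2$ is a linear plane. Semistable and unstable are in the sense of geometric invariant theory for $\mathrm{SL}(V_1)\times\mathrm{SL}(V_2)\times\mathrm{SL}(V_3)$.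 *)

(* Defs.v *)
From mathcomp Require Import all_boot all_order all_algebra.
From mathcomp Require Import mpoly.

Set Implicit Arguments.
Unset Strict Implicit.
Unset Printing Implicit Defensive.

Import GRing.Theory.
Local Open Scope ring_scope.

(* The tensor sum T(i,j,k) a_i (x) b_j (x) c_k in V_1 (x) V_2 (x) V_3, where the
   V_m are identified with K^3 by means of the fixed bases; this also fixes the
   identification V_2 = V_3 used by swap23. *)
Notation tensor K := {ffun 'I_3 * 'I_3 * 'I_3 -> K}.

Section Tensors.
Variable K : fieldType.
Implicit Types (T S : tensor K) (A B C : 'M[K]_3) (x : 'rV[K]_3).

Definition abc (i j k : nat) : tensor K :=
  [ffun t : 'I_3 * 'I_3 * 'I_3 =>
     [&& t.1.1 == i :> nat, t.1.2 == j :> nat & t.2 == k :> nat]%:R].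

Definition tscale (lam : K) T : tensor K := [ffun t => lam * T t].

Definition gact A B C T : tensor K :=
  [ffun t => \sum_i \sum_j \sum_k
     A t.1.1 i * B t.1.2 j * C t.2 k * T (i, j, k)].

Definition swap23 T : tensor K := [ffun t => T (t.1.1, t.2, t.1.2)].

Definition equiv_up_to_swap T S : Prop :=
  exists A B C, [/\ A \in unitmx, B \in unitmx, C \in unitmx &
    S = gact A B C T \/ S = gact A B C (swap23 T)].

(* The three flattenings; x holds the coordinates of a linear form in the dual
   basis. *)
Definition contr1 T x : 'M[K]_3 := \matrix_(j, k) \sum_i x 0 i * T (i, j, k).
Definition contr2 T x : 'M[K]_3 := \matrix_(i, k) \sum_j x 0 j * T (i, j, k).
Definition contr3 T x : 'M[K]_3 := \matrix_(i, j) \sum_k x 0 k * T (i, j, k).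

Definition concise T : Prop :=
  [/\ injective (contr1 T), injective (contr2 T) & injective (contr3 T)].

Definition det_form T : {mpoly K[3]} :=
  \det (\matrix_(j < 3, k < 3) \sum_(i < 3) T (i, j, k) *: 'X_i).

(* Jacobian criterion, for K algebraically closed. *)
Definition smooth_plane_curve (f : {mpoly K[3]}) : Prop :=
  f != 0 /\
  forall x, x != 0 -> f.@[x 0] = 0 -> exists i : 'I_3, (f^`M(i)).@[x 0] != 0.

Definition E1_singular T : Prop := ~ smooth_plane_curve (det_form T).

Definition teval (p : {mpoly K[#|{: 'I_3 * 'I_3 * 'I_3}|]}) T : K :=
  p.@[fun n => T (enum_val n)].

Definition SL_invariant (p : {mpoly K[#|{: 'I_3 * 'I_3 * 'I_3}|]}) : Prop :=
  forall A B C T, \det A = 1 -> \det B = 1 -> \det C = 1 ->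
    teval p (gact A B C T) = teval p T.

Definition semistable T : Prop :=
  exists d p, [/\ (0 < d)%N, p \is d.-homog, SL_invariant p & teval p T != 0].

Definition unstable T : Prop := ~ semistable T.

End Tensors.

Arguments abc {K} i j k.

(* A subset of the projective space P(K^n) is represented by the set of the
   nonzero vectors of K^n lying over it. *)
Section Projective.
Variable K : fieldType.

Definition zariski_closure n (S : 'rV[K]_n -> Prop) (y : 'rV[K]_n) : Prop :=
  y != 0 /\
  forall d (p : {mpoly K[n]}), p \is d.-homog ->
    (forall z, S z -> p.@[z 0] = 0) -> p.@[y 0] = 0.

(* Closure of the image of the rational map P(K^m) --> P(K^n) given by f, which
   is undefined where f vanishes. *)
Definition closed_image m n (f : 'rV[K]_m -> 'rV[K]_n) : 'rV[K]_n -> Prop :=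
  zariski_closure (fun y => y != 0 /\ exists x, y = f x).

Definition minors (T : tensor K) (x : 'rV[K]_3) : 'rV[K]_(3 * 3) :=
  mxvec (\matrix_(j, k) \det (row' j (col' k (contr1 T x)))).

Definition collineation_variety (T : tensor K) : 'rV[K]_(3 * 3) -> Prop :=
  closed_image (minors T).

Definition linear_span n (X : 'rV[K]_n -> Prop) (v : 'rV[K]_n) : Prop :=
  exists k (c : 'I_k -> K) (y : 'I_k -> 'rV[K]_n),
    (forall i, X (y i)) /\ v = \sum_i c i *: y i.

(* Some linear map, injective on the span of X, carries X onto Y. *)
Definition linearly_isomorphic m n
    (X : 'rV[K]_m -> Prop) (Y : 'rV[K]_n -> Prop) : Prop :=
  exists A : 'M[K]_(m, n),
    (forall v, linear_span X v -> v *m A = 0 -> v = 0) /\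
    (forall y, Y y <-> exists2 x, X x & y = x *m A).

Definition veronese_map (x : 'rV[K]_3) : 'rV[K]_6 :=
  let x0 := x 0 0 in let x1 := x 0 1 in let x2 := x 0 2 in
  \row_i [:: x0 ^+ 2; x0 * x1; x0 * x2; x1 ^+ 2; x1 * x2; x2 ^+ 2]`_i.

Definition veronese_surface (y : 'rV[K]_6) : Prop :=
  exists x (c : K), [/\ x != 0, c != 0 & y = c *: veronese_map x].

Definition scroll_map (x : 'rV[K]_3) : 'rV[K]_5 :=
  let x0 := x 0 0 in let x1 := x 0 1 in let x2 := x 0 2 in
  \row_i [:: x0 * x1; x0 * x2; x1 ^+ 2; x1 * x2; x2 ^+ 2]`_i.

Definition cubic_scroll : 'rV[K]_5 -> Prop := closed_image scroll_map.

Definition segre_quadric (y : 'rV[K]_(2 * 2)) : Prop :=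
  exists s t : 'rV[K]_2, [/\ s != 0, t != 0 & y = mxvec (s^T *m t)].

Definition quadric_cone (y : 'rV[K]_4) : Prop :=
  y != 0 /\ y 0 0 * y 0 2 = y 0 1 ^+ 2.

Definition plane (y : 'rV[K]_3) : Prop := y != 0.

Definition plane_conic (y : 'rV[K]_3) : Prop :=
  y != 0 /\ y 0 0 * y 0 2 = y 0 1 ^+ 2.

End Projective.

Variant label : Set :=
  | III_1 | III_2 | III_ps | IV_1_i | IV_1_ii | IV_1_iii | IV_2_i | IV_2_iii
  | IV_2_vi | IV_4_i | IV_4_ii | IV_4_iii | IV_5_i | IV_5_ii | IV_7_i
  | IV_ps | V_1 | V_2 | V_3 | V_4 | V_5 | V_ps | I_1_i | I_1_ii | I_2_i
  | I_2_iii | I_3_i | I_3_iii | I_4_i | I_4_iii | I_5_i | I_5_iii | I_6_i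
  | I_6_iii | I_7_i | I_7_ii | I_8 | I_10 | I_11_i | I_11_ii | I_14_i
  | I_14_iii.

Section Table.
Variable K : fieldType.

Definition tensor_u : tensor K := abc 0 0 0 + abc 1 1 1 + abc 2 2 2.
Definition tensor_w : tensor K := abc 0 1 2 + abc 2 0 1 + abc 1 2 0.
Definition tensor_v : tensor K :=
  abc 0 1 2 + abc 1 2 0 + abc 2 0 1 - (abc 0 2 1 + abc 1 0 2 + abc 2 1 0).

(* lam is used by the family III only. *)
Definition normal_form (lam : K) (l : label) : tensor K :=
  match l with
  | III_1 => tensor_u + tscale lam tensor_w + abc 0 2 1 + abc 1 0 2
  | III_2 => tensor_u + tscale lam tensor_w + abc 0 2 1
  | III_ps => tensor_u + tscale lam tensor_w
  | IV_1_i => tensor_u + abc 0 1 2 + abc 0 2 1 + abc 1 0 2 + abc 1 2 0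
  | IV_1_ii => tensor_u + abc 1 0 2 + abc 2 0 1 + abc 0 1 2 + abc 2 1 0
  | IV_1_iii => tensor_u + abc 2 1 0 + abc 1 2 0 + abc 2 0 1 + abc 0 2 1
  | IV_2_i => tensor_u + abc 0 1 2 + abc 0 2 1 + abc 1 0 2
  | IV_2_iii => tensor_u + abc 1 0 2 + abc 2 0 1 + abc 0 1 2
  | IV_2_vi => tensor_u + abc 2 1 0 + abc 1 2 0 + abc 2 0 1
  | IV_4_i => tensor_u + abc 0 1 2 + abc 0 2 1
  | IV_4_ii => tensor_u + abc 1 0 2 + abc 2 0 1
  | IV_4_iii => tensor_u + abc 2 1 0 + abc 1 2 0
  | IV_5_i => tensor_u + abc 0 1 2 + abc 1 2 0
  | IV_5_ii => tensor_u + abc 1 0 2 + abc 2 1 0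
  | IV_7_i => tensor_u + abc 0 1 2
  | IV_ps => tensor_u
  | V_1 => tensor_v + abc 0 0 0 + abc 1 1 2 + abc 1 2 1 + abc 2 1 1
  | V_2 => tensor_v + abc 0 0 1 + abc 0 1 0 + abc 1 0 0 + abc 1 1 2
      + abc 1 2 1 + abc 2 1 1
  | V_3 => tensor_v + abc 0 0 0 + abc 1 1 1
  | V_4 => tensor_v + abc 0 0 1 + abc 0 1 0 + abc 1 0 0
  | V_5 => tensor_v + abc 0 0 0
  | V_ps => tensor_v
  | I_1_i => abc 0 1 2 + abc 0 2 1 + abc 1 0 2 + abc 1 1 1 + abc 1 2 0
      + abc 2 0 0
  | I_1_ii => abc 1 0 2 + abc 2 0 1 + abc 0 1 2 + abc 1 1 1 + abc 2 1 0
      + abc 0 2 0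
  | I_2_i => abc 0 1 2 + abc 0 2 1 + abc 1 0 2 + abc 1 1 0 + abc 1 1 1
      + abc 2 0 0
  | I_2_iii => abc 2 0 1 + abc 1 0 2 + abc 2 1 0 + abc 0 1 1 + abc 1 1 1
      + abc 0 2 0
  | I_3_i => abc 0 0 2 + abc 0 1 1 + abc 0 2 0 + abc 1 0 1 + abc 1 1 2
      + abc 2 0 0
  | I_3_iii => abc 2 0 0 + abc 1 0 1 + abc 0 0 2 + abc 1 1 0 + abc 2 1 1
      + abc 0 2 0
  | I_4_i => abc 0 0 2 + abc 0 1 1 + abc 1 0 1 + abc 1 1 0 + abc 2 2 0
  | I_4_iii => abc 2 0 0 + abc 1 0 1 + abc 1 1 0 + abc 0 1 1 + abc 0 2 2
  | I_5_i => abc 0 0 2 + abc 0 2 0 + abc 0 2 1 + abc 1 1 0 + abc 2 0 1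
  | I_5_iii => abc 2 0 0 + abc 0 0 2 + abc 1 0 2 + abc 0 1 1 + abc 1 2 0
  | I_6_i => abc 0 0 2 + abc 0 1 1 + abc 1 0 1 + abc 1 2 0 + abc 2 1 0
  | I_6_iii => abc 2 0 0 + abc 1 0 1 + abc 1 1 0 + abc 0 1 2 + abc 0 2 1
  | I_7_i => abc 0 0 2 + abc 0 1 1 + abc 0 2 0 + abc 1 0 1 + abc 2 1 0
  | I_7_ii => abc 0 0 2 + abc 1 0 1 + abc 2 0 0 + abc 0 1 1 + abc 1 2 0
  | I_8 => abc 0 0 2 + abc 0 2 0 + abc 1 1 1 + abc 2 0 0
  | I_10 => abc 0 0 2 + abc 0 1 1 + abc 0 2 0 + abc 1 0 1 + abc 1 1 0
      + abc 2 0 0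
  | I_11_i => abc 0 0 2 + abc 0 2 0 + abc 1 0 1 + abc 2 1 0
  | I_11_ii => abc 0 0 2 + abc 2 0 0 + abc 0 1 1 + abc 1 2 0
  | I_14_i => abc 0 0 2 + abc 0 1 0 + abc 0 2 1 + abc 1 0 0 + abc 2 0 1
  | I_14_iii => abc 2 0 0 + abc 0 0 1 + abc 1 0 2 + abc 0 1 0 + abc 1 2 0
  end.

Definition recorded_variety (l : label) (X : 'rV[K]_(3 * 3) -> Prop) : Prop :=
  match l with
  | III_1 | III_2 | III_ps | IV_1_ii | IV_1_iii | IV_2_iii | V_1 | V_2
  | V_3 | V_4 | V_5 | V_ps | I_1_ii | I_2_iii =>
      linearly_isomorphic (@veronese_surface K) X
  | IV_1_i | IV_2_i | IV_2_vi | IV_4_ii | IV_4_iii | IV_5_i | IV_5_ii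
  | I_1_i | I_2_i | I_3_i | I_4_i | I_6_i =>
      linearly_isomorphic (@cubic_scroll K) X
  | IV_4_i | IV_7_i | I_3_iii | I_5_i | I_7_i | I_11_i =>
      linearly_isomorphic (@segre_quadric K) X
  | I_4_iii | I_5_iii | I_6_iii | I_7_ii =>
      linearly_isomorphic (@quadric_cone K) X
  | IV_ps | I_8 | I_10 | I_11_ii | I_14_i =>
      linearly_isomorphic (@plane K) X
  | I_14_iii =>
      linearly_isomorphic (@plane_conic K) X
  end.

End Table.

Definition semistable_label (l : label) : bool :=
  match l with
  | I_1_i | I_1_ii | I_2_i | I_2_iii | I_3_i | I_3_iii | I_4_i | I_4_iii
  | I_5_i | I_5_iii | I_6_i | I_6_iii | I_7_i | I_7_ii | I_8 | I_10
  | I_11_i | I_11_ii | I_14_i | I_14_iii => false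
  | _ => true
  end.

(* Main.v *)
Require Import Defs.
From HB Require Import structures.
From Stdlib Require Import Classical.
From mathcomp Require Import all_boot all_order all_algebra.
From mathcomp Require Import perm reals complex mpoly mxtens ring.

(** Regard T as the net x |-> contr1 T x of 3 x 3 matrices, up to linear
    substitutions, row and column operations and transposition.  A singular
    E1_T has a singular point, which is moved to e0; its matrix is not zero,
    since T is concise.  If it has rank one, x0 only occurs in one corner of the
    net, and the pencil of complementary 2 x 2 blocks in x1, x2 directs the case
    analysis.  If it has rank two, the net is x0 diag(1, 1, 0) plus a pencil in
    x1, x2, and singularity of the determinant at e0 kills the last diagonal
    entry; the last column and the last row are then normalized.

    The 2 x 2 minors of a normal form are expressed linearly, and injectively,
    in the coordinates of a parametrization of the recorded variety.

    A one-parameter subgroup carries a tensor of an unstable family to 0, and one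
    of a semistable family to u + lam w, u or v.  At these limits either an
    invariant of degree 6 or Strassen's invariant of degree 9 does not vanish:
    the first is a multiple of 1 - 10 lam^3 + lam^6 at u + lam w, the second
    vanishes at u + lam w only if lam (1 - lam^3) = 0. *)

Set Implicit Arguments.
Unset Strict Implicit.
Unset Printing Implicit Defensive.
Import Order.TTheory GRing.Theory Num.Theory.
Local Open Scope ring_scope.

(** * Explicit 3 x 3 matrices *)

Section Matrices.
Variable K : fieldType.

(** A point of rank one is used without any singularity condition; at a point of rank two, diag(1,
    1, 0), the derivative of the determinant in a direction Q is the entry Q 2 2. There, if the two
    forms in the last column are independent, they are taken as x1 and x2, and the last row becomes
    a bilinear form R on (x1, x2), up to congruence. If R is antidiagonal with entries 1 and mu, 1 +
    mu != 0, the net falls in family III when mu != 0, with lam a cube root of mu, and in family IV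
    when mu = 0. If R is skew-symmetric up to one diagonal entry, the net is a skew-symmetric matrix
    plus the second derivatives of a cubic, and the type of this cubic selects the member of family
    V. Degenerate configurations contradict conciseness, fall back on a point of rank one, or leave
    a few coefficients that scale to 0 or 1. Algebraic closure provides the points where these
    quadratic and cubic forms vanish, and the square and cube roots by which diagonal scalings
    normalize the surviving coefficients. Varieties and stability are computed on the normal forms,
    for every nonzero lam, and transported to T. *)

Definition mx3 (a b c d e f g h i : K) : 'M[K]_3 :=
  \matrix_(r, s) nth 0 (nth [::] [:: [:: a; b; c]; [:: d; e; f]; [:: g; h; i]] r) s.

Definition row3 (a b c : K) : 'rV[K]_3 := \row_s [:: a; b; c]`_s.

Lemma ord3P (P : 'I_3 -> Prop) : P 0 -> P 1 -> P 2 -> forall i, P i.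
Proof.
move=> P0 P1 P2 [[|[|[|//]]] lt_i].
- by rewrite (_ : Ordinal _ = 0) //; apply: val_inj.
- by rewrite (_ : Ordinal _ = 1) //; apply: val_inj.
- by rewrite (_ : Ordinal _ = 2) //; apply: val_inj.
Qed.

Lemma big_ord3 (R : nmodType) (F : 'I_3 -> R) : \sum_i F i = F 0 + F 1 + F 2.
Proof.
rewrite !big_ord_recl big_ord0 addr0 addrA.
by congr (_ + F _ + F _); apply: val_inj.
Qed.

Lemma mx3E (M : 'M[K]_3) : M = mx3 (M 0 0) (M 0 1) (M 0 2)
  (M 1 0) (M 1 1) (M 1 2) (M 2 0) (M 2 1) (M 2 2).
Proof. by apply/matrixP; do 2!elim/ord3P; rewrite mxE. Qed.

Lemma row3E (x : 'rV[K]_3) : x = row3 (x 0 0) (x 0 1) (x 0 2).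
Proof. by apply/rowP; elim/ord3P; rewrite mxE. Qed.

Lemma mul_mx3 a b c d e f g h i a' b' c' d' e' f' g' h' i' :
  mx3 a b c d e f g h i *m mx3 a' b' c' d' e' f' g' h' i' =
  mx3 (a * a' + b * d' + c * g') (a * b' + b * e' + c * h') (a * c' + b * f' + c * i')
      (d * a' + e * d' + f * g') (d * b' + e * e' + f * h') (d * c' + e * f' + f * i')
      (g * a' + h * d' + i * g') (g * b' + h * e' + i * h') (g * c' + h * f' + i * i').
Proof.
by apply/matrixP; do 2!elim/ord3P; rewrite mxE big_ord3 !mxE.
Qed.

Lemma mul_row3 x y z a b c d e f g h i : row3 x y z *m mx3 a b c d e f g h i =
  row3 (x * a + y * d + z * g) (x * b + y * e + z * h) (x * c + y * f + z * i).
Proof. by apply/rowP; elim/ord3P; rewrite mxE big_ord3 !mxE. Qed.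

Lemma tr_mx3 a b c d e f g h i :
  (mx3 a b c d e f g h i)^T = mx3 a d g b e h c f i.
Proof. by apply/matrixP; do 2!elim/ord3P; rewrite !mxE. Qed.

Lemma det3 (R : comNzRingType) (M : 'M[R]_3) : \det M =
    M 0 0 * (M 1 1 * M 2 2 - M 1 2 * M 2 1)
  - M 0 1 * (M 1 0 * M 2 2 - M 1 2 * M 2 0)
  + M 0 2 * (M 1 0 * M 2 1 - M 1 1 * M 2 0).
Proof.
rewrite (expand_det_row M 0) big_ord3 /cofactor.
rewrite !(expand_det_row _ ord0) !big_ord_recl !big_ord0 /cofactor !det_mx11 !mxE /=.
rewrite !(expr0, expr1, mul1r, addr0, expr2, mulrNN, mulN1r, mulNr).
(* The expansion produces different terms for the same index; reading entries through natural
   numbers lets [ring] identify them. *)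
pose m (a b : nat) := M (inord a) (inord b).
have E i j : M i j = m i j by rewrite /m !inord_val.
by rewrite !E /= /bump /=; ring.
Qed.

Lemma det_mx3 a b c d e f g h i : \det (mx3 a b c d e f g h i) =
  a * (e * i - f * h) - b * (d * i - f * g) + c * (d * h - e * g).
Proof. by rewrite det3 !mxE. Qed.

End Matrices.

(** * Nets of matrices *)

Section Nets.
Variable K : fieldType.

(** The nets of the normal forms, written out once so that all later computations with them are
    identities between explicit entries; [contr1_nf] certifies the table. *)
Definition nf_mx (lam : K) (l : label) (x0 x1 x2 : K) : 'M[K]_3 :=
  match l with
  | III_1 => mx3 x0 (lam * x2) x1  0 x1 (lam * x0)  (lam * x1) x0 x2
  | III_2 => mx3 x0 (lam * x2) 0  0 x1 (lam * x0)  (lam * x1) x0 x2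
  | III_ps => mx3 x0 (lam * x2) 0  0 x1 (lam * x0)  (lam * x1) 0 x2
  | IV_1_i => mx3 x0 0 x1  0 x1 x0  x1 x0 x2
  | IV_1_ii => mx3 x0 x2 x1  x2 x1 x0  0 0 x2
  | IV_1_iii => mx3 x0 x2 0  x2 x1 0  x1 x0 x2
  | IV_2_i => mx3 x0 0 x1  0 x1 x0  0 x0 x2
  | IV_2_iii => mx3 x0 x2 x1  0 x1 x0  0 0 x2
  | IV_2_vi => mx3 x0 x2 0  x2 x1 0  x1 0 x2
  | IV_4_i => mx3 x0 0 0  0 x1 x0  0 x0 x2
  | IV_4_ii => mx3 x0 x2 x1  0 x1 0  0 0 x2
  | IV_4_iii => mx3 x0 0 0  x2 x1 0  x1 0 x2
  | IV_5_i => mx3 x0 0 0  0 x1 x0  x1 0 x2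
  | IV_5_ii => mx3 x0 0 x1  x2 x1 0  0 0 x2
  | IV_7_i => mx3 x0 0 0  0 x1 x0  0 0 x2
  | IV_ps => mx3 x0 0 0  0 x1 0  0 0 x2
  | V_1 => mx3 x0 x2 (- x1)  (- x2) x2 (x0 + x1)  x1 (- x0 + x1) 0
  | V_2 => mx3 x1 (x0 + x2) (- x1)  (x0 - x2) x2 (x0 + x1)  x1 (- x0 + x1) 0
  | V_3 => mx3 x0 x2 (- x1)  (- x2) x1 x0  x1 (- x0) 0
  | V_4 => mx3 x1 (x0 + x2) (- x1)  (x0 - x2) 0 x0  x1 (- x0) 0
  | V_5 => mx3 x0 x2 (- x1)  (- x2) 0 x0  x1 (- x0) 0
  | V_ps => mx3 0 x2 (- x1)  (- x2) 0 x0  x1 (- x0) 0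
  | I_1_i => mx3 x2 0 x1  0 x1 x0  x1 x0 0
  | I_1_ii => mx3 0 x2 x1  x2 x1 x0  x0 0 0
  | I_2_i => mx3 x2 0 x1  x1 x1 x0  0 x0 0
  | I_2_iii => mx3 0 x2 x1  x2 (x0 + x1) 0  x0 0 0
  | I_3_i => mx3 x2 x1 x0  0 x0 x1  x0 0 0
  | I_3_iii => mx3 x2 x1 x0  x1 x2 0  x0 0 0
  | I_4_i => mx3 0 x1 x0  x1 x0 0  x2 0 0
  | I_4_iii => mx3 x2 x1 0  x1 x0 0  0 0 x0
  | I_5_i => mx3 0 x2 x0  x1 0 0  x0 x0 0
  | I_5_iii => mx3 x2 0 (x0 + x1)  0 x0 0  x1 0 0
  | I_6_i => mx3 0 x1 x0  x2 x0 0  x1 0 0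
  | I_6_iii => mx3 x2 x1 0  x1 0 x0  0 x0 0
  | I_7_i => mx3 0 x1 x0  x2 x0 0  x0 0 0
  | I_7_ii => mx3 x2 x1 x0  0 x0 0  x1 0 0
  | I_8 => mx3 x2 0 x0  0 x1 0  x0 0 0
  | I_10 => mx3 x2 x1 x0  x1 x0 0  x0 0 0
  | I_11_i => mx3 0 x1 x0  x2 0 0  x0 0 0
  | I_11_ii => mx3 x2 0 x0  0 x0 0  x1 0 0
  | I_14_i => mx3 x1 x2 x0  x0 0 0  0 x0 0
  | I_14_iii => mx3 x2 x0 x1  x0 0 0  x1 0 0
  end.

Lemma contr1D (S T : tensor K) x : contr1 (S + T) x = contr1 S x + contr1 T x.
Proof.
apply/matrixP => j k; rewrite !mxE -big_split; apply: eq_bigr => i _ /=.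
by rewrite ffunE mulrDr.
Qed.

Lemma contr1Z a (T : tensor K) x : contr1 (tscale a T) x = a *: contr1 T x.
Proof.
apply/matrixP => j k; rewrite !mxE mulr_sumr; apply: eq_bigr => i _ /=.
by rewrite ffunE mulrCA.
Qed.

Lemma contr1N (T : tensor K) x : contr1 (- T) x = - contr1 T x.
Proof.
apply/matrixP => j k; rewrite !mxE -sumrN; apply: eq_bigr => i _ /=.
by rewrite ffunE mulrN.
Qed.

Lemma contr1_abc i j k (x : 'rV[K]_3) : (i < 3)%N ->
  let e a b := if (j == a) && (k == b) then x 0 (inord i) else 0 in
  contr1 (abc i j k) x =
    mx3 (e 0 0) (e 0 1) (e 0 2) (e 1 0) (e 1 1) (e 1 2) (e 2 0) (e 2 1) (e 2 2).
Proof.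
move=> lti e; apply/matrixP => a b; rewrite !mxE (bigD1 (inord i)) //= big1 => [|c ne]; last first.
  rewrite ffunE /= [_ == i :> nat](_ : _ = false) ?mulr0 //.
  by apply: contraNF ne => /eqP <-; rewrite inord_val.
rewrite ffunE /= inordK // eqxx /= addr0 [_ == j]eq_sym [_ == k]eq_sym.
by move: a b; do 2!elim/ord3P; rewrite /e /=; case: ifP; rewrite ?mulr1 ?mulr0.
Qed.

Lemma add_mx3 a b c d e f g h i a' b' c' d' e' f' g' h' i' :
  mx3 a b c d e f g h i + mx3 a' b' c' d' e' f' g' h' i' =
  mx3 (a + a') (b + b') (c + c') (d + d') (e + e') (f + f') (g + g') (h + h') (i + i') :> 'M[K]_3.
Proof. by apply/matrixP; do 2!elim/ord3P; rewrite !mxE. Qed.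

Lemma scale_mx3 t a b c d e f g h i : t *: mx3 a b c d e f g h i =
  mx3 (t * a) (t * b) (t * c) (t * d) (t * e) (t * f) (t * g) (t * h) (t * i) :> 'M[K]_3.
Proof. by apply/matrixP; do 2!elim/ord3P; rewrite !mxE. Qed.

Lemma opp_mx3 a b c d e f g h i : - mx3 a b c d e f g h i =
  mx3 (- a) (- b) (- c) (- d) (- e) (- f) (- g) (- h) (- i) :> 'M[K]_3.
Proof. by apply/matrixP; do 2!elim/ord3P; rewrite !mxE. Qed.

Lemma inord3 : [/\ inord 0 = 0 :> 'I_3, inord 1 = 1 :> 'I_3 & inord 2 = 2 :> 'I_3].
Proof. by split; apply: val_inj; rewrite /= inordK. Qed.

Lemma contr1_nf lam l (x : 'rV[K]_3) :
  contr1 (normal_form lam l) x = nf_mx lam l (x 0 0) (x 0 1) (x 0 2).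
Proof.
have [i0 i1 i2] := inord3.
case: l; rewrite /= !(contr1D, contr1N, contr1Z) !contr1_abc //= ?(i0, i1, i2);
  rewrite !(add_mx3, scale_mx3, opp_mx3) ?(mulr0, oppr0, addr0, add0r) //;
  congr mx3; ring.
Qed.
End Nets.

(** * Equivalence of nets and reduction of the classification to nets *)

Section Equivalence.
Variable K : fieldType.
Implicit Types (T S : tensor K) (A B C : 'M[K]_3).
Notation net := ('rV[K]_3 -> 'M[K]_3).
Implicit Types f g : net.

Lemma contr1_gact A B C T x :
  contr1 (gact A B C T) x = B *m contr1 T (x *m A) *m C^T.
Proof.
apply/matrixP => j k; rewrite mxE big_ord3 !ffunE !big_ord3 /=.
by do 3!rewrite !mxE !big_ord3; rewrite !mxE !big_ord3; ring.
Qed.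

Lemma contr1_swap23 T x : contr1 (swap23 T) x = (contr1 T x)^T.
Proof. by apply/matrixP => j k; rewrite !mxE; apply: eq_bigr => i _; rewrite ffunE. Qed.

Lemma contr1_inj T S : (forall x, contr1 T x = contr1 S x) -> T = S.
Proof.
move=> e; apply/ffunP => -[[i j] k].
have /matrixP/(_ j k) := e (delta_mx 0 i); rewrite !mxE.
rewrite (bigD1 i) //= [X in _ = X -> _](bigD1 i) //= !big1 => [| a ne | a ne]; last 2 first.
- by rewrite mxE (negPf ne) andbF mul0r.
- by rewrite mxE (negPf ne) andbF mul0r.
by rewrite mxE !eqxx !mul1r !addr0.
Qed.

(* The net of matrices [contr1 T] carries the action of the three groups as a
   substitution in x and as row and column operations. *)
Definition net_equiv f g := exists A B C,
  [/\ A \in unitmx, B \in unitmx, C \in unitmx &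
    (forall x, g x = B *m f (x *m A) *m C) \/
    (forall x, g x = B *m (f (x *m A))^T *m C)].

Lemma net_equiv_tensor T S :
  net_equiv (contr1 T) (contr1 S) -> equiv_up_to_swap T S.
Proof.
move=> [A [B [C [uA uB uC h]]]]; exists A, B, C^T; split; rewrite ?unitmx_tr //.
by case: h => h; [left|right]; apply: contr1_inj => x;
  rewrite h contr1_gact ?contr1_swap23 trmxK.
Qed.

Definition listed f := exists lam l, lam != 0 /\ net_equiv f (contr1 (normal_form lam l)).

(** Injectivity of the second and third flattenings becomes: no fixed row or column vector is
    annihilated by the whole net. *)
Definition concise_net f := [/\ forall x, f x = 0 -> x = 0,
  forall u : 'rV_3, (forall x, u *m f x = 0) -> u = 0 &
  forall u : 'cV_3, (forall x, f x *m u = 0) -> u = 0].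

(** Conciseness is part of the predicate, so that reductions carry it along silently and a
    degenerate net is classified vacuously. *)
Definition classified f := concise_net f -> listed f.

(** Used backwards: to classify f, pass to a simpler equivalent net g. Conciseness goes from f to g,
    and the normal form of g comes back to f. *)
Lemma classified_act A B C f g :
  A \in unitmx -> B \in unitmx -> C \in unitmx ->
  (forall x, g x = B *m f (x *m A) *m C) -> classified g -> classified f.
Proof.
move=> uA uB uC e cg [c1 c2 c3].
have eA x : f x = invmx B *m g (x *m invmx A) *m invmx C.
  by rewrite e mulmxKV // !mulmxA mulVmx // mul1mx mulmxK.
have {}/cg [lam [l [nz [A' [B' [C' [uA' uB' uC' h]]]]]]] : concise_net g.
  split=> [x|u|u].
  - rewrite e => z; have /c1 : f (x *m A) = 0.
      by rewrite -[f _](mulKmx uB) -[_ *m f _](mulmxK uC) z mul0mx mulmx0.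
    by move/(congr1 (mulmx^~ (invmx A))); rewrite mulmxK // mul0mx.
  - move=> z; suff /c2 : forall x, u *m B *m f x = 0.
      by move/(congr1 (mulmx^~ (invmx B))); rewrite mulmxK // mul0mx.
    by move=> x; rewrite eA !mulmxA mulmxK // z mul0mx.
  - move=> z; suff /c3 : forall x, f x *m (C *m u) = 0.
      by move/(congr1 (mulmx (invmx C))); rewrite mulKmx // mulmx0.
    by move=> x; rewrite eA -!mulmxA mulKmx // z mulmx0.
exists lam, l; split=> //; case: h => h.
  exists (A' *m A), (B' *m B), (C *m C'); rewrite !unitmx_mul; split; try exact/andP.
  by left=> x; rewrite h e !mulmxA.
(* Transposing the net exchanges the row and column operations. *)
exists (A' *m A), (B' *m C^T), (B^T *m C'); rewrite !unitmx_mul !unitmx_tr.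
split; try exact/andP.
by right=> x; rewrite h e !trmx_mul !mulmxA.
Qed.

Lemma classified_tr f g : (forall x, g x = (f x)^T) -> classified g -> classified f.
Proof.
move=> e cg [c1 c2 c3].
have {}/cg [lam [l [nz [A' [B' [C' [uA' uB' uC' h]]]]]]] : concise_net g.
  split=> [x|u z|u z].
  - by rewrite e => /(congr1 trmx); rewrite trmxK trmx0 => /c1.
  - apply: trmx_inj; rewrite trmx0; apply: c3 => x.
    by apply: trmx_inj; rewrite trmx_mul -e trmxK z trmx0.
  - apply: trmx_inj; rewrite trmx0; apply: c2 => x.
    by apply: trmx_inj; rewrite trmx_mul -e trmxK z trmx0.
exists lam, l; split=> //; exists A', B', C'; split=> //.
by case: h => h; [right|left] => x; rewrite h e ?trmxK.
Qed.

Lemma classified_nf A B C lam l f : lam != 0 ->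
  A \in unitmx -> B \in unitmx -> C \in unitmx ->
  (forall x, contr1 (normal_form lam l) x = B *m f (x *m A) *m C) -> classified f.
Proof. by move=> nz uA uB uC h _; exists lam, l; split=> //; exists A, B, C; split=> //; left. Qed.

(** Nets as functions of three scalars: equivalences then reduce to nine polynomial identities
    between entries. *)
Definition form3 (F : K -> K -> K -> 'M[K]_3) : net :=
  fun x => F (x 0 0) (x 0 1) (x 0 2).

Lemma classified_step A B C F G :
  A \in unitmx -> B \in unitmx -> C \in unitmx ->
  (forall x0 x1 x2, let y := row3 x0 x1 x2 *m A in
    G x0 x1 x2 = B *m F (y 0 0) (y 0 1) (y 0 2) *m C) ->
  classified (form3 G) -> classified (form3 F).
Proof.
move=> uA uB uC h; apply: (classified_act uA uB uC) => x.
by rewrite /form3 h /= -row3E.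
Qed.

Lemma classified_form_nf A B C lam l F : lam != 0 ->
  A \in unitmx -> B \in unitmx -> C \in unitmx ->
  (forall x0 x1 x2, let y := row3 x0 x1 x2 *m A in
    nf_mx lam l x0 x1 x2 = B *m F (y 0 0) (y 0 1) (y 0 2) *m C) ->
  classified (form3 F).
Proof.
move=> nz uA uB uC h; apply: (classified_nf nz uA uB uC (l := l)) => x.
by rewrite contr1_nf /form3 h /= -row3E.
Qed.

End Equivalence.

(** * Vacuous cases, roots, and tactics for explicit reductions *)

Section Tools.
Variable K : numClosedFieldType.

(* Row [i] of [pmx a b c] selects coordinate [i] among [a, b, c]: the matrix of
   a permutation of the coordinates. *)
Definition pmx (a b c : nat) : 'M[K]_3 :=
  mx3 (a == 0)%:R (b == 0)%:R (c == 0)%:R (a == 1)%:R (b == 1)%:R (c == 1)%:R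
      (a == 2)%:R (b == 2)%:R (c == 2)%:R.

Definition dmx (a b c : K) := mx3 a 0 0  0 b 0  0 0 c.

Lemma row3_coord (a b c : K) :
  ((row3 a b c 0 0 = a) * (row3 a b c 0 1 = b) * (row3 a b c 0 2 = c))%type.
Proof. by split; [split|]; rewrite mxE. Qed.

Lemma mx3_unit (a b c d e f g h i : K) :
  a * (e * i - f * h) - b * (d * i - f * g) + c * (d * h - e * g) != 0 ->
  mx3 a b c d e f g h i \in unitmx.
Proof. by rewrite unitmxE unitfE det_mx3. Qed.

Lemma classified_form_tr (F G : K -> K -> K -> 'M[K]_3) :
  (forall x0 x1 x2, G x0 x1 x2 = (F x0 x1 x2)^T) ->
  classified (form3 G) -> classified (form3 F).
Proof. by move=> e; apply: classified_tr => x; rewrite /form3 e. Qed.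

(** Such a net is not concise. This lemma and the next two dispose of the degenerate branches, one
    for each flattening. *)
Lemma classified_dep_col (F : K -> K -> K -> 'M[K]_3) u0 u1 u2 :
  [|| u0 != 0, u1 != 0 | u2 != 0] ->
  (forall x0 x1 x2, F x0 x1 x2 *m (row3 u0 u1 u2)^T = 0) -> classified (form3 F).
Proof.
move=> nz z [_ _ c3]; suff /rowP e : row3 u0 u1 u2 = 0.
  move: nz; have := e 0; have := e 1; have := e 2; rewrite !mxE /=.
  by move=> -> -> ->; rewrite eqxx.
by apply: trmx_inj; rewrite trmx0; apply: c3 => x; apply: z.
Qed.

Lemma classified_dep_row (F : K -> K -> K -> 'M[K]_3) u0 u1 u2 :
  [|| u0 != 0, u1 != 0 | u2 != 0] ->
  (forall x0 x1 x2, row3 u0 u1 u2 *m F x0 x1 x2 = 0) -> classified (form3 F).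
Proof.
move=> nz z [_ c2 _]; suff /rowP e : row3 u0 u1 u2 = 0.
  move: nz; have := e 0; have := e 1; have := e 2; rewrite !mxE /=.
  by move=> -> -> ->; rewrite eqxx.
by apply: c2 => x; apply: z.
Qed.

Lemma classified_dep_var (F : K -> K -> K -> 'M[K]_3) u0 u1 u2 :
  [|| u0 != 0, u1 != 0 | u2 != 0] -> F u0 u1 u2 = 0 -> classified (form3 F).
Proof.
move=> nz z [c1 _ _]; suff /rowP e : row3 u0 u1 u2 = 0.
  move: nz; have := e 0; have := e 1; have := e 2; rewrite !mxE /=.
  by move=> -> -> ->; rewrite eqxx.
by apply: c1; rewrite /form3 !row3_coord.
Qed.

(** A coefficient is split into a unit, to be absorbed by rescaling, and a boolean, which leaves
    finitely many nets to list. *)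
Lemma indicator_factor (a : K) : exists2 u : K, u != 0 & exists e : bool, a = u * e%:R.
Proof.
have [->|nz] := eqVneq a 0; first by exists 1; rewrite ?oner_neq0 //; exists false; rewrite mulr0.
by exists a => //; exists true; rewrite mulr1.
Qed.

Lemma cube_root (a : K) : a != 0 -> exists2 t : K, t != 0 & a = t ^+ 3.
Proof.
move=> nz; exists (3.-root a); last by rewrite rootCK.
by rewrite rootC_eq0.
Qed.

Lemma square_root (a : K) : a != 0 -> exists2 t : K, t != 0 & a = t ^+ 2.
Proof.
move=> nz; exists (sqrtC a); last by rewrite sqrtCK.
by rewrite sqrtC_eq0.
Qed.

End Tools.

Arguments pmx {K}.

Ltac simp0 := rewrite ?(mulr0, mul0r, mulr1, mul1r, subr0, sub0r, addr0, add0r,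
  oppr0, opprK, mulrN, mulNr, mulr1n, mulr0n).
Ltac nonzero := rewrite ?(mulf_eq0, oppr_eq0, invr_eq0, expf_eq0, oner_eq0, pnatr_eq0,
  negb_or, negb_and) /=;
  repeat (apply/andP; split); first [done | assumption].
Ltac unit3 := rewrite /pmx /dmx /=; apply: mx3_unit; simp0; nonzero.
Ltac mx_eq :=
  repeat match goal with x := _ |- _ => subst x end;
  rewrite /pmx /dmx /=; move=> ? ? ? /=;
  rewrite ?mul_row3 ?row3_coord ?tr_mx3 !mul_mx3; congr mx3;
  first [ring | field; nonzero].
Ltac leaf_lam lam l A B C :=
  apply: (@classified_form_nf _ A B C lam l);
  [nonzero | unit3 | unit3 | unit3 | mx_eq].
(** Ends a branch at the normal form [l], reached by the substitution A, the row operations B and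
    the column operations C. The value 1 of the parameter is a placeholder outside family III. *)
Ltac leaf l A B C :=
  apply: (@classified_form_nf _ A B C 1 l);
  [nonzero | unit3 | unit3 | unit3 | mx_eq].
Ltac transpose_net :=
  apply: classified_form_tr => [? ? ?|]; [by rewrite tr_mx3; reflexivity|].
Ltac tleaf l A B C := transpose_net; leaf l A B C.

(** Passes to the equivalent net classified by [H]; A, B, C are the witnesses of the equivalence. *)
Ltac step A B C H :=
  apply: (@classified_step _ A B C _ _ _ _ _ _ H); [unit3 | unit3 | unit3 | mx_eq].

(** * Nets with a point of rank one *)

Section RankOnePoint.
Variable K : numClosedFieldType.
Notation cl F := (classified (form3 F)).

(** Up to exchanging the indices 1 and 2 and transposing, the sixteen patterns are a few members of
    family IV. *)
Lemma classified_corner_diag_0 (p q r s : bool) : cl (fun x0 x1 x2 : K => mx3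
   x0 (p%:R * x2) (q%:R * x1)  (r%:R * x2) x1 0  (s%:R * x1) 0 x2).
Proof.
case: p q r s => [] [] [] [] /=.
- leaf IV_1_i (@pmx K 2 0 1) (@pmx K 2 0 1) (@pmx K 1 2 0).
- tleaf IV_2_i (@pmx K 2 1 0) (@pmx K 2 1 0) (@pmx K 2 1 0).
- tleaf IV_2_i (@pmx K 2 0 1) (@pmx K 2 0 1) (@pmx K 1 2 0).
- leaf IV_4_ii (@pmx K 0 1 2) (@pmx K 0 1 2) (@pmx K 0 1 2).
- leaf IV_2_i (@pmx K 2 1 0) (@pmx K 2 1 0) (@pmx K 2 1 0).
- leaf IV_4_i (@pmx K 1 2 0) (@pmx K 1 2 0) (@pmx K 2 0 1).
- leaf IV_5_i (@pmx K 2 0 1) (@pmx K 2 0 1) (@pmx K 1 2 0).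
- leaf IV_7_i (@pmx K 1 2 0) (@pmx K 1 2 0) (@pmx K 2 0 1).
- leaf IV_2_i (@pmx K 2 0 1) (@pmx K 2 0 1) (@pmx K 1 2 0).
- leaf IV_5_i (@pmx K 2 1 0) (@pmx K 2 1 0) (@pmx K 2 1 0).
- leaf IV_4_i (@pmx K 1 0 2) (@pmx K 1 0 2) (@pmx K 1 0 2).
- leaf IV_7_i (@pmx K 1 0 2) (@pmx K 1 0 2) (@pmx K 1 0 2).
- leaf IV_4_iii (@pmx K 0 1 2) (@pmx K 0 1 2) (@pmx K 0 1 2).
- leaf IV_7_i (@pmx K 2 1 0) (@pmx K 2 1 0) (@pmx K 2 1 0).
- leaf IV_7_i (@pmx K 2 0 1) (@pmx K 2 0 1) (@pmx K 1 2 0).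
- leaf IV_ps (@pmx K 0 1 2) (@pmx K 0 1 2) (@pmx K 0 1 2).
Qed.

Lemma classified_corner_diag_scaled (p q r s : K) : cl (fun x0 x1 x2 : K => mx3
   x0 (p * x2) (q * x1)  (r * x2) x1 0  (s * x1) 0 x2).
Proof.
have [a a0 [e ->]] := indicator_factor p; have [b b0 [f ->]] := indicator_factor q.
have [c c0 [g ->]] := indicator_factor r; have [d d0 [h ->]] := indicator_factor s.
(* Diagonal scalings that preserve the three diagonal coefficients multiply p r / (q s) by the cube
   of the ratio of the scalings of x2 and x1, whence a cube root. *)
have [|t t0] := cube_root (a := a * c / (b * d)); first by nonzero.
move=> Et; have {Et}-> : d = a * c / (b * t ^+ 3) by rewrite -Et; field; nonzero.
step (dmx (a * c / t) t 1) (dmx ((t * b)^-1) (a / (t ^+ 2 * b)) 1)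
  (dmx (t ^+ 2 * b / (a * c)) (t * b / a) 1) (@classified_corner_diag_0 e f g h).
Qed.

(** The entries x1 and x2 of the block clear the matching terms of the first row and column; what
    lands in the corner is absorbed into x0. *)
Lemma classified_corner_diag (p1 p2 q1 q2 r1 r2 s1 s2 : K) : cl (fun x0 x1 x2 : K => mx3
   x0 (p1 * x1 + p2 * x2) (q1 * x1 + q2 * x2)
   (r1 * x1 + r2 * x2) x1 0
   (s1 * x1 + s2 * x2) 0 x2).
Proof.
step (mx3 1 0 0  (p1 * r1 + q2 * s1 + s2 * q1) 1 0  (p1 * r2 + q2 * s2 + r1 * p2) 0 1)
  (mx3 1 (- p1) (- q2)  0 1 0  0 0 1) (mx3 1 0 0  (- r1) 1 0  (- s2) 0 1)
  (@classified_corner_diag_scaled p2 q1 r2 s1).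
Qed.

Definition net_corner_sym (a b c d x0 x1 x2 : K) : 'M[K]_3 :=
  mx3 x0 (a * x1) (b * x1)  (c * x1) x1 x2  (d * x1) x2 0.

Lemma classified_corner_sym_leaf (a b c d : bool) : a && b = false -> c && d = false ->
  cl (net_corner_sym a%:R b%:R c%:R d%:R).
Proof.
case: a b c d => [] [] [] [] //= _ _; rewrite /net_corner_sym.
- leaf I_3_iii (mx3 0 0 2^-1  0 2^-1 0  1 2^-1 0 : 'M[K]_3)
    (mx3 (-1) 2 0  1 0 0  0 0 1 : 'M[K]_3) (mx3 (-1) 1 0  2 0 0  0 0 1 : 'M[K]_3).
- tleaf I_2_i (@pmx K 2 1 0) (@pmx K 0 1 2) (@pmx K 0 1 2).
- tleaf I_5_i (@pmx K 1 2 0) (mx3 0 1 0  (-1) 0 0  0 0 1 : 'M[K]_3)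
    (mx3 (-1) 0 0  1 1 0  0 0 1 : 'M[K]_3).
- leaf I_2_i (@pmx K 2 1 0) (@pmx K 0 1 2) (@pmx K 0 1 2).
- leaf I_1_i (@pmx K 2 1 0) (@pmx K 0 1 2) (@pmx K 0 1 2).
- tleaf I_4_i (@pmx K 2 1 0) (@pmx K 2 0 1) (@pmx K 0 1 2).
- leaf I_5_i (@pmx K 1 2 0) (mx3 0 1 0  (-1) 0 0  0 0 1 : 'M[K]_3)
    (mx3 (-1) 0 0  1 1 0  0 0 1 : 'M[K]_3).
- leaf I_4_i (@pmx K 2 1 0) (@pmx K 2 0 1) (@pmx K 0 1 2).
- leaf I_8 (@pmx K 1 2 0) (@pmx K 1 0 2) (@pmx K 1 0 2).
Qed.

Lemma classified_corner_sym_reduced (a b c d : K) : a * b = 0 -> c * d = 0 -> cl (net_corner_sym a b c d).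
Proof.
have normal (s t : K) : s * t = 0 -> exists2 u, u != 0 &
    exists e f : bool, [/\ e && f = false, s = u * e%:R & t = u * f%:R].
  move=> /eqP; rewrite mulf_eq0; have [-> _|s0] := eqVneq s 0; last move=> /eqP ->.
    have [u u0 [f ->]] := indicator_factor t.
    by exists u => //; exists false, f; rewrite mulr0.
  by exists s => //; exists true, false; rewrite mulr0 mulr1.
move=> /normal[u u0 [e [f [ef -> ->]]]] /normal[v v0 [g [h [gh -> ->]]]].
step (dmx (u * v) 1 1) (dmx (u^-1) 1 1) (dmx (v^-1) 1 1) (@classified_corner_sym_leaf e f g h ef gh).
Qed.

(* Adding multiples of the last row and column moves (a, c) along (2b, d) and
   (b, 2d), up to a change of x1. *)
Lemma classified_corner_sym_diag (a b c d : K) : cl (net_corner_sym a b c d).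
Proof.
have [s [t [es et]]] : exists s t : K,
    (a - (2 * s + t) * b) * b = 0 /\ (c - (s + 2 * t) * d) * d = 0.
  have [->|b0] := eqVneq b 0; have [->|d0] := eqVneq d 0.
  - by exists 0, 0; rewrite !mulr0.
  - exists 0, (c / (2 * d)); rewrite !mulr0; split=> //; field; nonzero.
  - exists (a / (2 * b)), 0; rewrite !mulr0; split=> //; field; nonzero.
  (* The solution of 2 s + t = a / b and s + 2 t = c / d. *)
  - exists ((2 * a / b - c / d) / 3), ((2 * c / d - a / b) / 3); split; field; nonzero.
pose k := s + t; pose a' := a - s * b; pose c' := c - t * d.
step (mx3 1 0 0  (b * k * c' + a' * k * d + d * k * (a' - b * k) + c' * k * b) 1 0
     (b * k ^+ 2 * c' + a' * k ^+ 2 * d) k 1)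
  (mx3 1 (- (b * k)) (b * k * t - a' * k)  0 1 (- t)  0 0 1)
  (mx3 1 0 0  (- (d * k)) 1 0  (d * k * s - c' * k) (- s) 1)
  (classified_corner_sym_reduced es et).
Qed.

Lemma classified_corner_sym (p1 p2 q1 q2 r1 r2 s1 s2 : K) : cl (fun x0 x1 x2 : K => mx3
   x0 (p1 * x1 + p2 * x2) (q1 * x1 + q2 * x2)
   (r1 * x1 + r2 * x2) x1 x2
   (s1 * x1 + s2 * x2) x2 0).
Proof.
step (mx3 1 0 0  (q2 * r1 + p2 * s1 + s2 * (p1 - q2) + r2 * q1) 1 0
     (q2 * r2 + p2 * s2) 0 1)
  (mx3 1 (- q2) (- p2)  0 1 0  0 0 1) (mx3 1 0 0  (- s2) 1 0  (- r2) 0 1)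
  (@classified_corner_sym_diag (p1 - q2) q1 (r1 - s2) s1).
Qed.

(** The last two entries of the first row form a 2 x 2 matrix of coefficients of x1, x2. Subtracting
    the second row shifts it by a scalar matrix; a substitution in (x1, x2) together with the
    inverse column operations conjugates it, and must keep the form x1 of the last row up to a
    factor. *)
Definition net_corner_row (a1 a2 b1 b2 x0 x1 x2 : K) : 'M[K]_3 :=
  mx3 x0 (a1 * x1 + a2 * x2) (b1 * x1 + b2 * x2)  0 x1 x2  x1 0 0.

Lemma classified_corner_row_anti (a b : K) : a != 0 -> cl (net_corner_row 0 a b 0).
Proof.
move=> a0; have [c c0 [e ->]] := indicator_factor b.
(* Rescaling x1 against x2 changes the ratio of the two coefficients by a square. *)
have [|t t0 Et] := square_root (a := c / a); first by nonzero.
have {Et}-> : c = a * t ^+ 2 by rewrite -Et; field; nonzero.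
suff H : cl (net_corner_row 0 1 e%:R 0).
  step (dmx (a * t) 1 t) (dmx ((a * t)^-1) 1 1) (dmx 1 1 (t^-1)) H.
case: e; rewrite /net_corner_row.
- leaf I_3_i (@pmx K 2 0 1) (@pmx K 0 1 2) (@pmx K 0 1 2).
- leaf I_6_i (@pmx K 2 1 0) (@pmx K 1 0 2) (@pmx K 0 1 2).
Qed.

Lemma classified_corner_row_nilp (b : K) : cl (net_corner_row 0 0 b 0).
Proof.
have [c c0 [e ->]] := indicator_factor b.
suff H : cl (net_corner_row 0 0 e%:R 0).
  step (dmx c 1 1) (dmx (c^-1) 1 1) (dmx (1 : K) 1 1) H.
case: e; rewrite /net_corner_row.
- leaf I_7_i (@pmx K 2 0 1) (@pmx K 1 0 2) (@pmx K 0 2 1).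
- leaf I_11_i (@pmx K 2 0 1) (@pmx K 1 0 2) (@pmx K 0 2 1).
Qed.

Lemma classified_corner_row_traceless (a1 a2 b1 : K) : cl (net_corner_row a1 a2 b1 0).
Proof.
have [->|a20] := eqVneq a2 0; last first.
  (* This k makes both diagonal coefficients equal to a1 / 2, and a multiple of the second row then
     removes them together. *)
  pose k := - a1 / (2 * a2).
  step (mx3 1 0 0  0 1 k  0 0 1) (mx3 1 (k * a2) 0  0 1 0  0 0 1)
    (mx3 1 0 0  0 1 (- k)  0 0 1)
    (@classified_corner_row_anti a2 (b1 - k * (a1 + k * a2)) a20).
have [->|a10] := eqVneq a1 0; first exact: classified_corner_row_nilp.
have H : cl (net_corner_row 1 0 0 0).
  rewrite /net_corner_row; tleaf I_5_i (@pmx K 2 0 1) (@pmx K 0 2 1) (@pmx K 1 0 2).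
step (mx3 a1 0 0  0 1 (b1 / a1)  0 0 1) (dmx (a1^-1) 1 1)
  (mx3 1 0 0  0 1 (- (b1 / a1))  0 0 1) H.
Qed.

Lemma classified_corner_row_aligned (a1 a2 b1 b2 : K) : cl (net_corner_row a1 a2 b1 b2).
Proof.
step (dmx (1 : K) 1 1) (mx3 1 (- b2) 0  0 1 0  0 0 1) (dmx (1 : K) 1 1)
  (@classified_corner_row_traceless (a1 - b2) a2 b1).
Qed.

Lemma classified_corner_row_nz (p1 p2 q1 q2 s1 s2 : K) : s1 != 0 -> cl (fun x0 x1 x2 : K => mx3
   x0 (p1 * x1 + p2 * x2) (q1 * x1 + q2 * x2)  0 x1 x2  (s1 * x1 + s2 * x2) 0 0).
Proof.
move=> s0.
step (mx3 1 0 0  0 (s1^-1) 0  0 (- s2 / s1) 1) (dmx (1 : K) 1 1) (mx3 1 0 0  0 s1 0  0 s2 1)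
  (@classified_corner_row_aligned (p1 + s2 * q1 / s1)
    (s1 * p2 - p1 * s2 + s2 * q2 - s2 ^+ 2 * q1 / s1) (q1 / s1) (q2 - q1 * s2 / s1)).
Qed.

Lemma classified_corner_row (p1 p2 q1 q2 r1 r2 s1 s2 : K) : cl (fun x0 x1 x2 : K => mx3
   x0 (p1 * x1 + p2 * x2) (q1 * x1 + q2 * x2)
   (r1 * x1 + r2 * x2) x1 x2
   (s1 * x1 + s2 * x2) 0 0).
Proof.
suff H : cl (fun x0 x1 x2 : K => mx3
   x0 (p1 * x1 + p2 * x2) (q1 * x1 + q2 * x2)  0 x1 x2  (s1 * x1 + s2 * x2) 0 0).
  step (mx3 1 0 0  (r1 * p1 + r2 * q1) 1 0  (r1 * p2 + r2 * q2) 0 1)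
    (dmx (1 : K) 1 1) (mx3 1 0 0  (- r1) 1 0  (- r2) 0 1) H.
have [->|s10] := eqVneq s1 0; last exact: classified_corner_row_nz.
have [->|s20] := eqVneq s2 0.
  apply: (@classified_dep_row _ _ 0 0 1) => [|x0 x1 x2]; first by rewrite oner_eq0 ?orbT.
  rewrite mul_row3; apply/rowP; elim/ord3P; rewrite !mxE /=; ring.
step (@pmx K 0 2 1) (@pmx K 0 1 2) (@pmx K 0 2 1) (@classified_corner_row_nz q2 q1 p2 p1 s2 0 s20).
Qed.

(** Conjugations of the block x1 I act on the row (a, b) and the column (c, d) as on a covector and
    a vector. What matters is which of them vanish and whether the pairing a c + b d does. *)
Definition net_corner_scalar (a b c d x0 x1 x2 : K) : 'M[K]_3 :=
  mx3 x0 (a * x2) (b * x2)  (c * x2) x1 0  (d * x2) 0 x1.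

Lemma classified_corner_scalar_row (a c d : K) : a != 0 -> cl (net_corner_scalar a 0 c d).
Proof.
move=> a0; have [->|c0] := eqVneq c 0; last first.
  have H : cl (net_corner_scalar 1 0 1 0) by rewrite /net_corner_scalar; leaf I_4_iii (@pmx K 2 0 1) (@pmx K 0 1 2) (@pmx K 0 1 2).
  step (dmx (a * c) 1 1) (mx3 (a^-1) 0 0  0 1 0  0 (- (d / c)) 1)
    (mx3 (c^-1) 0 0  0 1 0  0 (d / c) 1) H.
have [v v0 [e ->]] := indicator_factor d.
suff H : cl (net_corner_scalar 1 0 0 e%:R).
  step (dmx (a * v) 1 1) (dmx (a^-1) 1 1) (dmx (v^-1) 1 1) H.
case: e; rewrite /net_corner_scalar.
- leaf I_6_iii (@pmx K 2 0 1) (@pmx K 0 2 1) (@pmx K 0 1 2).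
- tleaf I_11_ii (@pmx K 1 0 2) (@pmx K 2 0 1) (@pmx K 0 2 1).
Qed.

Lemma classified_corner_scalar_nz (a b c d : K) : (a != 0) || (b != 0) -> cl (net_corner_scalar a b c d).
Proof.
have [-> /= b0|a0 _] := eqVneq a 0; last first.
  step (dmx (1 : K) 1 1) (mx3 1 0 0  0 1 (b / a)  0 0 1) (mx3 1 0 0  0 1 (- (b / a))  0 0 1)
    (@classified_corner_scalar_row a (c + b / a * d) d a0).
step (@pmx K 0 1 2) (@pmx K 0 2 1) (@pmx K 0 2 1) (@classified_corner_scalar_row b d c b0).
Qed.

Lemma classified_corner_scalar (p1 p2 q1 q2 r1 r2 s1 s2 : K) : cl (fun x0 x1 x2 : K => mx3
   x0 (p1 * x1 + p2 * x2) (q1 * x1 + q2 * x2)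
   (r1 * x1 + r2 * x2) x1 0
   (s1 * x1 + s2 * x2) 0 x1).
Proof.
suff H : cl (net_corner_scalar p2 q2 r2 s2).
  step (mx3 1 0 0  (p1 * r1 + q1 * s1) 1 0  (p1 * r2 + q1 * s2 + r1 * p2 + s1 * q2) 0 1)
    (mx3 1 (- p1) (- q1)  0 1 0  0 0 1) (mx3 1 0 0  (- r1) 1 0  (- s1) 0 1) H.
have [ab|] := boolP ((p2 != 0) || (q2 != 0)); first exact: classified_corner_scalar_nz.
rewrite negb_or !negbK => /andP[/eqP -> /eqP ->].
have [rs|] := boolP ((r2 != 0) || (s2 != 0)).
  apply: classified_form_tr (classified_corner_scalar_nz (c := 0) (d := 0) rs) => x0 x1 x2.
  by rewrite tr_mx3.
rewrite negb_or !negbK => /andP[/eqP -> /eqP ->].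
apply: (@classified_dep_var _ _ 0 0 1); first by rewrite oner_eq0 ?orbT.
by rewrite /net_corner_scalar !mul0r; apply/matrixP; do 2!elim/ord3P; rewrite !mxE.
Qed.

(** The block has the single entry x1. The cases depend on whether the forms q and s in the opposite
    corners are multiples of x1: neither (transverse), only q (mixed), or both (tangent). *)
Definition net_corner_line (a q1 q2 c s1 s2 x0 x1 x2 : K) : 'M[K]_3 :=
  mx3 x0 (a * x2) (q1 * x1 + q2 * x2)  (c * x2) x1 0  (s1 * x1 + s2 * x2) 0 0.

Lemma classified_corner_line_transverse (a q1 q2 c s1 s2 : K) : q2 != 0 -> s2 != 0 ->
  cl (net_corner_line a q1 q2 c s1 s2).
Proof.
move=> q0 s0; pose u := a * q1 / q2; pose v := c * s1 / s2.
suff H : cl (net_corner_line 0 0 1 0 (s1 * q2 / s2 - q1) 1).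
  step (mx3 1 0 0  (u * c * q1 / q2) 1 (- q1 / q2)  (- u * c / q2) 0 (q2^-1))
    (mx3 1 u 0  0 1 (- c / s2)  0 0 (q2 / s2))
    (mx3 1 0 0  v 1 0  (- v * a / q2) (- a / q2) 1) H.
have [t t0 [e ->]] := indicator_factor (s1 * q2 / s2 - q1).
suff H : cl (net_corner_line 0 0 1 0 e%:R 1).
  step (dmx 1 (t^-1) 1) (dmx 1 t 1) (dmx (1 : K) 1 1) H.
case: e; rewrite /net_corner_line.
- tleaf I_5_iii (@pmx K 2 0 1) (@pmx K 0 1 2) (@pmx K 0 1 2).
- leaf I_8 (@pmx K 2 1 0) (@pmx K 0 1 2) (@pmx K 0 1 2).
Qed.

Lemma classified_corner_line_mixed (a q1 c s1 s2 : K) : q1 != 0 -> s2 != 0 ->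
  cl (net_corner_line a q1 0 c s1 s2).
Proof.
move=> q0 s0; pose v := c * s1 / s2; pose w := a * s1 / s2.
suff H : cl (net_corner_line (a / s2) 1 0 0 0 1).
  step (mx3 1 0 0  (v * a * s1 / s2) 1 (- s1 / s2)  (- v * a / s2) 0 (s2^-1))
    (mx3 1 w (- w * c / s2)  0 1 (- c / s2)  0 0 1)
    (mx3 1 0 0  v 1 0  0 0 (q1^-1)) H.
have [t t0 [e ->]] := indicator_factor (a / s2).
suff H : cl (net_corner_line e%:R 1 0 0 0 1).
  step (dmx (1 : K) 1 1) (dmx 1 t 1) (dmx 1 (t^-1) 1) H.
case: e; rewrite /net_corner_line.
- leaf I_7_ii (@pmx K 2 0 1) (@pmx K 0 1 2) (@pmx K 0 1 2).
- leaf I_11_ii (@pmx K 2 0 1) (@pmx K 0 1 2) (@pmx K 0 1 2).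
Qed.

Lemma classified_corner_line_tangent (a q1 c s1 : K) : q1 != 0 -> s1 != 0 ->
  cl (net_corner_line a q1 0 c s1 0).
Proof.
move=> q0 s0; have [t t0 [e ->]] := indicator_factor a.
have [r r0 [f ->]] := indicator_factor c.
suff H : cl (net_corner_line e%:R 1 0 f%:R 1 0).
  step (dmx (t * r) 1 1) (dmx (t^-1) 1 (r / s1)) (dmx (r^-1) 1 (t / q1)) H.
case: e f => [] []; rewrite /net_corner_line.
- leaf I_10 (@pmx K 2 0 1) (@pmx K 0 1 2) (@pmx K 0 1 2).
- leaf I_14_i (@pmx K 1 0 2) (@pmx K 0 2 1) (@pmx K 0 1 2).
- tleaf I_14_i (@pmx K 1 0 2) (@pmx K 0 2 1) (@pmx K 0 1 2).
- apply: (@classified_dep_var _ _ 0 0 1); first by rewrite oner_eq0 ?orbT.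
  by rewrite !(mul0r, mulr0, addr0); apply/matrixP; do 2!elim/ord3P; rewrite !mxE.
Qed.

Lemma net_corner_line_tr (a q1 q2 c s1 s2 x0 x1 x2 : K) :
  net_corner_line c s1 s2 a q1 q2 x0 x1 x2 = (net_corner_line a q1 q2 c s1 s2 x0 x1 x2)^T.
Proof. by rewrite tr_mx3. Qed.

Lemma classified_corner_line_reduced (a q1 q2 c s1 s2 : K) : cl (net_corner_line a q1 q2 c s1 s2).
Proof.
have [->|q20] := eqVneq q2 0; have [->|s20] := eqVneq s2 0; last exact: classified_corner_line_transverse.
- have [->|q10] := eqVneq q1 0.
    apply: (@classified_dep_col _ _ 0 0 1) => [|x0 x1 x2]; first by rewrite oner_eq0 ?orbT.
    by apply/colP; elim/ord3P; rewrite mxE big_ord3 !mxE /=; ring.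
  have [->|s10] := eqVneq s1 0; last exact: classified_corner_line_tangent.
  apply: (@classified_dep_row _ _ 0 0 1) => [|x0 x1 x2]; first by rewrite oner_eq0 ?orbT.
  by apply/rowP; elim/ord3P; rewrite mxE big_ord3 !mxE /=; ring.
- have [->|q10] := eqVneq q1 0; last exact: classified_corner_line_mixed.
  apply: (@classified_dep_col _ _ 0 0 1) => [|x0 x1 x2]; first by rewrite oner_eq0 ?orbT.
  by apply/colP; elim/ord3P; rewrite mxE big_ord3 !mxE /=; ring.
- apply: (classified_form_tr (net_corner_line_tr _ _ _ _ _ _)).
  have [->|s10] := eqVneq s1 0; last exact: classified_corner_line_mixed.
  apply: (@classified_dep_col _ _ 0 0 1) => [|x0 x1 x2]; first by rewrite oner_eq0 ?orbT.
  by apply/colP; elim/ord3P; rewrite mxE big_ord3 !mxE /=; ring.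
Qed.

Lemma classified_corner_line (p1 p2 q1 q2 r1 r2 s1 s2 : K) : cl (fun x0 x1 x2 : K => mx3
   x0 (p1 * x1 + p2 * x2) (q1 * x1 + q2 * x2)
   (r1 * x1 + r2 * x2) x1 0
   (s1 * x1 + s2 * x2) 0 0).
Proof.
step (mx3 1 0 0  (p1 * r1) 1 0  (p1 * r2 + r1 * p2) 0 1)
  (mx3 1 (- p1) 0  0 1 0  0 0 1) (mx3 1 0 0  (- r1) 1 0  0 0 1)
  (@classified_corner_line_reduced p2 q1 q2 r2 s1 s2).
Qed.

Lemma orthogonal_pair (p1 p2 q1 q2 : K) : p1 * q2 - p2 * q1 = 0 ->
  exists u v, [/\ (u != 0) || (v != 0), u * p1 + v * q1 = 0 & u * p2 + v * q2 = 0].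
Proof.
move=> D; have [pz|pnz] := boolP ((p1 == 0) && (p2 == 0)).
  move/andP: pz => [/eqP -> /eqP ->]; exists 1, 0.
  by rewrite oner_eq0 !mulr0 !mul0r addr0.
have [q1z|q1n] := boolP (q1 == 0); last first.
  exists q1, (- p1); split; [by apply/orP; left | by ring |].
  by apply/eqP; rewrite -oppr_eq0 -D; apply/eqP; ring.
have [q2z|q2n] := boolP (q2 == 0).
  by exists 0, 1; rewrite oner_eq0 orbT (eqP q1z) (eqP q2z) !mul0r !mul1r !addr0.
exists q2, (- p2); split; [by apply/orP; left | by rewrite -D; ring | by ring].
Qed.

(** With a zero block, conciseness forces the border row and the border column each to be a basis of
    the forms in x1, x2, and all such nets are equivalent. *)
Lemma classified_corner_zero (p1 p2 q1 q2 r1 r2 s1 s2 : K) : cl (fun x0 x1 x2 : K => mx3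
   x0 (p1 * x1 + p2 * x2) (q1 * x1 + q2 * x2)
   (r1 * x1 + r2 * x2) 0 0
   (s1 * x1 + s2 * x2) 0 0).
Proof.
have [/orthogonal_pair[u [v [nz e1 e2]]]|D] := eqVneq (p1 * q2 - p2 * q1) 0.
  apply: (@classified_dep_col _ _ 0 u v) => [|x0 x1 x2]; first by rewrite nz orbT.
  apply/colP; elim/ord3P; rewrite mxE big_ord3 !mxE /=; try by ring.
  transitivity ((u * p1 + v * q1) * x1 + (u * p2 + v * q2) * x2); first by ring.
  by rewrite e1 e2 !mul0r addr0.
have [/orthogonal_pair[u [v [nz e1 e2]]]|E] := eqVneq (r1 * s2 - r2 * s1) 0.
  apply: (@classified_dep_row _ _ 0 u v) => [|x0 x1 x2]; first by rewrite nz orbT.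
  apply/rowP; elim/ord3P; rewrite mxE big_ord3 !mxE /=; try by ring.
  transitivity ((u * r1 + v * s1) * x1 + (u * r2 + v * s2) * x2); first by ring.
  by rewrite e1 e2 !mul0r addr0.
have H : cl (fun x0 x1 x2 : K => mx3 x0 x1 x2  x1 0 0  x2 0 0).
  leaf I_14_iii (@pmx K 2 0 1) (@pmx K 0 1 2) (@pmx K 0 1 2).
apply: (@classified_step _ (mx3 1 0 0  0 (q2 / (p1 * q2 - p2 * q1)) (- q1 / (p1 * q2 - p2 * q1))
         0 (- p2 / (p1 * q2 - p2 * q1)) (p1 / (p1 * q2 - p2 * q1)))
  (mx3 1 0 0
    0 ((p1 * s2 - p2 * s1) / (r1 * s2 - r2 * s1)) ((p2 * r1 - p1 * r2) / (r1 * s2 - r2 * s1))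
    0 ((q1 * s2 - q2 * s1) / (r1 * s2 - r2 * s1)) ((q2 * r1 - q1 * r2) / (r1 * s2 - r2 * s1)))
  (dmx (1 : K) 1 1) _ _ _ _ _ _ H).
- apply: mx3_unit; rewrite [X in X != 0](_ : _ = (p1 * q2 - p2 * q1)^-1) ?invr_eq0 //.
  by field.
- apply: mx3_unit; rewrite [X in X != 0](_ : _ = (p1 * q2 - p2 * q1) / (r1 * s2 - r2 * s1)).
    by rewrite mulf_neq0 ?invr_eq0.
  by field.
- unit3.
- mx_eq.
Qed.

Definition net_rank1 (z1 z2 p1 p2 q1 q2 r1 r2 s1 s2 a1 a2 b1 b2 c1 c2 d1 d2 x0 x1 x2 : K) : 'M[K]_3 :=
  mx3 (x0 + (z1 * x1 + z2 * x2)) (p1 * x1 + p2 * x2) (q1 * x1 + q2 * x2)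
      (r1 * x1 + r2 * x2) (a1 * x1 + a2 * x2) (b1 * x1 + b2 * x2)
      (s1 * x1 + s2 * x2) (c1 * x1 + c2 * x2) (d1 * x1 + d2 * x2).

Lemma classified_rank1_sub (y1 y2 w1 w2 z1 z2 p1 p2 q1 q2 r1 r2 s1 s2 a1 a2 b1 b2 c1 c2 d1 d2 : K) :
  y1 * w2 - y2 * w1 != 0 ->
  cl (net_rank1 (z1 * y1 + z2 * y2) (z1 * w1 + z2 * w2) (p1 * y1 + p2 * y2) (p1 * w1 + p2 * w2)
    (q1 * y1 + q2 * y2) (q1 * w1 + q2 * w2) (r1 * y1 + r2 * y2) (r1 * w1 + r2 * w2)
    (s1 * y1 + s2 * y2) (s1 * w1 + s2 * w2) (a1 * y1 + a2 * y2) (a1 * w1 + a2 * w2)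
    (b1 * y1 + b2 * y2) (b1 * w1 + b2 * w2) (c1 * y1 + c2 * y2) (c1 * w1 + c2 * w2)
    (d1 * y1 + d2 * y2) (d1 * w1 + d2 * w2)) ->
  cl (net_rank1 z1 z2 p1 p2 q1 q2 r1 r2 s1 s2 a1 a2 b1 b2 c1 c2 d1 d2).
Proof.
move=> D H; apply: (@classified_step _ (mx3 1 0 0  0 y1 y2  0 w1 w2) (dmx (1 : K) 1 1)
  (dmx (1 : K) 1 1) _ _ _ _ _ _ H); [|unit3|unit3|mx_eq].
by apply: mx3_unit; rewrite [X in X != 0](_ : _ = y1 * w2 - y2 * w1) //; ring.
Qed.

Lemma classified_rank1_rowcol (g h k l g' h' k' l'
    z1 z2 p1 p2 q1 q2 r1 r2 s1 s2 a1 a2 b1 b2 c1 c2 d1 d2 : K) :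
  g * l - h * k != 0 -> g' * l' - h' * k' != 0 ->
  cl (net_rank1 z1 z2 (p1 * g' + q1 * k') (p2 * g' + q2 * k') (p1 * h' + q1 * l') (p2 * h' + q2 * l')
    (g * r1 + h * s1) (g * r2 + h * s2) (k * r1 + l * s1) (k * r2 + l * s2)
    ((g * a1 + h * c1) * g' + (g * b1 + h * d1) * k') ((g * a2 + h * c2) * g' + (g * b2 + h * d2) * k')
    ((g * a1 + h * c1) * h' + (g * b1 + h * d1) * l') ((g * a2 + h * c2) * h' + (g * b2 + h * d2) * l')
    ((k * a1 + l * c1) * g' + (k * b1 + l * d1) * k') ((k * a2 + l * c2) * g' + (k * b2 + l * d2) * k')
    ((k * a1 + l * c1) * h' + (k * b1 + l * d1) * l') ((k * a2 + l * c2) * h' + (k * b2 + l * d2) * l')) ->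
  cl (net_rank1 z1 z2 p1 p2 q1 q2 r1 r2 s1 s2 a1 a2 b1 b2 c1 c2 d1 d2).
Proof.
move=> D E H; apply: (@classified_step _ (dmx (1 : K) 1 1) (mx3 1 0 0  0 g h  0 k l)
  (mx3 1 0 0  0 g' h'  0 k' l') _ _ _ _ _ _ H); [unit3| | |mx_eq].
- by apply: mx3_unit; rewrite [X in X != 0](_ : _ = g * l - h * k) //; ring.
- by apply: mx3_unit; rewrite [X in X != 0](_ : _ = g' * l' - h' * k') //; ring.
Qed.

(** The rank normal form in size 2: (g h; k l) (a b; c d) (g' h'; k' l') = E_11, with scalars
    spelled out to fit [classified_rank1_rowcol]. *)
Lemma rank1_2x2 (a b c d : K) : a * d = b * c -> [|| a != 0, b != 0, c != 0 | d != 0] ->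
  exists g h k l g' h' k' l', [/\ g * l - h * k != 0, g' * l' - h' * k' != 0 &
    [/\ (g * a + h * c) * g' + (g * b + h * d) * k' = 1, (g * a + h * c) * h' + (g * b + h * d) * l' = 0,
        (k * a + l * c) * g' + (k * b + l * d) * k' = 0 & (k * a + l * c) * h' + (k * b + l * d) * l' = 0]].
Proof.
have main (a' b' c' d' : K) : a' * d' = b' * c' -> a' != 0 ->
    d' = b' * c' / a' by move=> <- n; field.
move=> D; have [/eqP a0|a0 _] := boolP (a == 0); last first.
  exists a^-1, 0, (- c / a), 1, 1, (- b / a), 0, 1.
  rewrite (main _ _ _ _ D a0); split; last by split; field.
  - by rewrite [X in X != 0](_ : _ = a^-1) ?invr_eq0 //; field.
  - by rewrite [X in X != 0](_ : _ = 1) ?oner_eq0 //; field.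
have [/eqP b0|b0 _] := boolP (b == 0); last first.
  have Dc : c = a * d / b by rewrite D; field.
  exists b^-1, 0, (- d / b), 1, 0, 1, 1, (- a / b).
  rewrite Dc; split; last by split; field.
  - by rewrite [X in X != 0](_ : _ = b^-1) ?invr_eq0 //; field.
  - by rewrite [X in X != 0](_ : _ = - 1) ?oppr_eq0 ?oner_eq0 //; field.
have [/eqP c0|c0 _] := boolP (c == 0); last first.
  have Db : b = a * d / c by rewrite D; field.
  exists 0, c^-1, 1, (- a / c), 1, (- d / c), 0, 1.
  rewrite Db; split; last by split; field.
  - by rewrite [X in X != 0](_ : _ = - c^-1) ?oppr_eq0 ?invr_eq0 //; field.
  - by rewrite [X in X != 0](_ : _ = 1) ?oner_eq0 //; field.
rewrite a0 b0 c0 /= => d0.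
exists 0, d^-1, 1, 0, 0, 1, 1, 0; split; last by split; field.
- by rewrite [X in X != 0](_ : _ = - d^-1) ?oppr_eq0 ?invr_eq0 //; field.
- by rewrite [X in X != 0](_ : _ = - 1) ?oppr_eq0 ?oner_eq0 //; field.
Qed.

(** The block is x1 E_11 + x2 (e f; g h). If h is nonzero, it serves as a pivot and the block
    becomes diagonal; if h = 0, the vanishing of f and g decides between the remaining shapes. *)
Lemma classified_rank1_lin (z1 z2 p1 p2 q1 q2 r1 r2 s1 s2 e f g h : K) :
  cl (net_rank1 z1 z2 p1 p2 q1 q2 r1 r2 s1 s2 1 e 0 f 0 g 0 h).
Proof.
have [->|h0] := eqVneq h 0; last first.
  pose k := f * g / h - e.
  step (mx3 1 0 0  (- z1) 1 0  (- z2 - z1 * k) k 1) (mx3 1 0 0  0 1 (- f / h)  0 0 (h^-1))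
    (mx3 1 0 0  0 1 0  0 (- g / h) 1)
    (@classified_corner_diag (p1 - g / h * q1) (p2 - g / h * q2 + k * (p1 - g / h * q1)) q1 (q2 + k * q1)
      (r1 - f / h * s1) (r2 - f / h * s2 + k * (r1 - f / h * s1)) (s1 / h) ((s2 + k * s1) / h)).
have [->|f0] := eqVneq f 0; have [->|g0] := eqVneq g 0.
- step (mx3 1 0 0  (- z1) 1 0  (- z2 + z1 * e) (- e) 1) (dmx (1 : K) 1 1) (dmx (1 : K) 1 1)
    (@classified_corner_line p1 (p2 - e * p1) q1 (q2 - e * q1) r1 (r2 - e * r1) s1 (s2 - e * s1)).
- transpose_net.
  step (mx3 1 0 0  (- z1) 1 0  (- z2 + z1 * e) (- e) 1) (dmx (1 : K) 1 1) (dmx 1 1 (g^-1))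
    (@classified_corner_row r1 (r2 - e * r1) (s1 / g) ((s2 - e * s1) / g) p1 (p2 - e * p1) q1 (q2 - e * q1)).
- step (mx3 1 0 0  (- z1) 1 0  (- z2 + z1 * e) (- e) 1) (dmx (1 : K) 1 1) (dmx 1 1 (f^-1))
    (@classified_corner_row p1 (p2 - e * p1) (q1 / f) ((q2 - e * q1) / f) r1 (r2 - e * r1) s1 (s2 - e * s1)).
- step (mx3 1 0 0  (- z1) 1 0  (- z2 + z1 * e) (- e) 1) (dmx 1 1 (g^-1)) (dmx 1 1 (f^-1))
    (@classified_corner_sym p1 (p2 - e * p1) (q1 / f) ((q2 - e * q1) / f) r1 (r2 - e * r1) (s1 / g) ((s2 - e * s1) / g)).
Qed.

(** The block is x1 times a constant matrix, and the rank of that matrix selects the case. *)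
Lemma classified_rank1_const (z1 z2 p1 p2 q1 q2 r1 r2 s1 s2 a b c d : K) :
  cl (net_rank1 z1 z2 p1 p2 q1 q2 r1 r2 s1 s2 a 0 b 0 c 0 d 0).
Proof.
have [D|D] := eqVneq (a * d) (b * c); last first.
  have {}D : a * d - b * c != 0 by rewrite subr_eq0.
  apply: (@classified_rank1_rowcol (d / (a * d - b * c)) (- b / (a * d - b * c))
    (- c / (a * d - b * c)) (a / (a * d - b * c)) 1 0 0 1).
  - by rewrite [X in X != 0](_ : _ = (a * d - b * c)^-1) ?invr_eq0 //; field.
  - by rewrite mulr1 mulr0 subr0 oner_eq0.
  set r1' := _ * r1 + _; set r2' := _ * r2 + _; set s1' := _ * r1 + _; set s2' := _ * r2 + _.
  apply: (@classified_step _ (mx3 1 0 0  (- z1) 1 0  (- z2) 0 1) (dmx (1 : K) 1 1) (dmx (1 : K) 1 1)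
    _ _ _ _ _ _ (@classified_corner_scalar p1 p2 q1 q2 r1' r2' s1' s2')); [unit3|unit3|unit3|].
  move: r1' r2' s1' s2' => r1' r2' s1' s2'.
  rewrite /dmx => x0 x1 x2 /=; rewrite mul_row3 ?row3_coord !mul_mx3.
  by congr mx3; field.
have [nz|] := boolP [|| a != 0, b != 0, c != 0 | d != 0]; last first.
  rewrite !negb_or !negbK => /and4P[/eqP -> /eqP -> /eqP -> /eqP ->].
  step (mx3 1 0 0  (- z1) 1 0  (- z2) 0 1) (dmx (1 : K) 1 1) (dmx (1 : K) 1 1)
    (@classified_corner_zero p1 p2 q1 q2 r1 r2 s1 s2).
have [g [h [k [l [g' [h' [k' [l' [n n' [E1 E2 E3 E4]]]]]]]]]] := rank1_2x2 D nz.
by apply: (classified_rank1_rowcol n n'); rewrite E1 E2 E3 E4 !mulr0 !addr0 !mul0r !addr0; apply: classified_rank1_lin.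
Qed.

Lemma binary_quadratic_root (a b c : K) : exists u v,
  (u != 0) || (v != 0) /\ a * u ^+ 2 + b * u * v + c * v ^+ 2 = 0.
Proof.
have [->|a0] := eqVneq a 0.
  by exists 1, 0; rewrite oner_eq0; split=> //; ring.
exists ((- b + sqrtC (b ^+ 2 - 4 * a * c)) / (2 * a)), 1; rewrite oner_eq0 orbT; split=> //.
have := sqrtCK (b ^+ 2 - 4 * a * c); set t := sqrtC _ => Et.
transitivity ((t ^+ 2 - (b ^+ 2 - 4 * a * c)) / (4 * a)).
  by field; nonzero.
by rewrite Et subrr mul0r.
Qed.

(* A zero of the determinant of the lower right block can be moved to x = (0, 1, 0). *)
Lemma classified_rank1 (z1 z2 p1 p2 q1 q2 r1 r2 s1 s2 a1 a2 b1 b2 c1 c2 d1 d2 : K) :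
  cl (net_rank1 z1 z2 p1 p2 q1 q2 r1 r2 s1 s2 a1 a2 b1 b2 c1 c2 d1 d2).
Proof.
have [y1 [y2 [nz root]]] := binary_quadratic_root (a1 * d1 - b1 * c1)
  (a1 * d2 + a2 * d1 - b1 * c2 - b2 * c1) (a2 * d2 - b2 * c2).
have [w1 [w2 D]] : exists w1 w2, y1 * w2 - y2 * w1 != 0.
  have [y1z|] := boolP (y1 == 0).
    by exists 1, 0; move: nz; rewrite y1z /= mulr0 mulr1 sub0r oppr_eq0.
  by exists 0, 1; rewrite mulr0 mulr1 subr0.
apply: (classified_rank1_sub D).
have {root} : (a1 * y1 + a2 * y2) * (d1 * y1 + d2 * y2) =
    (b1 * y1 + b2 * y2) * (c1 * y1 + c2 * y2).
  by apply/eqP; rewrite -subr_eq0 -root; apply/eqP; ring.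
move: (a1 * y1 + _) (b1 * y1 + _) (c1 * y1 + _) (d1 * y1 + _) => a b c d det0.
have [nz'|] := boolP [|| a != 0, b != 0, c != 0 | d != 0]; last first.
  rewrite !negb_or !negbK => /and4P[/eqP -> /eqP -> /eqP -> /eqP ->].
  (* The whole block vanishes at the chosen point, so it depends on the other variable only;
     exchange the two. *)
  apply: (@classified_rank1_sub 0 1 1 0).
    by rewrite mulr0 mulr1 sub0r oppr_eq0 oner_eq0.
  by rewrite !(mul0r, mulr0, addr0, add0r, mulr1); apply: classified_rank1_const.
have [g [h [k [l [g' [h' [k' [l' [n n' [E1 E2 E3 E4]]]]]]]]]] := rank1_2x2 det0 nz'.
by apply: (classified_rank1_rowcol n n'); rewrite E1 E2 E3 E4; apply: classified_rank1_lin.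
Qed.

End RankOnePoint.

(** * Nets with a singular point of rank two *)

Section RankTwoPoint.
Variable K : numClosedFieldType.
Notation cl F := (classified (form3 F)).

(* The sum of the generic skew-symmetric matrix and of the matrix of second
   derivatives of f / 6, where
   f = a y0^3 + 3b y0^2 y1 + 3d y0 y1^2 + e y1^3 + 3c y0^2 y2.
   For a matrix g, the net g^T V_f(g y) g is det g times V_h, h = f(g y) / det g. *)
Definition net_hessian (c a b d e y0 y1 y2 : K) : 'M[K]_3 :=
  mx3 (c * y2 + a * y0 + b * y1) (y2 + b * y0 + d * y1) (- y1 + c * y0)
      (- y2 + b * y0 + d * y1) (d * y0 + e * y1) y0
      (y1 + c * y0) (- y0) 0.

(** For c != 0 the tangent cone of f at its singular point (0, 0, 1) is the double line y0 = 0. The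
    cubic is cuspidal for e != 0 (V.1), a conic with a tangent line (V.2), or a double line with a
    line (V.4). *)
Lemma classified_hessian_cuspidal (c a b d e : K) : c != 0 -> cl (net_hessian c a b d e).
Proof.
move=> c0.
have H0 (d' e' : K) : d' = 0 \/ e' = 0 -> cl (net_hessian c 0 0 d' e').
  have [->|e0] := eqVneq e' 0; last first.
    case=> [->|ez]; last by rewrite ez eqxx in e0.
    rewrite /net_hessian; leaf V_1 (mx3 0 1 0  (- c^-1) 0 0  0 0 (e' * c))
      (mx3 0 (e'^-1) 0  (- (c * e')^-1) 0 0  0 0 c)
      (mx3 0 (- c^-1) 0  1 0 0  0 0 (e' * c)).
  move=> _; have [->|d0] := eqVneq d' 0.
    rewrite /net_hessian; leaf V_4 (mx3 (- c^-1) 0 0  0 0 1  0 1 0)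
      (mx3 (-1) 0 0  0 0 c  0 c 0) (mx3 (- c^-1) 0 0  0 0 1  0 1 0).
  rewrite /net_hessian; leaf V_2 (mx3 0 1 0  (- c^-1) 0 0  0 0 (- d'))
    (mx3 0 (- c / d') 0  (d'^-1) 0 0  0 0 c)
    (mx3 0 (- c^-1) 0  1 0 0  0 0 (- d')).
have H1 (a' b' d' e' : K) : d' = 0 \/ e' = 0 -> cl (net_hessian c a' b' d' e').
  (* Replacing y2 by y2 - (a' y0 + 3 b' y1) / (3 c) removes a' and b' from the cubic. *)
  move=> /H0 H; pose k := - (a' / (3 * c)); pose l := - (b' / c).
  step (mx3 1 0 k  0 1 l  0 0 1) (mx3 1 0 k  0 1 l  0 0 1) (mx3 1 0 0  0 1 0  k l 1) H.
have [->|e0] := eqVneq e 0; first by apply: H1; right.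
(* The shift of y1 that removes the term y0 y1^2. *)
pose k := - (d / e).
step (mx3 1 k 0  0 1 0  0 0 1) (mx3 1 k 0  0 1 0  0 0 1) (mx3 1 0 0  k 1 0  0 0 1)
  (H1 (a + 3 * b * k + 3 * d * k ^+ 2 + e * k ^+ 3) (b + 2 * d * k + e * k ^+ 2) 0 e (or_introl erefl)).
Qed.

(** Here f is a binary cubic with the root (1, 0). It is zero (V.ps), or has a triple root (V.5), a
    double root (V.4) or three distinct roots (V.3). *)
Lemma classified_hessian_root (b d e : K) : cl (net_hessian 0 0 b d e).
Proof.
have [->|b0] := eqVneq b 0.
  have [->|d0] := eqVneq d 0.
    have [->|e0] := eqVneq e 0.
      rewrite /net_hessian; leaf V_ps (dmx (1 : K) 1 1) (dmx (1 : K) 1 1) (dmx (1 : K) 1 1).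
    rewrite /net_hessian; leaf V_5 (mx3 0 1 0  1 0 0  0 0 (- e))
      (mx3 0 (e^-1) 0  (e^-1) 0 0  0 0 (-1)) (mx3 0 1 0  1 0 0  0 0 (- e)).
  pose k := - (e / (3 * d)).
  suff H : cl (net_hessian 0 0 0 d 0).
    step (mx3 1 0 0  k 1 0  0 0 1) (mx3 1 0 0  k 1 0  0 0 1) (mx3 1 k 0  0 1 0  0 0 1) H.
  rewrite /net_hessian; leaf V_4 (mx3 0 1 0  1 0 0  0 0 (- d))
    (mx3 0 (d^-1) 0  (d^-1) 0 0  0 0 (-1)) (mx3 0 1 0  1 0 0  0 0 (- d)).
pose k := - (d / (2 * b)).
suff H f : cl (net_hessian 0 0 b 0 f).
  step (mx3 1 0 0  k 1 0  0 0 1) (mx3 1 0 0  k 1 0  0 0 1) (mx3 1 k 0  0 1 0  0 0 1)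
    (H (e + 3 * k * d + 3 * k ^+ 2 * b)).
have [->|f0] := eqVneq f 0.
  rewrite /net_hessian; leaf V_4 (dmx 1 1 b) (dmx (b^-1) (b^-1) 1) (dmx 1 1 b).
have [|m m0 Em] := square_root (a := f / b); first by nonzero.
have {Em}-> : f = b * m ^+ 2 by rewrite -Em; field; nonzero.
(* A sum of two cubes: 3 b y0^2 y1 + b m^2 y1^3 = b / (2 m) ((y0 + m y1)^3 - (y0 - m y1)^3). *)
rewrite /net_hessian; apply: (@classified_form_nf _ (mx3 m 1 0  (- m) 1 0  0 0 (2 * b * m))
  (mx3 ((4 * b * m)^-1) ((4 * b * m ^+ 2)^-1) 0  (- (4 * b * m)^-1) ((4 * b * m ^+ 2)^-1) 0  0 0 ((2 * m)^-1))
  (mx3 m (- m) 0  1 1 0  0 0 (2 * b * m)) 1 V_3).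
- by nonzero.
- by apply: mx3_unit; rewrite [X in X != 0](_ : _ = 4 * b * m ^+ 2); [nonzero | ring].
- by apply: mx3_unit; rewrite [X in X != 0](_ : _ = (16 * b ^+ 2 * m ^+ 4)^-1); [nonzero | field; nonzero].
- by apply: mx3_unit; rewrite [X in X != 0](_ : _ = 4 * b * m ^+ 2); [nonzero | ring].
- mx_eq.
Qed.

Lemma binary_cubic_root (a b d e : K) : exists u v,
  (u != 0) || (v != 0) /\ a * u ^+ 3 + 3 * b * u ^+ 2 * v + 3 * d * u * v ^+ 2 + e * v ^+ 3 = 0.
Proof.
have [->|a0] := eqVneq a 0.
  by exists 1, 0; rewrite oner_eq0; split=> //; ring.
pose p := Poly [:: e; 3 * d; 3 * b; a].
have sp : size p = 4 by rewrite (PolyK (c := 0)).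
have /closed_rootP[x /rootP px] : size p != 1 by rewrite sp.
exists x, 1; rewrite oner_eq0 orbT; split=> //; rewrite -px horner_Poly /=; ring.
Qed.

Lemma classified_hessian (c a b d e : K) : cl (net_hessian c a b d e).
Proof.
have [->|] := eqVneq c 0; last exact: classified_hessian_cuspidal.
(* A root of the binary cubic is moved to (1, 0), which makes its first coefficient vanish. *)
have [u [v [nz root]]] := binary_cubic_root a b d e.
have [w [z D]] : exists w z, u * z - v * w != 0.
  have [uz|] := boolP (u == 0).
    by exists 1, 0; move: nz; rewrite uz /= mulr0 mulr1 sub0r oppr_eq0.
  by exists 0, 1; rewrite mulr0 mulr1 subr0.
pose D' := u * z - v * w.
have := @classified_hessian_root
  ((a * u ^+ 2 * w + b * (u ^+ 2 * z + 2 * u * v * w) + d * (2 * u * v * z + v ^+ 2 * w) + e * v ^+ 2 * z) / D')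
  ((a * u * w ^+ 2 + b * (2 * u * w * z + v * w ^+ 2) + d * (u * z ^+ 2 + 2 * v * w * z) + e * v * z ^+ 2) / D')
  ((a * w ^+ 3 + 3 * b * w ^+ 2 * z + 3 * d * w * z ^+ 2 + e * z ^+ 3) / D').
(* The zero coefficient is rewritten as the transformed one, so that the equivalence is an identity
   of rational functions. *)
have {2}<- : (a * u ^+ 3 + 3 * b * u ^+ 2 * v + 3 * d * u * v ^+ 2 + e * v ^+ 3) / D' = 0 by rewrite root mul0r.
apply: (@classified_step _ (mx3 u v 0  w z 0  0 0 1) (mx3 (u / D') (v / D') 0  (w / D') (z / D') 0  0 0 (D'^-1))
  (mx3 u w 0  v z 0  0 0 1)); rewrite ?/D'.
- by apply: mx3_unit; rewrite [X in X != 0](_ : _ = D') //; rewrite /D'; ring.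
- by apply: mx3_unit; rewrite [X in X != 0](_ : _ = D'^-2) ?invr_eq0 ?expf_eq0 //; rewrite /D'; field.
- by apply: mx3_unit; rewrite [X in X != 0](_ : _ = D') //; rewrite /D'; ring.
- mx_eq.
Qed.

(** Adding multiples of the last row and column, and of y0 and y1 to y2, makes the coefficients of
    the block symmetric in all three indices, that is, second derivatives of a cubic. The scalars s,
    t, l0, l1 solve the corresponding linear equations. *)
Lemma classified_skew_hessian (c e000 e001 e010 e011 e100 e101 e110 e111 : K) :
  cl (fun y0 y1 y2 : K => mx3
    (c * y2 + e000 * y0 + e001 * y1) (y2 + e010 * y0 + e011 * y1) (- y1 + c * y0)
    (- y2 + e100 * y0 + e101 * y1) (e110 * y0 + e111 * y1) y0
    (y1 + c * y0) (- y0) 0).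
Proof.
pose t := ((e011 + e101) / 2 - e110) / 3.
pose l0 := (e100 - e010) / 2 - t * c; pose l1 := (e101 - e011) / 2.
pose s := (e001 + c * l1 - (e010 + e100) / 2) / 3.
step (mx3 1 0 l0  0 1 l1  0 0 1) (mx3 1 0 (- s)  0 1 (- t)  0 0 1) (mx3 1 0 0  0 1 0  s t 1)
  (@classified_hessian c (e000 + c * l0) (e001 - 2 * s + c * l1) ((e011 + e101) / 2 - t) e111).
Qed.

Lemma classified_skew (a1 a2 b1 b2 c1 c2 d1 d2 rho : K) : cl (fun x0 x1 x2 : K => mx3
  (x0 + (a1 * x1 + a2 * x2)) (b1 * x1 + b2 * x2) x1
  (c1 * x1 + c2 * x2) (x0 + (d1 * x1 + d2 * x2)) x2
  (- x2) (x1 + rho * x2) 0).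
Proof.
(* With x2 = y0 and x1 = c y0 - y1, this value gives y0 the same coefficient c in the entries (0, 2)
   and (2, 0). *)
pose c := - (rho / 3).
step (mx3 0 c 1  0 (-1) 0  1 0 0) (dmx (1 : K) 1 1) (mx3 c 1 0  (-1) 0 0  0 0 1)
  (@classified_skew_hessian c (- b2 - c * b1 + c * (a2 + c * a1)) (b1 - c * a1) (a2 + c * a1) (- a1)
    (- d2 - c * d1 + c * (c2 + c * c1)) (d1 - c * c1) (c2 + c * c1) (- c1)).
Qed.

(* The last row is x^T R for the bilinear form R = (r_ij) on (x1, x2). *)
Definition net_bordered (a1 a2 b1 b2 c1 c2 d1 d2 r11 r12 r21 r22 x0 x1 x2 : K) : 'M[K]_3 :=
  mx3 (x0 + (a1 * x1 + a2 * x2)) (b1 * x1 + b2 * x2) x1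
      (c1 * x1 + c2 * x2) (x0 + (d1 * x1 + d2 * x2)) x2
      (r11 * x1 + r21 * x2) (r12 * x1 + r22 * x2) 0.

(** After the substitution h in (x1, x2), row operations by the inverse transpose of h restore the
    last column, and column operations by the transpose restore x0 I; R becomes h R h^T. The new
    block is quantified over because it is arbitrary anyway. *)
Lemma classified_bordered_congruence (h11 h12 h21 h22 a1 a2 b1 b2 c1 c2 d1 d2 r11 r12 r21 r22 : K) :
  let D := h11 * h22 - h12 * h21 in D != 0 ->
  (forall a1' a2' b1' b2' c1' c2' d1' d2', cl (net_bordered a1' a2' b1' b2' c1' c2' d1' d2'
    (h11 * r11 * h11 + h11 * r12 * h12 + h12 * r21 * h11 + h12 * r22 * h12)
    (h11 * r11 * h21 + h11 * r12 * h22 + h12 * r21 * h21 + h12 * r22 * h22)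
    (h21 * r11 * h11 + h21 * r12 * h12 + h22 * r21 * h11 + h22 * r22 * h12)
    (h21 * r11 * h21 + h21 * r12 * h22 + h22 * r21 * h21 + h22 * r22 * h22))) ->
  cl (net_bordered a1 a2 b1 b2 c1 c2 d1 d2 r11 r12 r21 r22).
Proof.
move=> D D0 H.
apply: (@classified_step _ (mx3 1 0 0  0 h11 h12  0 h21 h22)
  (mx3 (h22 / D) (- h21 / D) 0  (- h12 / D) (h11 / D) 0  0 0 1)
  (mx3 h11 h21 0  h12 h22 0  0 0 1) _ _ _ _ _ _ (H
  ((h22 * (h11 * a1 + h12 * a2) * h11 + h22 * (h11 * b1 + h12 * b2) * h12 + (- h21) * (h11 * c1 + h12 * c2) * h11 + (- h21) * (h11 * d1 + h12 * d2) * h12) / D)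
  ((h22 * (h21 * a1 + h22 * a2) * h11 + h22 * (h21 * b1 + h22 * b2) * h12 + (- h21) * (h21 * c1 + h22 * c2) * h11 + (- h21) * (h21 * d1 + h22 * d2) * h12) / D)
  ((h22 * (h11 * a1 + h12 * a2) * h21 + h22 * (h11 * b1 + h12 * b2) * h22 + (- h21) * (h11 * c1 + h12 * c2) * h21 + (- h21) * (h11 * d1 + h12 * d2) * h22) / D)
  ((h22 * (h21 * a1 + h22 * a2) * h21 + h22 * (h21 * b1 + h22 * b2) * h22 + (- h21) * (h21 * c1 + h22 * c2) * h21 + (- h21) * (h21 * d1 + h22 * d2) * h22) / D)
  (((- h12) * (h11 * a1 + h12 * a2) * h11 + (- h12) * (h11 * b1 + h12 * b2) * h12 + h11 * (h11 * c1 + h12 * c2) * h11 + h11 * (h11 * d1 + h12 * d2) * h12) / D)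
  (((- h12) * (h21 * a1 + h22 * a2) * h11 + (- h12) * (h21 * b1 + h22 * b2) * h12 + h11 * (h21 * c1 + h22 * c2) * h11 + h11 * (h21 * d1 + h22 * d2) * h12) / D)
  (((- h12) * (h11 * a1 + h12 * a2) * h21 + (- h12) * (h11 * b1 + h12 * b2) * h22 + h11 * (h11 * c1 + h12 * c2) * h21 + h11 * (h11 * d1 + h12 * d2) * h22) / D)
  (((- h12) * (h21 * a1 + h22 * a2) * h21 + (- h12) * (h21 * b1 + h22 * b2) * h22 + h11 * (h21 * c1 + h22 * c2) * h21 + h11 * (h21 * d1 + h22 * d2) * h22) / D))).
- by apply: mx3_unit; rewrite [X in X != 0](_ : _ = D) //; rewrite /D; ring.
- by apply: mx3_unit; rewrite [X in X != 0](_ : _ = D^-1) ?invr_eq0 //; rewrite /D; field.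
- by apply: mx3_unit; rewrite [X in X != 0](_ : _ = D) //; rewrite /D; ring.
- mx_eq.
Qed.

(** The determinant is c x1^3 + mu b x2^3 - (1 + mu) x0 x1 x2; for b = c = 0 and mu != -1 the curve
    is a triangle. *)
Definition net_triangle (b c mu x0 x1 x2 : K) : 'M[K]_3 :=
  mx3 x0 (b * x2) x1  (c * x1) x0 x2  (mu * x2) x1 0.

Lemma classified_triangle_scale (u v b c mu : K) : u != 0 -> v != 0 ->
  cl (net_triangle b c mu) -> cl (net_triangle (u * b) (v * c) mu).
Proof.
(* Scalings preserving the other coefficients multiply b / c by the cube of the ratio of the
   scalings of x2 and x1. *)
move=> u0 v0; have [|t t0 Et] := cube_root (a := u / v); first by nonzero.
have {v0 Et}-> : v = u / t ^+ 3 by rewrite -Et; field; nonzero.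
move=> H; step (dmx 1 (t ^+ 2 / u) (t / u)) (dmx 1 t (u / t)) (dmx 1 (t^-1) (u / t ^+ 2)) H.
Qed.

Lemma classified_triangle_reduced (b c mu : K) : cl (net_triangle b c mu).
Proof.
have [u u0 [e ->]] := indicator_factor b; have [v v0 [f ->]] := indicator_factor c.
have [->|m0] := eqVneq mu 0.
  apply: (classified_triangle_scale u0 v0).
  case: e f => [] []; rewrite /net_triangle.
  - leaf IV_1_ii (@pmx K 0 2 1) (@pmx K 0 1 2) (@pmx K 0 2 1).
  - leaf IV_2_iii (@pmx K 0 2 1) (@pmx K 0 1 2) (@pmx K 0 2 1).
  - tleaf IV_2_i (@pmx K 1 0 2) (@pmx K 1 0 2) (@pmx K 2 0 1).
  - leaf IV_5_i (@pmx K 1 0 2) (@pmx K 1 2 0) (@pmx K 1 0 2).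
(* The cube root l of mu becomes the parameter lam. The units u and v are split so that b and c keep
   the powers of l required by the diagonal rescaling below. *)
have [l l0 El] := cube_root m0; rewrite {mu m0}El.
have -> : u * e%:R = u / l * (l * e%:R) by field.
have -> : v * f%:R = v * l ^+ 2 * (l ^- 2 * f%:R) by field.
apply: classified_triangle_scale; [nonzero | nonzero |].
suff H : cl (fun x0 x1 x2 : K =>
    mx3 x0 (l * x2) (e%:R * x1)  (f%:R * x2) x1 (l * x0)  (l * x1) 0 x2).
  step (mx3 1 0 0  0 0 (l^-1)  0 l 0) (dmx 1 l (l^-1)) (@pmx K 0 2 1) H.
case: e f => [] [].
- leaf_lam l III_1 (@pmx K 2 0 1) (@pmx K 2 0 1) (@pmx K 1 2 0).
- leaf_lam l III_2 (@pmx K 2 0 1) (@pmx K 2 0 1) (@pmx K 1 2 0).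
- leaf_lam l III_2 (@pmx K 1 2 0) (@pmx K 1 2 0) (@pmx K 2 0 1).
- leaf_lam l III_ps (@pmx K 0 1 2) (@pmx K 0 1 2) (@pmx K 0 1 2).
Qed.

(** Multiples of the last row and column, and of x1 and x2 added to x0, clear the whole block except
    b2 and c1; solving for them divides by 1 + mu. *)
Lemma classified_bordered_generic (a1 a2 b1 b2 c1 c2 d1 d2 mu : K) : 1 + mu != 0 ->
  cl (net_bordered a1 a2 b1 b2 c1 c2 d1 d2 0 1 mu 0).
Proof.
move=> m1.
pose l1 := (c2 - a1 - mu * d1) / (1 + mu); pose l2 := (mu * b1 - mu * d2 - a2) / (1 + mu).
pose s1 := - a1 - l1; pose t2 := - d1 - l1; pose s2 := - d2 - l2; pose t1 := - b1 + d2 + l2.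
step (mx3 1 0 0  l1 1 0  l2 0 1) (mx3 1 0 t1  0 1 t2  0 0 1) (mx3 1 0 0  0 1 0  s1 s2 1)
  (@classified_triangle_reduced b2 c1 mu).
Qed.

Definition net_bordered_nilp (a c x0 x1 x2 : K) : 'M[K]_3 :=
  mx3 (x0 + a * x1) 0 x1  (c * x1) x0 x2  0 x2 0.

Lemma classified_bordered_degenerate_red (a1 a2 b1 b2 c1 c2 d1 d2 : K) :
  cl (net_bordered_nilp (a1 - c2 - d1) c1) -> cl (net_bordered a1 a2 b1 b2 c1 c2 d1 d2 0 0 0 1).
Proof.
move=> H; step (mx3 1 0 0  (- d1) 1 0  (- a2) 0 1) (mx3 1 0 (- b2)  0 1 (b1 + a2 - d2)  0 0 1)
  (mx3 1 0 0  0 1 0  (- c2) (- b1) 1) H.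
Qed.

Lemma classified_bordered_nilp (a c : K) : cl (net_bordered_nilp a c).
Proof.
have [->|c0] := eqVneq c 0.
  (* For c = 0 the matrix at (0, 1, 0) has only its first row nonzero: a point of rank one. *)
  step (@pmx K 1 0 2) (dmx (1 : K) 1 1) (mx3 0 0 1  0 1 0  1 0 (- a))
    (@classified_rank1 K 0 0 0 0 1 0 0 1 0 0 1 0 0 (- a) 0 1 0 0).
have H : cl (net_bordered_nilp 0 1).
  rewrite /net_bordered_nilp; leaf I_1_ii (@pmx K 2 1 0) (@pmx K 0 1 2) (@pmx K 1 0 2).
have {}H : cl (net_bordered_nilp 0 c).
  step (dmx 1 (c^-1) (c^-1)) (dmx 1 1 c) (dmx 1 1 c) H.
(* Replacing x1 by x1 + k x2 and restoring the border lowers a by 3 c k. *)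
pose k := a / (3 * c).
have E : (a - k * c) - c * k - c * k = 0 by rewrite /k; field; nonzero.
have {H}/classified_bordered_degenerate_red H : cl (net_bordered_nilp ((a - k * c) - c * k - c * k) c) by rewrite E.
step (mx3 1 0 0  0 1 0  0 k 1) (mx3 1 (- k) 0  0 1 0  0 0 1) (mx3 1 k 0  0 1 0  0 0 1)
  (H (k * (a - k * c)) (k * (a - k * c)) (k ^+ 2 * (a - k * c)) (c * k ^+ 2)).
Qed.

(** The symmetric part of R has off-diagonal entry (k + m) / 2. If it is nonzero, R is congruent to
    an antidiagonal form; if it vanishes, R is skew-symmetric plus s in one diagonal entry, and of
    rank at most one when k = 0. *)
Lemma classified_bordered_isotropic (a1 a2 b1 b2 c1 c2 d1 d2 k m s : K) :
  cl (net_bordered a1 a2 b1 b2 c1 c2 d1 d2 0 k m s).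
Proof.
have [km|km] := eqVneq (k + m) 0.
  have {km}-> : m = - k by apply/eqP; rewrite -addr_eq0 addrC km.
  have [->|k0] := eqVneq k 0; last first.
    step (dmx (1 : K) 1 1) (dmx 1 1 (k^-1)) (dmx (1 : K) 1 1)
      (@classified_skew a1 a2 b1 b2 c1 c2 d1 d2 (s / k)).
  have [->|s0] := eqVneq s 0.
    apply: (@classified_dep_row _ _ 0 0 1) => [|x0 x1 x2]; first by rewrite oner_eq0 ?orbT.
    by apply/rowP; elim/ord3P; rewrite mxE big_ord3 !mxE /=; ring.
  step (dmx (1 : K) 1 1) (dmx 1 1 (s^-1)) (dmx (1 : K) 1 1)
    (classified_bordered_degenerate_red (b1 := b1) (b2 := b2) (a2 := a2) (d2 := d2)
       (@classified_bordered_nilp (a1 - c2 - d1) c1)).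
have diag a1' a2' b1' b2' c1' c2' d1' d2' k' m' : k' != 0 -> k' + m' != 0 ->
    cl (net_bordered a1' a2' b1' b2' c1' c2' d1' d2' 0 k' m' 0).
  move=> k0 km'; have n : 1 + m' / k' != 0.
    by rewrite (_ : _ + _ = (k' + m') / k') ?mulf_neq0 ?invr_eq0 //; field.
  step (dmx (1 : K) 1 1) (dmx 1 1 (k'^-1)) (dmx (1 : K) 1 1)
    (@classified_bordered_generic a1' a2' b1' b2' c1' c2' d1' d2' (m' / k') n).
(* This shear makes the second basis vector isotropic too. *)
apply: (@classified_bordered_congruence 1 0 (- s / (k + m)) 1).
  by rewrite mul0r mulr1 subr0 oner_eq0.
move=> a1' a2' b1' b2' c1' c2' d1' d2'.
rewrite [X in net_bordered _ _ _ _ _ _ _ _ X](_ : _ = 0); last by ring.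
rewrite [X in net_bordered _ _ _ _ _ _ _ _ _ X](_ : _ = k); last by ring.
rewrite [X in net_bordered _ _ _ _ _ _ _ _ _ _ X](_ : _ = m); last by ring.
rewrite [X in net_bordered _ _ _ _ _ _ _ _ _ _ _ X](_ : _ = 0); last by field.
have [k0|] := eqVneq k 0; last by move=> k0; apply: diag.
apply: (@classified_bordered_congruence 0 1 1 0).
  by rewrite mul0r mulr1 sub0r oppr_eq0 oner_eq0.
move: km; rewrite k0 add0r => m0 *.
rewrite [X in net_bordered _ _ _ _ _ _ _ _ X](_ : _ = 0); last by ring.
rewrite [X in net_bordered _ _ _ _ _ _ _ _ _ X](_ : _ = m); last by ring.
rewrite [X in net_bordered _ _ _ _ _ _ _ _ _ _ X](_ : _ = 0); last by ring.
rewrite [X in net_bordered _ _ _ _ _ _ _ _ _ _ _ X](_ : _ = 0); last by ring.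
by apply: diag; rewrite ?addr0.
Qed.

Lemma classified_bordered (a1 a2 b1 b2 c1 c2 d1 d2 r11 r12 r21 r22 : K) :
  cl (net_bordered a1 a2 b1 b2 c1 c2 d1 d2 r11 r12 r21 r22).
Proof.
(* An isotropic vector of R, taken as the first basis vector. *)
have [u [v [nz root]]] := binary_quadratic_root r11 (r12 + r21) r22.
have [w [z D]] : exists w z, u * z - v * w != 0.
  have [uz|] := boolP (u == 0).
    by exists 1, 0; move: nz; rewrite uz /= mulr0 mulr1 sub0r oppr_eq0.
  by exists 0, 1; rewrite mulr0 mulr1 subr0.
apply: (classified_bordered_congruence D) => {a1 a2 b1 b2 c1 c2 d1 d2} a1 a2 b1 b2 c1 c2 d1 d2.
rewrite [X in net_bordered _ _ _ _ _ _ _ _ X](_ : _ = 0); last by rewrite -root; ring.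
exact: classified_bordered_isotropic.
Qed.

Lemma classified_ext (F G : K -> K -> K -> 'M[K]_3) :
  (forall x0 x1 x2, F x0 x1 x2 = G x0 x1 x2) -> cl F -> cl G.
Proof.
move=> e H; apply: (@classified_act _ 1%:M 1%:M 1%:M _ (form3 F)); rewrite ?unitmx1 //.
by move=> x; rewrite mul1mx !mulmx1 /form3 e.
Qed.

Definition net_rank2 (a1 a2 b1 b2 c1 c2 d1 d2 p1 p2 q1 q2 r1 r2 s1 s2 x0 x1 x2 : K) : 'M[K]_3 :=
  mx3 (x0 + (a1 * x1 + a2 * x2)) (b1 * x1 + b2 * x2) (p1 * x1 + p2 * x2)
      (c1 * x1 + c2 * x2) (x0 + (d1 * x1 + d2 * x2)) (q1 * x1 + q2 * x2)
      (r1 * x1 + r2 * x2) (s1 * x1 + s2 * x2) 0.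

(** Conjugating the upper left block preserves x0 I. The factor D on the last row clears the
    denominators of the inverse there. *)
Lemma classified_rank2_conj (g h k l a1 a2 b1 b2 c1 c2 d1 d2 p1 p2 q1 q2 r1 r2 s1 s2 : K) :
  let D := g * l - h * k in D != 0 ->
  (forall a1' a2' b1' b2' c1' c2' d1' d2', cl (net_rank2 a1' a2' b1' b2' c1' c2' d1' d2'
    (g * p1 + h * q1) (g * p2 + h * q2) (k * p1 + l * q1) (k * p2 + l * q2)
    (l * r1 - k * s1) (l * r2 - k * s2) (g * s1 - h * r1) (g * s2 - h * r2))) ->
  cl (net_rank2 a1 a2 b1 b2 c1 c2 d1 d2 p1 p2 q1 q2 r1 r2 s1 s2).
Proof.
move=> D D0 H.
apply: (@classified_step _ (dmx (1 : K) 1 1) (mx3 g h 0  k l 0  0 0 D)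
  (mx3 (l / D) (- h / D) 0  (- k / D) (g / D) 0  0 0 1) _ _ _ _ _ _ (H
  ((g * a1 * l + g * b1 * (- k) + h * c1 * l + h * d1 * (- k)) / D)
  ((g * a2 * l + g * b2 * (- k) + h * c2 * l + h * d2 * (- k)) / D)
  ((g * a1 * (- h) + g * b1 * g + h * c1 * (- h) + h * d1 * g) / D)
  ((g * a2 * (- h) + g * b2 * g + h * c2 * (- h) + h * d2 * g) / D)
  ((k * a1 * l + k * b1 * (- k) + l * c1 * l + l * d1 * (- k)) / D)
  ((k * a2 * l + k * b2 * (- k) + l * c2 * l + l * d2 * (- k)) / D)
  ((k * a1 * (- h) + k * b1 * g + l * c1 * (- h) + l * d1 * g) / D)
  ((k * a2 * (- h) + k * b2 * g + l * c2 * (- h) + l * d2 * g) / D))).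
- by unit3.
- by apply: mx3_unit; rewrite [X in X != 0](_ : _ = D ^+ 2) ?expf_eq0 //; rewrite /D; ring.
- by apply: mx3_unit; rewrite [X in X != 0](_ : _ = D^-1) ?invr_eq0 //; rewrite /D; field.
- mx_eq.
Qed.

Lemma classified_rank2_sub (y1 y2 w1 w2 a1 a2 b1 b2 c1 c2 d1 d2 p1 p2 q1 q2 r1 r2 s1 s2 : K) :
  y1 * w2 - y2 * w1 != 0 ->
  (forall a1' a2' b1' b2' c1' c2' d1' d2', cl (net_rank2 a1' a2' b1' b2' c1' c2' d1' d2'
    (p1 * y1 + p2 * y2) (p1 * w1 + p2 * w2) (q1 * y1 + q2 * y2) (q1 * w1 + q2 * w2)
    (r1 * y1 + r2 * y2) (r1 * w1 + r2 * w2) (s1 * y1 + s2 * y2) (s1 * w1 + s2 * w2))) ->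
  cl (net_rank2 a1 a2 b1 b2 c1 c2 d1 d2 p1 p2 q1 q2 r1 r2 s1 s2).
Proof.
move=> D H.
apply: (@classified_step _ (mx3 1 0 0  0 y1 y2  0 w1 w2) (dmx (1 : K) 1 1) (dmx (1 : K) 1 1)
  _ _ _ _ _ _ (H
    (a1 * y1 + a2 * y2) (a1 * w1 + a2 * w2) (b1 * y1 + b2 * y2) (b1 * w1 + b2 * w2)
    (c1 * y1 + c2 * y2) (c1 * w1 + c2 * w2) (d1 * y1 + d2 * y2) (d1 * w1 + d2 * w2))).
- by apply: mx3_unit; rewrite [X in X != 0](_ : _ = y1 * w2 - y2 * w1) //; ring.
- by unit3.
- by unit3.
- mx_eq.
Qed.

Lemma classified_rank2_col (a1 a2 b1 b2 c1 c2 d1 d2 p1 p2 q1 q2 r1 r2 s1 s2 : K) :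
  p1 * q2 - p2 * q1 != 0 -> cl (net_rank2 a1 a2 b1 b2 c1 c2 d1 d2 p1 p2 q1 q2 r1 r2 s1 s2).
Proof.
move=> D0; pose D := p1 * q2 - p2 * q1.
apply: (@classified_rank2_sub (q2 / D) (- q1 / D) (- p2 / D) (p1 / D)).
  by rewrite [X in X != 0](_ : _ = D^-1) ?invr_eq0 //; rewrite /D; field.
move=> a1' a2' b1' b2' c1' c2' d1' d2'; rewrite /D.
have -> : p1 * (q2 / (p1 * q2 - p2 * q1)) + p2 * (- q1 / (p1 * q2 - p2 * q1)) = 1 by field.
have -> : p1 * (- p2 / (p1 * q2 - p2 * q1)) + p2 * (p1 / (p1 * q2 - p2 * q1)) = 0 by field.
have -> : q1 * (q2 / (p1 * q2 - p2 * q1)) + q2 * (- q1 / (p1 * q2 - p2 * q1)) = 0 by field.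
have -> : q1 * (- p2 / (p1 * q2 - p2 * q1)) + q2 * (p1 / (p1 * q2 - p2 * q1)) = 1 by field.
rewrite -/D; set r1' := r1 * _ + _; set r2' := r1 * _ + _; set s1' := s1 * _ + _; set s2' := s1 * _ + _.
have H := @classified_bordered a1' a2' b1' b2' c1' c2' d1' d2' r1' s1' r2' s2'.
move: r1' r2' s1' s2' H => r1' r2' s1' s2' H.
step (dmx (1 : K) 1 1) (dmx (1 : K) 1 1) (dmx (1 : K) 1 1) H.
Qed.

(** The border clears the first row of the block up to x0 and equalizes its diagonal; only the entry
    (1, 0), which meets neither border form, survives, with both of its coefficients scaled to 0 or
    1. *)
Lemma classified_rank2_opposite (a1 a2 b1 b2 c1 c2 d1 d2 s : K) : s != 0 ->
  cl (net_rank2 a1 a2 b1 b2 c1 c2 d1 d2 1 0 0 0 0 0 0 s).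
Proof.
move=> s0; have H0 (e f : bool) : cl (fun x0 x1 x2 : K => mx3
    x0 0 x1  (e%:R * x1 + f%:R * x2) x0 0  0 x2 0).
  case: e f => [] [].
  - leaf I_2_iii (@pmx K 2 1 0) (@pmx K 0 1 2) (@pmx K 1 0 2).
  - leaf I_4_i (@pmx K 1 0 2) (@pmx K 0 1 2) (@pmx K 1 0 2).
  - tleaf I_4_i (@pmx K 1 2 0) (@pmx K 1 0 2) (@pmx K 0 1 2).
  - leaf I_11_i (@pmx K 0 1 2) (@pmx K 0 2 1) (@pmx K 1 2 0).
have [u u0 [e ->]] := indicator_factor c1; have [v v0 [f ->]] := indicator_factor c2.
step (mx3 1 0 0  (- d1 / u) (u^-1) 0  (- a2 / v) 0 (v^-1))
  (mx3 1 0 (- b2 / s)  0 1 ((a2 - d2) / s)  0 0 (v / s))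
  (mx3 1 0 0  0 1 0  (d1 - a1) (- b1) u) (H0 e f).
Qed.

(** Column operations clear multiples of x1 in the first row, and row operations multiples of x2 in
    the first column; the coefficients left are b2 and c1. *)
Lemma classified_rank2_same (a1 a2 b1 b2 c1 c2 d1 d2 r : K) : r != 0 ->
  cl (net_rank2 a1 a2 b1 b2 c1 c2 d1 d2 1 0 0 0 0 r 0 0).
Proof.
move=> r0; have H0 (e f : bool) : cl (fun x0 x1 x2 : K => mx3
    x0 (e%:R * x2) x1  (f%:R * x1) x0 0  x2 0 0).
  case: e f => [] [].
  - leaf IV_2_iii (@pmx K 1 0 2) (@pmx K 0 1 2) (@pmx K 2 1 0).
  - leaf IV_4_ii (@pmx K 1 0 2) (@pmx K 0 1 2) (@pmx K 2 1 0).
  - leaf IV_4_iii (@pmx K 1 2 0) (@pmx K 2 1 0) (@pmx K 0 1 2).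
  - leaf IV_7_i (@pmx K 0 1 2) (@pmx K 1 0 2) (@pmx K 1 2 0).
have [u u0 [e ->]] := indicator_factor b2; have [v v0 [f ->]] := indicator_factor c1.
step (mx3 1 0 0  (- d1 / v) (v^-1) 0  (- d2 / u) 0 (u^-1))
  (mx3 1 0 ((d2 - a2) / r)  0 1 (- c2 / r)  0 0 (u / r))
  (mx3 1 0 0  0 1 0  (d1 - a1) (- b1) v) (H0 e f).
Qed.

(* On the line x1 = 0 only the upper left block survives, so that line carries
   a point of rank at most one. *)
Lemma classified_rank2_tangent (a1 a2 b1 b2 c1 c2 d1 d2 w1 w2 : K) :
  cl (net_rank2 a1 a2 b1 b2 c1 c2 d1 d2 1 0 0 0 w1 0 w2 0).
Proof.
(* A zero (u, v) of det (x0 I + x2 (a2 b2; c2 d2)); the quadratic form is monic in x0, hence v !=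
   0. *)
have [u [v [nz root]]] := binary_quadratic_root 1 (a2 + d2) (a2 * d2 - b2 * c2).
have v0 : v != 0.
  apply: contraTneq nz => vz; move: root; rewrite vz mul1r expr0n !mulr0 !addr0 => /eqP.
  by rewrite expf_eq0 /= => /eqP ->; rewrite eqxx.
have det0 : (u + a2 * v) * (u + d2 * v) = (b2 * v) * (c2 * v).
  by apply/eqP; rewrite -subr_eq0 -root; apply/eqP; ring.
have [nz'|] := boolP [|| u + a2 * v != 0, b2 * v != 0, c2 * v != 0 | u + d2 * v != 0]; last first.
  rewrite !negb_or !negbK => /and4P[/eqP e1 /eqP e2 /eqP e3 /eqP e4].
  apply: (@classified_dep_var _ _ u 0 v); first by rewrite v0 !orbT.
  rewrite /net_rank2 !mulr0 !mul0r !add0r e1 e2 e3 e4 ?addr0.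
  by apply/matrixP; do 2!elim/ord3P; rewrite !mxE.
have [g [h [k [l [g' [h' [k' [l' [n n' [E1 E2 E3 E4]]]]]]]]]] := rank1_2x2 det0 nz'.
suff H : cl (fun x0 x1 x2 : K => mx3
    (((g * (u + a2 * v) + h * (c2 * v)) * g' + (g * (b2 * v) + h * (u + d2 * v)) * k') * x0 +
     (((g * a1 + h * c1) * g' + (g * b1 + h * d1) * k') * x1 + (g * g' + h * k') * x2))
    (((g * (u + a2 * v) + h * (c2 * v)) * h' + (g * (b2 * v) + h * (u + d2 * v)) * l') * x0 +
     (((g * a1 + h * c1) * h' + (g * b1 + h * d1) * l') * x1 + (g * h' + h * l') * x2))
    (g * x1 + 0 * x2)
    (((k * (u + a2 * v) + l * (c2 * v)) * g' + (k * (b2 * v) + l * (u + d2 * v)) * k') * x0 +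
     (((k * a1 + l * c1) * g' + (k * b1 + l * d1) * k') * x1 + (k * g' + l * k') * x2))
    (((k * (u + a2 * v) + l * (c2 * v)) * h' + (k * (b2 * v) + l * (u + d2 * v)) * l') * x0 +
     (((k * a1 + l * c1) * h' + (k * b1 + l * d1) * l') * x1 + (k * h' + l * l') * x2))
    (k * x1 + 0 * x2)
    ((w1 * g' + w2 * k') * x1 + 0 * x2) ((w1 * h' + w2 * l') * x1 + 0 * x2) (0 * x1 + 0 * x2)).
  apply: (@classified_step _ (mx3 u 0 v  0 1 0  1 0 0) (mx3 g h 0  k l 0  0 0 1)
    (mx3 g' h' 0  k' l' 0  0 0 1) _ _ _ _ _ _ H).
  - by unit3.
  - by apply: mx3_unit; rewrite [X in X != 0](_ : _ = g * l - h * k) //; ring.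
  - by apply: mx3_unit; rewrite [X in X != 0](_ : _ = g' * l' - h' * k') //; ring.
  - mx_eq.
rewrite E1 E2 E3 E4.
apply: classified_ext (@classified_rank1 K
  ((g * a1 + h * c1) * g' + (g * b1 + h * d1) * k') (g * g' + h * k')
  ((g * a1 + h * c1) * h' + (g * b1 + h * d1) * l') (g * h' + h * l') g 0
  ((k * a1 + l * c1) * g' + (k * b1 + l * d1) * k') (k * g' + l * k') (w1 * g' + w2 * k') 0
  ((k * a1 + l * c1) * h' + (k * b1 + l * d1) * l') (k * h' + l * l') k 0
  (w1 * h' + w2 * l') 0 0 0) => x0 x1 x2.
by rewrite /net_rank1 mul1r !mul0r !add0r.
Qed.

(** The last column is p (1, 0) and the last row is m (w1, w2), for linear forms p and m.
    Proportional p and m give the tangent case. Independent ones are taken as x1 and x2, and the row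
    is opposite for w1 = 0 and conjugate to (w1, 0) otherwise. *)
Lemma classified_rank2_q0 (a1 a2 b1 b2 c1 c2 d1 d2 p1 p2 r1 r2 s1 s2 : K) :
  r1 * s2 = r2 * s1 -> cl (net_rank2 a1 a2 b1 b2 c1 c2 d1 d2 p1 p2 0 0 r1 r2 s1 s2).
Proof.
move=> E.
have [w1 [w2 [m1 [m2 [-> -> -> ->]]]]] : exists w1 w2 m1 m2,
    [/\ r1 = w1 * m1, r2 = w1 * m2, s1 = w2 * m1 & s2 = w2 * m2].
  have [rz|r0] := boolP (r1 == 0); last first.
    exists 1, (s1 / r1), r1, r2; split; rewrite ?mul1r //; first by field.
    have -> : s2 = r2 * s1 / r1 by rewrite -E; field.
    by field.
  have [qz|q0] := boolP (r2 == 0).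
    by exists 0, 1, s1, s2; rewrite (eqP rz) (eqP qz) !mul0r !mul1r.
  exists 1, (s2 / r2), r1, r2; split; rewrite ?mul1r //; last by field.
  have /eqP : r2 * s1 = 0 by rewrite -E (eqP rz) mul0r.
  by rewrite mulf_eq0 (negPf q0) (eqP rz) mulr0 => /eqP.
have [pz|pn] := boolP ((p1 == 0) && (p2 == 0)).
  move/andP: pz => [/eqP -> /eqP ->].
  apply: (@classified_dep_col _ _ 0 0 1) => [|x0 x1 x2]; first by rewrite oner_eq0 ?orbT.
  by apply/colP; elim/ord3P; rewrite mxE big_ord3 !mxE /=; ring.
have [mz|mn] := boolP ((w1 * m1 == 0) && (w1 * m2 == 0) && (w2 * m1 == 0) && (w2 * m2 == 0)).
  move: mz => /andP[/andP[/andP[/eqP -> /eqP ->] /eqP ->] /eqP ->].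
  apply: (@classified_dep_row _ _ 0 0 1) => [|x0 x1 x2]; first by rewrite oner_eq0 ?orbT.
  by apply/rowP; elim/ord3P; rewrite mxE big_ord3 !mxE /=; ring.
have [D|D] := eqVneq (p1 * m2 - p2 * m1) 0.
  have [t [m1t m2t]] : exists t, m1 = t * p1 /\ m2 = t * p2.
    have [p1z|p10] := boolP (p1 == 0); last first.
      exists (m1 / p1); split; first by field.
      by transitivity (m1 / p1 * p2 + (p1 * m2 - p2 * m1) / p1); [field | rewrite D mul0r addr0].
    move: pn; rewrite p1z /= => p20; exists (m2 / p2); split; last by field.
    by transitivity (m2 / p2 * p1 - (p1 * m2 - p2 * m1) / p2); [field | rewrite D mul0r subr0].
  have [y1 [y2 [v1 [v2 [n [e1 e2]]]]]] : exists y1 y2 v1 v2, y1 * v2 - y2 * v1 != 0 /\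
      p1 * y1 + p2 * y2 = 1 /\ p1 * v1 + p2 * v2 = 0.
    have [p1z|p10] := boolP (p1 == 0); last first.
      exists p1^-1, 0, (- p2 / p1), 1; rewrite mul0r mulr1 subr0 invr_eq0; split=> //.
      by split; field.
    move: pn; rewrite p1z (eqP p1z) /= => p20; exists 0, p2^-1, 1, 0.
    split; last by split; field.
    by rewrite mul0r mulr1 sub0r; nonzero.
  apply: (classified_rank2_sub n) => {a1 a2 b1 b2 c1 c2 d1 d2} a1 a2 b1 b2 c1 c2 d1 d2.
  have -> : w1 * m1 * y1 + w1 * m2 * y2 = w1 * t * (p1 * y1 + p2 * y2) by rewrite m1t m2t; ring.
  have -> : w2 * m1 * y1 + w2 * m2 * y2 = w2 * t * (p1 * y1 + p2 * y2) by rewrite m1t m2t; ring.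
  have -> : w1 * m1 * v1 + w1 * m2 * v2 = w1 * t * (p1 * v1 + p2 * v2) by rewrite m1t m2t; ring.
  have -> : w2 * m1 * v1 + w2 * m2 * v2 = w2 * t * (p1 * v1 + p2 * v2) by rewrite m1t m2t; ring.
  rewrite e1 e2 !mul0r !addr0 !mulr1 !mulr0.
  exact: classified_rank2_tangent.
apply: (@classified_rank2_sub (m2 / (p1 * m2 - p2 * m1)) (- m1 / (p1 * m2 - p2 * m1))
  (- p2 / (p1 * m2 - p2 * m1)) (p1 / (p1 * m2 - p2 * m1))).
  by rewrite [X in X != 0](_ : _ = (p1 * m2 - p2 * m1)^-1) ?invr_eq0 //; field.
move=> {a1 a2 b1 b2 c1 c2 d1 d2} a1 a2 b1 b2 c1 c2 d1 d2.
have e1 : p1 * (m2 / (p1 * m2 - p2 * m1)) + p2 * (- m1 / (p1 * m2 - p2 * m1)) = 1 by field.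
have e2 : p1 * (- p2 / (p1 * m2 - p2 * m1)) + p2 * (p1 / (p1 * m2 - p2 * m1)) = 0 by field.
have e3 w : w * m1 * (m2 / (p1 * m2 - p2 * m1)) + w * m2 * (- m1 / (p1 * m2 - p2 * m1)) = 0 by field.
have e4 w : w * m1 * (- p2 / (p1 * m2 - p2 * m1)) + w * m2 * (p1 / (p1 * m2 - p2 * m1)) = w by field.
rewrite e1 e2 !e3 !e4 !mul0r !addr0.
have [w1z|w10] := eqVneq w1 0.
  rewrite w1z; have [w2z|w20] := eqVneq w2 0; last exact: classified_rank2_opposite.
  by move: mn; rewrite w1z w2z !mul0r eqxx.
apply: (@classified_rank2_conj 1 (w2 / w1) 0 1); first by rewrite mulr0 mulr1 subr0 oner_eq0.
move=> {a1 a2 b1 b2 c1 c2 d1 d2} a1 a2 b1 b2 c1 c2 d1 d2.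
rewrite !(mul0r, mulr0, mul1r, addr0, subr0, subrr) mulfVK // subrr.
exact: classified_rank2_same.
Qed.

(** An independent border column or, after transposition, an independent border row leads to
    [net_bordered]. Otherwise a conjugation makes one entry of the column zero. *)
Lemma classified_rank2 (a1 a2 b1 b2 c1 c2 d1 d2 p1 p2 q1 q2 r1 r2 s1 s2 : K) :
  cl (net_rank2 a1 a2 b1 b2 c1 c2 d1 d2 p1 p2 q1 q2 r1 r2 s1 s2).
Proof.
have [D|D] := eqVneq (p1 * q2 - p2 * q1) 0; last exact: classified_rank2_col.
have [E|E] := eqVneq (r1 * s2 - r2 * s1) 0; last first.
  apply: classified_form_tr (@classified_rank2_col a1 a2 c1 c2 b1 b2 d1 d2 r1 r2 s1 s2 p1 p2 q1 q2 E) => x0 x1 x2.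
  by rewrite tr_mx3.
have [u [v [nz e1 e2]]] := orthogonal_pair D.
have [g [h n]] : exists g h, g * v - h * u != 0.
  have [vz|v0] := boolP (v == 0); last by exists 1, 0; rewrite mul1r mul0r subr0.
  exists 0, 1; rewrite mul0r mul1r sub0r oppr_eq0.
  by move: nz; rewrite vz orbF.
apply: (@classified_rank2_conj g h u v) => // {a1 a2 b1 b2 c1 c2 d1 d2} a1 a2 b1 b2 c1 c2 d1 d2.
rewrite e1 e2; apply: classified_rank2_q0.
apply/eqP; rewrite -subr_eq0 [X in X == 0](_ : _ = (g * v - h * u) * (r1 * s2 - r2 * s1)).
  by rewrite E mulr0.
by ring.
Qed.

End RankTwoPoint.

(** * Classification *)

Section Classification.
Variable K : numClosedFieldType.
Implicit Types (P Q B C : 'M[K]_3) (T : tensor K).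

(* The coefficient of t in det (P + t Q). *)
Definition ddet (R : comNzRingType) (P Q : 'M[R]_3) : R :=
    Q 0 0 * (P 1 1 * P 2 2 - P 1 2 * P 2 1)
  + P 0 0 * (Q 1 1 * P 2 2 + P 1 1 * Q 2 2 - Q 1 2 * P 2 1 - P 1 2 * Q 2 1)
  - Q 0 1 * (P 1 0 * P 2 2 - P 1 2 * P 2 0)
  - P 0 1 * (Q 1 0 * P 2 2 + P 1 0 * Q 2 2 - Q 1 2 * P 2 0 - P 1 2 * Q 2 0)
  + Q 0 2 * (P 1 0 * P 2 1 - P 1 1 * P 2 0)
  + P 0 2 * (Q 1 0 * P 2 1 + P 1 0 * Q 2 1 - Q 1 1 * P 2 0 - P 1 1 * Q 2 0).

Lemma det_line t P Q : \det (P + t *: Q) =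
  \det P + t * ddet P Q + t ^+ 2 * ddet Q P + t ^+ 3 * \det Q.
Proof. rewrite !det3 /ddet !mxE; ring. Qed.

Lemma cubic_coef1 (a b c : K) : (forall t, t * a + t ^+ 2 * b + t ^+ 3 * c = 0) -> a = 0.
Proof.
move=> h; have := h 1; have := h (-1); have := h 2 => e2 e1 e0.
(* Since 6 f(1) - 2 f(-1) - f(2) = 6 a for f(t) = a t + b t^2 + c t^3. *)
transitivity (((1 * a + 1 ^+ 2 * b + 1 ^+ 3 * c) * 6 - (-1 * a + (-1) ^+ 2 * b + (-1) ^+ 3 * c) * 2
  - (2 * a + 2 ^+ 2 * b + 2 ^+ 3 * c)) / 6); first by field; nonzero.
by rewrite e0 e1 e2; field; nonzero.
Qed.

(** Compare the linear terms in t of det (B (P + t Q) C) = det B det C det (P + t Q). *)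
Lemma ddet_mul0 B C P Q : \det P = 0 -> ddet P Q = 0 ->
  ddet (B *m P *m C) (B *m Q *m C) = 0.
Proof.
move=> d0 d1; set k := \det B * \det C.
apply: (@cubic_coef1 _ (ddet (B *m Q *m C) (B *m P *m C) - k * ddet Q P)
  (\det (B *m Q *m C) - k * \det Q)) => t.
have := det_line t (B *m P *m C) (B *m Q *m C).
rewrite scalemxAl scalemxAr -mulmxDl -mulmxDr !det_mulmx det_line d0 d1.
rewrite /k => e; apply/eqP; move/eqP: e; rewrite -subr_eq0 => /eqP e.
rewrite -oppr_eq0 -e; apply/eqP; ring.
Qed.

Lemma mderiv_linear_form n (c : 'I_n -> K) i :
  (\sum_j c j *: 'X_j : {mpoly K[n]})^`M(i) = (c i)%:MP.
Proof.
rewrite (bigD1 i) //= mderivD mderivZ mderivX mnm1E eqxx scale1r.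
rewrite (_ : (U_(i) - U_(i))%MM = 0%MM); last by apply/mnmP => j; rewrite mnmBE mnm0E subnn.
rewrite mpolyX0 raddf_sum big1 ?addr0 => [|j ne]; first by rewrite -mul_mpolyC mulr1.
by rewrite /= mderivZ mderivX mnm1E (negPf ne) scale0r scaler0.
Qed.

Lemma meval_det_form T (x : 'rV[K]_3) : (det_form T).@[x 0] = \det (contr1 T x).
Proof.
rewrite /det_form !det3 !mxE !big_ord3 !(mevalB, mevalD, mevalM, mevalZ, mevalXU); ring.
Qed.

Lemma mderiv_det_form T (x : 'rV[K]_3) i :
  ((det_form T)^`M(i)).@[x 0] = ddet (contr1 T x) (\matrix_(j, k) T (i, j, k)).
Proof.
pose L j k : {mpoly K[3]} := \sum_i T (i, j, k) *: 'X_i.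
have dL j k : (L j k)^`M(i) = (T (i, j, k))%:MP by apply: mderiv_linear_form.
have vL j k : (L j k).@[x 0] = contr1 T x j k.
  by rewrite /L mxE !big_ord3 !(mevalD, mevalZ, mevalXU); ring.
rewrite /det_form det3 ![(\matrix_(_, _) _) _ _]mxE -/(L _ _) -!/(L _ _).
rewrite !(mderivB, mderivD, mderivM) !dL !(mevalB, mevalD, mevalM, mevalC) !vL /ddet.
rewrite ![(\matrix_(_, _) T _) _ _]mxE; ring.
Qed.

Lemma move_to_e0 (x : 'rV[K]_3) : x != 0 ->
  exists2 A : 'M[K]_3, A \in unitmx & row3 1 0 0 *m A = x.
Proof.
move=> nz; rewrite [x]row3E; move: (x 0 0) (x 0 1) (x 0 2) (row3E x) => a b c Ex.
have [a0|a0] := eqVneq a 0; last first.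
  exists (mx3 a b c 0 1 0 0 0 1); first by unit3.
  by rewrite mul_row3; congr row3; ring.
have [b0|b0] := eqVneq b 0; last first.
  exists (mx3 a b c 1 0 0 0 0 1); first by rewrite a0; unit3.
  by rewrite mul_row3; congr row3; ring.
have c0 : c != 0.
  apply: contraNneq nz => c0; rewrite Ex a0 b0 c0; apply/eqP/rowP.
  by elim/ord3P; rewrite !mxE.
exists (mx3 a b c 1 0 0 0 1 0); first by rewrite a0 b0; unit3.
by rewrite mul_row3; congr row3; ring.
Qed.

Lemma rank_normal_form P : P != 0 -> \det P = 0 -> exists B C, [/\ B \in unitmx, C \in unitmx &
  B *m P *m C = mx3 1 0 0 0 0 0 0 0 0 \/ B *m P *m C = mx3 1 0 0 0 1 0 0 0 0].
Proof.
move=> nz d0; exists (invmx (col_ebase P)), (invmx (row_ebase P)).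
rewrite !unitmx_inv col_ebase_unit row_ebase_unit; split=> //.
have -> : invmx (col_ebase P) *m P *m invmx (row_ebase P) = pid_mx (\rank P).
  by rewrite -{2}(mulmx_ebase P) !mulmxA mulVmx ?col_ebase_unit // mul1mx mulmxK ?row_ebase_unit.
have : (\rank P < 3)%N.
  rewrite ltn_neqAle rank_leq_row andbT; apply/negP => /eqP r3.
  suff: row_free P by rewrite row_free_unit unitmxE d0 unitr0.
  by rewrite /row_free r3.
have : \rank P != 0 by rewrite mxrank_eq0.
case: (\rank P) => [|[|[|]]] // _ _; [left|right];
  by apply/matrixP; do 2!elim/ord3P; rewrite !mxE.
Qed.

Lemma contr1_lin T (x : 'rV[K]_3) : contr1 T x =
  x 0 0 *: contr1 T (row3 1 0 0) + x 0 1 *: contr1 T (row3 0 1 0) + x 0 2 *: contr1 T (row3 0 0 1).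
Proof. by apply/matrixP => j k; rewrite !mxE !big_ord3 !mxE /=; ring. Qed.

Lemma concise_net_contr1 T : concise T -> concise_net (contr1 T).
Proof.
move=> [c1 c2 c3]; split=> [x|u h|u h].
- by move=> e; apply: c1; rewrite e; apply/matrixP => j k; rewrite !mxE big1 // => i _; rewrite mxE mul0r.
- apply: c2; apply/matrixP => i k; rewrite !mxE.
  have /matrixP/(_ 0 k) := h (delta_mx 0 i).
  rewrite !mxE => e; rewrite [RHS]big1 => [|j _]; last by rewrite mxE mul0r.
  rewrite -[RHS]e; apply: eq_bigr => j _; rewrite mxE (bigD1 i) //= big1 => [|i' ne].
    by rewrite mxE !eqxx mul1r addr0.
  by rewrite mxE (negPf ne) andbF mul0r.
- apply: trmx_inj; rewrite trmx0; apply: c3; apply/matrixP => i j; rewrite !mxE.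
  have /matrixP/(_ j 0) := h (delta_mx 0 i).
  rewrite !mxE => e; rewrite [RHS]big1 => [|k _]; last by rewrite mxE mul0r.
  rewrite -[RHS]e; apply: eq_bigr => k _; rewrite !mxE mulrC (bigD1 i) //= big1 => [|i' ne].
    by rewrite mxE !eqxx mul1r addr0.
  by rewrite mxE (negPf ne) andbF mul0r.
Qed.

Lemma singular_point T : E1_singular T -> exists2 x : 'rV[K]_3, x != 0 &
  \det (contr1 T x) = 0 /\ forall i, ddet (contr1 T x) (contr1 T (delta_mx 0 i)) = 0.
Proof.
have grad i : contr1 T (delta_mx 0 i) = \matrix_(j, k) T (i, j, k).
  apply/matrixP => j k; rewrite !mxE (bigD1 i) //= big1 => [|i' ne].
    by rewrite mxE !eqxx mul1r addr0.
  by rewrite mxE (negPf ne) andbF mul0r.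
have e0 : delta_mx 0 0 != 0 :> 'rV[K]_3.
  by apply/eqP => /matrixP/(_ 0 0)/eqP; rewrite !mxE oner_eq0.
(* If the determinant is identically zero, every point is singular. *)
move=> sing; have [z|nz] := eqVneq (det_form T) 0.
  exists (delta_mx 0 0) => //; split=> [|i]; first by rewrite -meval_det_form z meval0.
  by rewrite grad -mderiv_det_form z mderiv0 meval0.
apply: NNPP => no; apply: sing; split=> // x xn fx.
apply: NNPP => grad0; apply: no; exists x => //; split; first by rewrite -meval_det_form.
move=> i; rewrite grad -mderiv_det_form; apply/eqP/negPn/negP => ne.
by apply: grad0; exists i.
Qed.

Lemma ddet_lin P Q1 Q2 a b : ddet P (a *: Q1 + b *: Q2) = a * ddet P Q1 + b * ddet P Q2.
Proof. by rewrite /ddet !mxE; ring. Qed.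

Theorem classification T : concise T -> E1_singular T ->
  exists lam l, lam != 0 /\ equiv_up_to_swap T (normal_form lam l).
Proof.
move=> /concise_net_contr1 cT /singular_point[x xn [d0 dd]].
suff /(_ cT) [lam [l [nz e]]] : classified (contr1 T).
  by exists lam, l; split=> //; apply: net_equiv_tensor.
have [A uA Ax] := move_to_e0 xn.
have Pn : contr1 T x != 0 by case: cT => c1 _ _; apply: contraNneq xn => /c1 ->.
have [B [C [uB uC nf]]] := rank_normal_form Pn d0.
pose f y := B *m contr1 T (y *m A) *m C.
apply: (classified_act (g := f) uA uB uC) => //.
pose M := f (row3 0 1 0); pose N := f (row3 0 0 1); pose P := f (row3 1 0 0).
have flin (y : 'rV[K]_3) : f y = y 0 0 *: P + y 0 1 *: M + y 0 2 *: N.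
  rewrite /P /M /N /f (contr1_lin T (y *m A)) (contr1_lin T (row3 1 0 0 *m A)).
  rewrite (contr1_lin T (row3 0 1 0 *m A)) (contr1_lin T (row3 0 0 1 *m A)).
  rewrite [A]mx3E [y]row3E !mul_row3 !row3_coord.
  move: (contr1 T _) (contr1 T _) (contr1 T _) => U V W.
  rewrite !(mulmxDl, mulmxDr, =^~ scalemxAl, =^~ scalemxAr, scalerDr, scalerA).
  by apply/matrixP => j k; rewrite !mxE; ring.
have EP : P = B *m contr1 T x *m C by rewrite /P /f Ax.
have H F : (forall y : 'rV[K]_3, f y = form3 F y) -> classified (form3 F) -> classified f.
  move=> e H; apply: (@classified_act _ 1%:M 1%:M 1%:M _ (form3 F)); rewrite ?unitmx1 // => y.
  by rewrite -e mul1mx !mulmx1.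
case: nf => nf; rewrite -EP in nf.
  apply: H (@classified_rank1 K (M 0 0) (N 0 0) (M 0 1) (N 0 1) (M 0 2) (N 0 2) (M 1 0) (N 1 0)
    (M 2 0) (N 2 0) (M 1 1) (N 1 1) (M 1 2) (N 1 2) (M 2 1) (N 2 1) (M 2 2) (N 2 2)) => y.
  rewrite flin nf /form3 /net_rank1; move: (M) (N) => U V.
  by apply/matrixP; do 2!elim/ord3P; rewrite !mxE /=; ring.
have dP (Q : 'M[K]_3) : Q = M \/ Q = N -> Q 2 2 = 0.
  have z (y : 'rV[K]_3) : (f y) 2 2 = 0.
    (* At P = diag(1, 1, 0) the derivative of the determinant is the last diagonal entry, and
       singularity makes it vanish in every direction of the net. *)
    have -> : (f y) 2 2 = ddet P (f y) by rewrite nf /ddet !mxE /=; ring.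
    rewrite EP; apply: ddet_mul0 => //.
    set w := y *m A; rewrite (_ : contr1 T w = w 0 0 *: contr1 T (delta_mx 0 0) +
       1 *: (w 0 1 *: contr1 T (delta_mx 0 1) + w 0 2 *: contr1 T (delta_mx 0 2))).
      by rewrite !ddet_lin !dd !(mulr0, addr0).
    rewrite [LHS]contr1_lin scale1r addrA.
    by congr (_ *: contr1 T _ + _ *: contr1 T _ + _ *: contr1 T _);
      apply/rowP; elim/ord3P; rewrite !mxE.
  by case=> ->; apply: z.
have M22 : M 2 2 = 0 by apply: dP; left.
have N22 : N 2 2 = 0 by apply: dP; right.
apply: H (@classified_rank2 K (M 0 0) (N 0 0) (M 0 1) (N 0 1) (M 1 0) (N 1 0) (M 1 1) (N 1 1)
  (M 0 2) (N 0 2) (M 1 2) (N 1 2) (M 2 0) (N 2 0) (M 2 1) (N 2 1)) => y.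
rewrite flin nf /form3 /net_rank2; move: (M) (N) M22 N22 => U V U22 V22.
by apply/matrixP; do 2!elim/ord3P; rewrite !mxE ?U22 ?V22 /=; ring.
Qed.

End Classification.

(** * Collineation varieties *)

Section Closures.
Variable K : numClosedFieldType.

Lemma meval_homogZ n d (p : {mpoly K[n]}) (c : K) (v : 'I_n -> K) : p \is d.-homog ->
  p.@[fun i => c * v i] = c ^+ d * p.@[v].
Proof.
move=> /dhomogP hp; rewrite !mevalE mulr_sumr; apply: eq_big_seq => m mp.
have <- : mdeg m = d := hp m mp.
rewrite mulrCA mdegE -prodrXr -big_split /=.
by congr (_ * _); apply: eq_bigr => i _; rewrite exprMn.
Qed.

Lemma dhomog_prodX n m (q : 'I_m -> {mpoly K[n]}) (e : 'I_m -> nat) :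
  (forall i, q i \is 1.-homog) -> \prod_i q i ^+ e i \is (\sum_i e i).-homog.
Proof.
move=> hq; elim/big_rec2: _ => [|i p d _ hp]; first exact: dhomog1.
by apply: dhomogM => //; rewrite -[X in X.-homog]mul1n; apply: dhomogMn.
Qed.

Lemma dhomog_var n (i : 'I_n) : ('X_i : {mpoly K[n]}) \is 1.-homog.
Proof. by rewrite dhomogX; apply/eqP; exact: mdeg1. Qed.

Lemma dhomog_linear_form n (c : 'I_n -> K) : \sum_i c i *: 'X_i \is 1.-homog.
Proof. by apply: rpred_sum => i _; apply/dhomogZ/dhomog_var. Qed.

Lemma meval_linear_form n (c v : 'I_n -> K) :
  (\sum_i c i *: 'X_i : {mpoly K[n]}).@[v] = \sum_i c i * v i.
Proof. by rewrite raddf_sum /=; apply: eq_bigr => i _; rewrite mevalZ mevalXU. Qed.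

Definition lin_comp n m (A : 'M[K]_(n, m)) (p : {mpoly K[m]}) : {mpoly K[n]} :=
  p \mPo [tuple \sum_i A i j *: 'X_i | j < m].

Lemma meval_lin_comp n m (A : 'M[K]_(n, m)) p (v : 'rV_n) :
  (lin_comp A p).@[v 0] = p.@[(v *m A) 0].
Proof.
rewrite /lin_comp comp_mpoly_meval; apply: meval_eq => j.
rewrite tnth_mktuple mxE meval_linear_form; apply: eq_bigr => i _.
by rewrite mulrC.
Qed.

Lemma dhomog_lin_comp n m (A : 'M[K]_(n, m)) d p :
  p \is d.-homog -> lin_comp A p \is d.-homog.
Proof.
move=> /dhomogP hp; rewrite /lin_comp comp_mpolyEX.
rewrite big_seq; apply: rpred_sum => m' mp; apply: dhomogZ.
have <- : mdeg m' = d := hp m' mp.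
rewrite comp_mpolyX mdegE; apply: dhomog_prodX => j.
by rewrite tnth_mktuple; apply: dhomog_linear_form.
Qed.

Lemma zariski_closure_eq n (S S' : 'rV[K]_n -> Prop) y : (forall z, S z <-> S' z) ->
  zariski_closure S y -> zariski_closure S' y.
Proof. by move=> e [y0 h]; split=> // d p hp z; apply: (h d p hp) => x /e; apply: z. Qed.

Lemma closed_image_scale m n (f : 'rV[K]_m -> 'rV[K]_n) x c : c != 0 -> f x != 0 ->
  closed_image f (c *: f x).
Proof.
move=> c0 nz; split=> [|d p hp z]; first by rewrite scaler_eq0 negb_or c0.
rewrite (meval_eq (v2 := fun i => c * f x 0 i)) => [|i]; last by rewrite mxE.
by rewrite (meval_homogZ _ _ hp) z ?mulr0 //; split=> //; exists x.
Qed.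

(** A linear embedding is closed: the linear equations y = y B A hold on the image, hence on its
    closure. Pulling polynomials back along A and B then compares the two closures. *)
Lemma closed_image_linear m n k (f : 'rV[K]_m -> 'rV[K]_n) (A : 'M_(n, k)) (B : 'M_(k, n)) y :
  A *m B = 1%:M ->
  closed_image (fun x => f x *m A) y <-> exists2 z, closed_image f z & y = z *m A.
Proof.
move=> AB; have inj z : z *m A = 0 -> z = 0 :> 'rV_n.
  by move=> e; rewrite -[z]mulmx1 -AB mulmxA e mul0mx.
split=> [[y0 h]|[z [z0 h] ->]].
  have yE : y = y *m B *m A.
    apply/rowP => i; pose q : {mpoly K[k]} := 'X_i - lin_comp B (\sum_j A j i *: 'X_j).
    suff : q.@[y 0] = 0.
      rewrite mevalB mevalXU meval_lin_comp meval_linear_form => /eqP.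
      rewrite subr_eq0 => /eqP ->.
      by rewrite [RHS]mxE; apply: eq_bigr => j _; rewrite mulrC.
    have hq : q \is 1.-homog.
      by apply: rpredB; [apply: dhomog_var | apply/dhomog_lin_comp/dhomog_linear_form].
    apply: (h _ _ hq) => z [_ [x ->]].
    rewrite mevalB mevalXU meval_lin_comp meval_linear_form -mulmxA AB mulmx1 mxE.
    by apply/eqP; rewrite subr_eq0; apply/eqP/eq_bigr => j _; rewrite mulrC.
  exists (y *m B) => //; split=> [|d p hp z].
    by apply: contraNneq y0 => e; rewrite yE e mul0mx.
  rewrite -meval_lin_comp; apply: (h d _ (dhomog_lin_comp _ hp)) => w [wn [x we]].
  rewrite meval_lin_comp we -mulmxA AB mulmx1; apply: z; split; last by exists x.
  by apply: contraNneq wn => e; rewrite we e mul0mx.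
split=> [|d p hp zz]; first by apply: contraNneq z0 => /inj ->.
rewrite -meval_lin_comp; apply: (h d _ (dhomog_lin_comp _ hp)) => w [wn [x we]].
rewrite meval_lin_comp; apply: zz; rewrite we; split; last by exists x.
by apply: contraNneq wn => /inj; rewrite we => ->.
Qed.

Lemma closed_image_quadric m n (f : 'rV[K]_m -> 'rV[K]_n) (y : 'rV[K]_n) i j k l :
  (forall x, f x 0 i * f x 0 j = f x 0 k * f x 0 l) -> closed_image f y ->
  y 0 i * y 0 j = y 0 k * y 0 l.
Proof.
move=> e [_ h]; pose p : {mpoly K[n]} := 'X_i * 'X_j - 'X_k * 'X_l.
have hp : p \is 2.-homog.
  by apply: rpredB; apply: (@dhomogM _ _ _ 1 _ 1); apply: dhomog_var.
have : p.@[y 0] = 0.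
  by apply: (h _ _ hp) => z [_ [x ->]]; rewrite mevalB !mevalM !mevalXU e subrr.
by rewrite mevalB !mevalM !mevalXU => /eqP; rewrite subr_eq0 => /eqP.
Qed.

Lemma poly_eq0_everywhere (p : {poly K}) : (forall t, p.[t] = 0) -> p = 0.
Proof.
move=> h; apply/eqP/negPn/negP => p0.
suff : (size [seq i%:R : K | i <- iota 0 (size p)] < size p)%N by rewrite size_map size_iota ltnn.
apply: max_poly_roots => //; first by apply/allP => t _; apply/rootP.
by rewrite map_inj_uniq ?iota_uniq // => i j /eqP; rewrite eqr_nat => /eqP.
Qed.

(* Points in the limit of a polynomial curve that lies generically in the cone
   over the image. *)
Lemma closed_image_curve m n (f : 'rV[K]_m -> 'rV[K]_n) (g : 'I_n -> {poly K}) (q : {poly K}) (y : 'rV[K]_n) :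
  q != 0 -> y != 0 -> (forall i, (g i).[0] = y 0 i) ->
  (forall t, q.[t] != 0 -> exists x c, [/\ c != 0, f x != 0 & forall i, c * (g i).[t] = f x 0 i]) ->
  closed_image f y.
Proof.
move=> q0 y0 gy h; split=> // d p hp z.
pose P := \sum_(m <- msupp p) (p@_m)%:P * \prod_i g i ^+ m i.
have PE t : P.[t] = p.@[fun i => (g i).[t]].
  rewrite /P mevalE horner_sum; apply: eq_bigr => m' _.
  rewrite hornerM hornerC horner_prod; congr (_ * _).
  by apply: eq_bigr => i _; rewrite horner_exp.
rewrite -(meval_eq (v1 := fun i => (g i).[0])) // -PE.
suff -> : P = 0 by rewrite horner0.
(* The factor q takes care of the excluded parameters, so that the product vanishes everywhere. *)
have : q * P = 0.
  apply: poly_eq0_everywhere => t; rewrite hornerM.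
  have [->|qt] := eqVneq q.[t] 0; first by rewrite mul0r.
  have [x [c [c0 fx e]]] := h t qt.
  have : c ^+ d * P.[t] = 0.
    by rewrite PE -(meval_homogZ _ _ hp) (meval_eq (v2 := f x 0)) // z //; split=> //; exists x.
  by move/eqP; rewrite mulf_eq0 expf_eq0 (negPf c0) andbF /= => /eqP ->; rewrite mulr0.
by move/eqP; rewrite mulf_eq0 (negPf q0) => /eqP.
Qed.

End Closures.

(** * Parametrizations of the model varieties *)

Section Models.
Variable K : numClosedFieldType.

Lemma row_inordP n (y z : 'rV[K]_n.+1) :
  (forall k, (k < n.+1)%N -> y 0 (inord k) = z 0 (inord k)) -> y = z.
Proof. by move=> h; apply/rowP => i; have := h i (ltn_ord i); rewrite inord_val. Qed.

(** M allows a change of coordinates between the model and the closure of the image; it is the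
    identity except for the Segre quadric, whose points are vectorized matrices. *)
Definition parametrized m n (X : 'rV[K]_n -> Prop) (phi : 'rV[K]_m -> 'rV[K]_n) :=
  exists M M', M *m M' = 1%:M /\
    forall y, closed_image phi y <-> exists2 x, X x & y = x *m M.

Lemma parametrized_id m n X (phi : 'rV[K]_m -> 'rV[K]_n) :
  (forall y, closed_image phi y <-> X y) -> parametrized X phi.
Proof.
move=> h; exists 1%:M, 1%:M; rewrite mulmx1; split=> // y; rewrite h.
by split=> [Xy|[x Xx ->]]; [exists y; rewrite ?mulmx1 | rewrite mulmx1].
Qed.

Lemma linearly_isomorphic_param m n p X (phi : 'rV[K]_m -> 'rV[K]_n) (f : 'rV[K]_m -> 'rV[K]_p) Q A B :
  parametrized X phi -> Q \in unitmx -> A *m B = 1%:M ->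
  (forall x, f x = phi (x *m Q) *m A) -> linearly_isomorphic X (closed_image f).
Proof.
move=> [M [M' [MM' hM]]] uQ AB e; exists (M *m A); split=> [v _ v0|y].
  by rewrite -[v]mulmx1 -MM' -[M]mulmx1 -AB !mulmxA -(mulmxA v) v0 !mul0mx.
have -> : closed_image f y <-> closed_image (fun x => phi x *m A) y.
  split; apply: zariski_closure_eq => z; split=> -[zn [x zx]]; split=> //.
  - by exists (x *m Q); rewrite zx e.
  - by exists (x *m invmx Q); rewrite zx e mulmxKV.
  - by exists (x *m invmx Q); rewrite zx e mulmxKV.
  - by exists (x *m Q); rewrite zx e.
rewrite (closed_image_linear phi y AB); split=> [[z /hM[x Xx ->] ->]|[x Xx ->]].
  by exists x; rewrite // mulmxA.
by exists (x *m M); rewrite ?mulmxA //; apply/hM; exists x.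
Qed.

Ltac coords := rewrite !mxE ?inordK //=.

(** The image is already closed. One of the squares v0, v3, v5 is nonzero, and four 2 x 2 minors of
    the symmetric matrix of coordinates let one recover the point after dividing by it. *)
Lemma veronese_param : parametrized (@veronese_surface K) (@veronese_map K).
Proof.
apply: parametrized_id => y; split=> [cl|[x [c [x0 c0 ->]]]]; last first.
  apply: closed_image_scale => //; apply: contraNneq x0 => /rowP e.
  have := e (inord 0); have := e (inord 3); have := e (inord 5); coords.
  move=> /eqP; rewrite expf_eq0 => /eqP x2 /eqP; rewrite expf_eq0 => /eqP x1 /eqP; rewrite expf_eq0 => /eqP x0.
  by apply/eqP/rowP; elim/ord3P; rewrite mxE.
pose v k := y 0 (inord k).
have r i j k l : (forall x : 'rV[K]_3, veronese_map x 0 (inord i) * veronese_map x 0 (inord j) =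
    veronese_map x 0 (inord k) * veronese_map x 0 (inord l)) -> v i * v j = v k * v l.
  by move=> h; apply: closed_image_quadric cl.
have r03 : v 0%N * v 3%N = v 1%N * v 1%N by apply: r => x; coords; ring.
have r05 : v 0%N * v 5%N = v 2%N * v 2%N by apply: r => x; coords; ring.
have r35 : v 3%N * v 5%N = v 4%N * v 4%N by apply: r => x; coords; ring.
have r04 : v 0%N * v 4%N = v 1%N * v 2%N by apply: r => x; coords; ring.
have yE a b c t : t != 0 -> v 0%N = t * a ^+ 2 -> v 1%N = t * (a * b) -> v 2%N = t * (a * c) ->
    v 3%N = t * b ^+ 2 -> v 4%N = t * (b * c) -> v 5%N = t * c ^+ 2 -> veronese_surface y.
  move=> t0 e0 e1 e2 e3 e4 e5; exists (row3 a b c), t.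
  have yv : y = t *: veronese_map (row3 a b c).
    by apply: row_inordP => -[|[|[|[|[|[|//]]]]]] _; rewrite -/(v _) ?(e0, e1, e2, e3, e4, e5); coords.
  split=> //; case: cl => yn _; apply: contraNneq yn => /rowP z; rewrite yv.
  have := z 0; have := z 1; have := z 2; rewrite !mxE /= => z2 z1 z0.
  apply/eqP/row_inordP => -[|[|[|[|[|[|//]]]]]] _; coords; rewrite ?z0 ?z1 ?z2; ring.
have [v0|v0] := eqVneq (v 0%N) 0; last first.
  by apply: (yE (v 0%N) (v 1%N) (v 2%N) (v 0%N)^-1); rewrite ?invr_eq0 //;
    apply: (mulfI v0); rewrite ?r03 ?r04 ?r05; field.
have v1 : v 1%N = 0 by apply/eqP; rewrite -[_ == 0]orbb -mulf_eq0 -r03 v0 mul0r.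
have v2 : v 2%N = 0 by apply/eqP; rewrite -[_ == 0]orbb -mulf_eq0 -r05 v0 mul0r.
have [v3|v3] := eqVneq (v 3%N) 0; last first.
  by apply: (yE 0 (v 3%N) (v 4%N) (v 3%N)^-1); rewrite ?invr_eq0 ?v0 ?v1 ?v2 //; try ring;
    apply: (mulfI v3); rewrite ?r35; field.
have v4 : v 4%N = 0 by apply/eqP; rewrite -[_ == 0]orbb -mulf_eq0 -r35 v3 mul0r.
have v5 : v 5%N != 0.
  case: cl => yn _; apply: contraNneq yn => v5; apply/eqP/row_inordP.
  by move=> [|[|[|[|[|[|//]]]]]] _; rewrite -/(v _) ?(v0, v1, v2, v3, v4, v5) mxE.
by apply: (yE 0 0 (v 5%N) (v 5%N)^-1); rewrite ?invr_eq0 ?v0 ?v1 ?v2 ?v3 ?v4 //; first [ring | field].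
Qed.

Lemma scroll_param : parametrized (@cubic_scroll K) (@scroll_map K).
Proof. exact: parametrized_id. Qed.

Definition cone_map (x : 'rV[K]_3) : 'rV[K]_4 :=
  \row_i [:: x 0 0 ^+ 2; x 0 0 * x 0 1; x 0 1 ^+ 2; x 0 0 * x 0 2]`_i.

Lemma cone_param : parametrized (@quadric_cone K) cone_map.
Proof.
apply: parametrized_id => y; split=> [cl|[yn ye]].
  split; first by case: cl.
  by rewrite expr2; apply: (closed_image_quadric _ cl) => x; rewrite !mxE /=; ring.
pose v k := y 0 (inord k).
have [i0 i1 i2] : [/\ 0 = inord 0 :> 'I_4, 1 = inord 1 :> 'I_4 & 2 = inord 2 :> 'I_4].
  by split; apply: val_inj; rewrite /= inordK.
rewrite i2 i1 i0 -!/(v _) in ye.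
have [v0|v0] := eqVneq (v 0%N) 0; last first.
  have -> : y = (v 0%N)^-1 *: cone_map (row3 (v 0%N) (v 1%N) (v 3%N)).
    apply: row_inordP => -[|[|[|[|//]]]] _; rewrite -/(v _); coords; try by field.
    by rewrite -ye; field.
  apply: closed_image_scale; rewrite ?invr_eq0 //; apply: contraNneq v0 => /rowP/(_ 0).
  by rewrite !mxE /= => /eqP; rewrite expf_eq0.
have v1 : v 1%N = 0 by apply/eqP; rewrite -[_ == 0]orbb -mulf_eq0 -expr2 -ye v0 mul0r.
(* A point (0, 0, v2, v3) is the limit at t = 0 of (t^2 s, t s, s, v3) with s = t + v2. Perturbing
   v2 keeps s nonzero for general t, even at the vertex v2 = 0. *)
pose a : {poly K} := 'X + (v 2%N)%:P.
apply: (@closed_image_curve _ _ _ _ (fun i => nth 0 [:: 'X ^+ 2 * a; 'X * a; a; (v 3%N)%:P] i) ('X * a)) => //.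
- by rewrite mulf_neq0 ?polyX_eq0 ?monic_neq0 ?monicXaddC.
- move=> i; rewrite -[in RHS](inord_val i).
  by case: i => [[|[|[|[|//]]]]] /= lti; rewrite -/(v _) ?v0 ?v1 /a !hornerE /=; ring.
move=> t; rewrite /a !hornerE; set s := t + v 2%N => ts.
exists (row3 (t ^+ 2 * s) (t * s) (v 3%N)), (t ^+ 2 * s).
have [t0 s0] : t != 0 /\ s != 0 by apply/andP; rewrite -negb_or -mulf_eq0.
split; first by rewrite mulf_neq0 ?expf_neq0.
  apply/eqP => /rowP/(_ 0)/eqP; rewrite !mxE /=; apply/negP.
  by rewrite expf_neq0 // mulf_neq0 ?expf_neq0.
by move=> [[|[|[|[|//]]]]] lti; rewrite !mxE /= !hornerE /= -/s; ring.
Qed.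

Definition conic_map (x : 'rV[K]_3) : 'rV[K]_3 := row3 (x 0 0 ^+ 2) (x 0 0 * x 0 1) (x 0 1 ^+ 2).

Lemma conic_param : parametrized (@plane_conic K) conic_map.
Proof.
apply: parametrized_id => y; split=> [cl|[yn ye]].
  split; first by case: cl.
  by rewrite expr2; apply: (closed_image_quadric _ cl) => x; rewrite !mxE /=; ring.
have [v0|v0] := eqVneq (y 0 0) 0.
  have v1 : y 0 1 = 0 by apply/eqP; rewrite -[_ == 0]orbb -mulf_eq0 -expr2 -ye v0 mul0r.
  have yE : y = y 0 2 *: conic_map (row3 0 1 0).
    by rewrite [LHS]row3E v0 v1; apply/rowP; elim/ord3P; rewrite !mxE /=; ring.
  rewrite yE; apply: closed_image_scale.
    by apply: contraNneq yn => z; rewrite yE z scale0r.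
  by apply/eqP => /rowP/(_ 2)/eqP; rewrite !mxE /= expr1n oner_eq0.
have -> : y = (y 0 0)^-1 *: conic_map (row3 (y 0 0) (y 0 1) 0).
  apply/rowP; elim/ord3P; rewrite !mxE /=; try by field.
  by rewrite -ye; field.
apply: closed_image_scale; rewrite ?invr_eq0 //; apply/eqP => /rowP/(_ 0)/eqP.
by rewrite !mxE /= expf_eq0 (negPf v0).
Qed.

(* A quadratic map with a rational inverse psi, up to a monomial factor, dominates the plane. *)
Lemma plane_param (phi psi : 'rV[K]_3 -> 'rV[K]_3) (e0 e1 e2 : nat) :
  (forall z, phi (psi z) = (z 0 0 ^+ e0 * z 0 1 ^+ e1 * z 0 2 ^+ e2) *: z) ->
  parametrized (@plane K) phi.
Proof.
move=> h; apply: parametrized_id => y; split=> [[] //|yn].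
pose g (i : 'I_3) : {poly K} := 'X + (y 0 i)%:P.
apply: (@closed_image_curve _ _ _ _ g (g 0 * g 1 * g 2)) => //.
- by rewrite !mulf_neq0 ?monic_neq0 ?monicXaddC.
- by move=> i; rewrite /g !hornerE.
move=> t; rewrite !hornerM !mulf_eq0 !negb_or => /andP[/andP[n0 n1] n2].
pose z := \row_i (g i).[t]; exists (psi z), (z 0 0 ^+ e0 * z 0 1 ^+ e1 * z 0 2 ^+ e2).
have c0 : z 0 0 ^+ e0 * z 0 1 ^+ e1 * z 0 2 ^+ e2 != 0 by rewrite !mulf_neq0 ?expf_neq0 ?mxE.
split=> //; last by move=> i; rewrite h !mxE.
rewrite h scaler_eq0 negb_or c0; apply/eqP => /rowP/(_ 0)/eqP.
by rewrite !mxE (negPf n0).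
Qed.

(** The tensor product of (x0, x1) and (x0, x2): a birational parametrization of the quadric by the
    plane. *)
Definition segre_map (x : 'rV[K]_3) : 'rV[K]_4 :=
  \row_i [:: x 0 0 ^+ 2; x 0 0 * x 0 2; x 0 0 * x 0 1; x 0 1 * x 0 2]`_i.

Lemma mxvec_dot (R : pzRingType) m n (A B : 'M[R]_(m, n)) :
  \sum_c mxvec A 0 c * mxvec B 0 c = \sum_i \sum_j A i j * B i j.
Proof.
rewrite pair_big /= (reindex (uncurry (@mxvec_index m n))); last exact: curry_mxvec_bij.
by apply: eq_bigr => -[i j] _ /=; rewrite !mxvecE.
Qed.

Lemma sum_delta m n (A : 'M[K]_(m, n)) k l : \sum_i \sum_j A i j * delta_mx k l i j = A k l.
Proof.
rewrite (bigD1 k) //= [X in _ + X]big1 ?addr0 => [|i ne]; last first.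
  by apply: big1 => j _; rewrite mxE (negPf ne) mulr0.
rewrite (bigD1 l) //= big1 ?addr0 => [|j ne]; last by rewrite mxE (negPf ne) andbF mulr0.
by rewrite mxE !eqxx mulr1.
Qed.

(** Lists the entries in row-major order. The enumeration behind [mxvec] is never computed: entries
    are selected by dot products with elementary matrices. *)
Definition entries4 : 'M[K]_(2 * 2, 4) :=
  \matrix_(c, k) mxvec (delta_mx (inord (k %/ 2)) (inord (k %% 2)) : 'M[K]_2) 0 c.

Lemma mul_entries4 (W : 'M[K]_2) k : (mxvec W *m entries4) 0 k = W (inord (k %/ 2)) (inord (k %% 2)).
Proof.
rewrite mxE -[RHS]sum_delta -mxvec_dot; apply: eq_bigr => c _; by rewrite mxE.
Qed.

Lemma entries4_unit : entries4 *m entries4^T = 1%:M.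
Proof.
apply: mulmx1C; apply/matrixP => k l.
rewrite mxE (eq_bigr (fun c => mxvec (delta_mx (inord (k %/ 2)) (inord (k %% 2)) : 'M[K]_2) 0 c *
  mxvec (delta_mx (inord (l %/ 2)) (inord (l %% 2)) : 'M[K]_2) 0 c)) => [|c _]; last by rewrite !mxE.
rewrite mxvec_dot sum_delta !mxE -!(inj_eq val_inj).
by case: k l => [[|[|[|[|//]]]] ?] [[|[|[|[|//]]]] ?]; rewrite /= !inordK.
Qed.

Definition row2 (a b : K) : 'rV[K]_2 := \row_i [:: a; b]`_i.

Lemma row2_eq0 a b : (row2 a b == 0) = (a == 0) && (b == 0).
Proof.
apply/eqP/andP => [/rowP e|[/eqP -> /eqP ->]].
  by have := e 0; have := e 1; rewrite !mxE /= => -> ->.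
by apply/rowP => -[[|[|//]] ?]; rewrite !mxE.
Qed.

Lemma row2E (s : 'rV[K]_2) : s = row2 (s 0 0) (s 0 1).
Proof.
by apply/rowP => -[[|[|//]] ?]; rewrite !mxE /=; congr (s _ _); apply: val_inj.
Qed.

Lemma segre_coords a b c d :
  mxvec ((row2 a b)^T *m row2 c d) *m entries4 = \row_(i < 4) [:: a * c; a * d; b * c; b * d]`_i.
Proof.
apply/rowP => i; rewrite mul_entries4 mxE big_ord1 !mxE.
by case: i => [[|[|[|[|//]]]] ?]; rewrite /= !inordK.
Qed.

Lemma segre_param : parametrized (@segre_quadric K) segre_map.
Proof.
exists entries4, entries4^T; split=> [|y]; first exact: entries4_unit.
have inj u : u *m entries4 = 0 -> u = 0.
  by move=> e; rewrite -[u]mulmx1 -entries4_unit mulmxA e mul0mx.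
split=> [cl|[_ [s [t [s0 t0 ->]]] ->]].
  pose v k := y 0 (inord k).
  have rel : v 0%N * v 3%N = v 1%N * v 2%N.
    by apply: (closed_image_quadric _ cl) => x; rewrite !mxE ?inordK //=; ring.
  have yE a b c d : v 0%N = a * c -> v 1%N = a * d -> v 2%N = b * c -> v 3%N = b * d ->
      exists2 x, segre_quadric x & y = x *m entries4.
    move=> e0 e1 e2 e3; have yv : y = mxvec ((row2 a b)^T *m row2 c d) *m entries4.
      by rewrite segre_coords; apply: row_inordP => -[|[|[|[|//]]]] _; rewrite mxE inordK.
    exists (mxvec ((row2 a b)^T *m row2 c d)) => //; exists (row2 a b), (row2 c d); split=> //.
      by case: cl => yn _; apply: contraNneq yn => z; rewrite yv z trmx0 mul0mx linear0 mul0mx.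
    by case: cl => yn _; apply: contraNneq yn => z; rewrite yv z mulmx0 linear0 mul0mx.
  have [v0|v0] := eqVneq (v 0%N) 0; last first.
    apply: (yE 1 (v 2%N / v 0%N) (v 0%N) (v 1%N)); try by field.
    by apply: (mulfI v0); rewrite rel; field.
  have : v 1%N * v 2%N == 0 by rewrite -rel v0 mul0r.
  rewrite mulf_eq0 => /orP[] /eqP vz.
    by apply: (yE 0 1 (v 2%N) (v 3%N)); rewrite ?v0 ?vz; ring.
  by apply: (yE (v 1%N) (v 3%N) 0 1); rewrite ?v0 ?vz; ring.
rewrite (row2E s) (row2E t) segre_coords; move: s0 t0; rewrite [s]row2E [t]row2E !row2_eq0.
move: (s 0 0) (s 0 1) (t 0 0) (t 0 1) => {s t} a b c d ab cd.
(* The factors (a, b) and (c, d) are perturbed to (t + a, b) and (t + c, d), whose first entries are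
   generically nonzero; there the parametrization can be inverted. *)
pose s : {poly K} := 'X + a%:P; pose t : {poly K} := 'X + c%:P.
apply: (@closed_image_curve _ _ _ _ (fun i => nth 0 [:: s * t; d *: s; b *: t; (b * d)%:P] i) (s * t)).
- by rewrite mulf_neq0 ?monic_neq0 ?monicXaddC.
- apply: contraTneq cd => /rowP e; have := e 0; have := e 1; have := e 2; have := e 3.
  rewrite !mxE /= => e3 e2 e1 e0; rewrite negbK; move: ab; rewrite negb_and => /orP[] n.
    by apply/andP; split; apply/eqP/(mulfI n); rewrite mulr0.
  by apply/andP; split; apply/eqP/(mulfI n); rewrite mulr0.
- by move=> [[|[|[|[|//]]]] ?]; rewrite !mxE /s /t !hornerE /=; ring.
move=> x; rewrite hornerM mulf_eq0 negb_or /s /t !hornerE => /andP[sn tn].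
exists (row3 ((x + a) * (x + c)) (b * (x + c)) ((x + a) * d)), ((x + a) * (x + c)).
split; first by rewrite mulf_neq0.
  apply/eqP => /rowP/(_ 0)/eqP; rewrite !mxE /=; apply/negP.
  by rewrite expf_neq0 // mulf_neq0.
by move=> [[|[|[|[|//]]]] ?]; rewrite !mxE /= !hornerE /=; ring.
Qed.

End Models.

(** * Minors of the normal forms and the table of collineation varieties *)

Section RecordedVarieties.
Variable K : numClosedFieldType.
Implicit Types (T S : tensor K) (M N : 'M[K]_3).

(** The second compound matrix, without cofactor signs, hence multiplicative (Cauchy-Binet). *)
Definition compound M : 'M[K]_3 := \matrix_(j, k) \det (row' j (col' k M)).

Lemma det2 (M : 'M[K]_2) : \det M = M 0 0 * M 1 1 - M 0 1 * M 1 0.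
Proof.
rewrite (expand_det_row M 0) !big_ord_recl big_ord0 /cofactor !det_mx11 !mxE /=.
pose m (a b : nat) := M (inord a) (inord b).
have E i j : M i j = m i j by rewrite /m !inord_val.
by rewrite !E /= /bump /=; ring.
Qed.

Lemma compound_mx3 (a b c d e f g h i : K) : compound (mx3 a b c d e f g h i) =
  mx3 (e * i - f * h) (d * i - f * g) (d * h - e * g)
      (b * i - c * h) (a * i - c * g) (a * h - b * g)
      (b * f - c * e) (a * f - c * d) (a * e - b * d).
Proof. by apply/matrixP; do 2!elim/ord3P; rewrite mxE det2 !mxE. Qed.

Lemma compound_mul M N : compound (M *m N) = compound M *m compound N.
Proof.
by rewrite (mx3E M) (mx3E N) mul_mx3 !compound_mx3 mul_mx3; congr mx3; ring.
Qed.

Lemma compound1 : compound 1%:M = 1%:M.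
Proof. by rewrite [1%:M]mx3E compound_mx3 !mxE /=; congr mx3; ring. Qed.

Lemma compound_tr M : compound M^T = (compound M)^T.
Proof. by rewrite (mx3E M) tr_mx3 !compound_mx3 tr_mx3; congr mx3; ring. Qed.

Lemma minorsE T x : minors T x = mxvec (compound (contr1 T x)).
Proof. by []. Qed.

(** Equivalent tensors have the same minors up to a substitution and the invertible linear map N |->
    U N V given by compound matrices, composed with transposition when the factors are swapped. *)
Lemma minors_equiv T S : equiv_up_to_swap T S -> exists Q L L',
  [/\ Q \in unitmx, L *m L' = 1%:M & forall x, minors T x = minors S (x *m Q) *m L].
Proof.
have mx_lin L : (forall N, mxvec N *m L = mxvec N) -> L = 1%:M :> 'M[K]_(3 * 3).
  by move=> h; apply/row_matrixP => i; rewrite rowE -[delta_mx _ _]vec_mxK h rowE mulmx1 vec_mxK.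
move=> [A [B [C [uA uB uC e]]]].
pose U := compound (invmx B); pose V := compound (invmx C)^T.
pose U' := compound B; pose V' := compound C^T.
have UU : U' *m U = 1%:M by rewrite -compound_mul mulmxV // compound1.
have VV : V *m V' = 1%:M.
  by rewrite -compound_mul -trmx_mul mulmxV // trmx1 compound1.
have inv T' : S = gact A B C T' -> forall x,
    compound (contr1 T' x) = U *m compound (contr1 S (x *m invmx A)) *m V.
  move=> -> x; rewrite -!compound_mul contr1_gact mulmxKV // !mulmxA mulVmx // mul1mx.
  by rewrite -mulmxA -trmx_mul mulVmx // trmx1 mulmx1.
pose L := lin_mulmx U *m lin_mulmxr V; pose L' := lin_mulmxr V' *m lin_mulmx U'.
have LE N : mxvec N *m L = mxvec (U *m N *m V)
  by rewrite /L mulmxA /lin_mulmx mul_vec_lin /lin_mulmxr mul_vec_lin.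
have LE' N : mxvec N *m L' = mxvec (U' *m (N *m V'))
  by rewrite /L' mulmxA /lin_mulmxr mul_vec_lin /lin_mulmx mul_vec_lin.
have LL : L *m L' = 1%:M.
  by apply: mx_lin => N; rewrite mulmxA LE LE' -!mulmxA VV mulmx1 mulmxA UU mul1mx.
pose t : 'M[K]_(3 * 3) := lin_mx (@trmx K 3 3).
have tt : t *m t = 1%:M by apply: mx_lin => N; rewrite mulmxA !mul_vec_lin /= trmxK.
case: e => e.
  exists (invmx A), L, L'; rewrite unitmx_inv; split=> // x.
  by rewrite !minorsE (inv _ e) LE.
exists (invmx A), (L *m t), (t *m L'); rewrite unitmx_inv; split=> [||x] //.
  by rewrite mulmxA -(mulmxA L) tt mulmx1.
rewrite !minorsE mulmxA LE mul_vec_lin /= -(inv _ e) contr1_swap23 compound_tr.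
by rewrite trmxK.
Qed.

(* [minors_span] expresses the minors of a normal form in the coordinates of the
   parametrization of the recorded variety, and [minors_coord] expresses these
   coordinates in the minors. *)
Definition minors_span (lam : K) (l : label) (v0 v1 v2 v3 v4 v5 : K) : 'M[K]_3 :=
  match l with
  | III_1 => mx3 (v4 - lam * v0) (- (lam ^+ 2 * v1)) (- (lam * v3))   (lam * v5 - v1) (v2 - lam * v3) (v0 - lam ^+ 2 * v4)   (lam ^+ 2 * v2 - v3) (lam * v0) v1
  | III_2 => mx3 (v4 - lam * v0) (- (lam ^+ 2 * v1)) (- (lam * v3))   (lam * v5) v2 (v0 - lam ^+ 2 * v4)   (lam ^+ 2 * v2) (lam * v0) v1
  | III_ps => mx3 v4 (- (lam ^+ 2 * v1)) (- (lam * v3))   (lam * v5) v2 (- (lam ^+ 2 * v4))   (lam ^+ 2 * v2) (lam * v0) v1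
  | IV_1_i => mx3 (v0 - v4) (- v3) (- v2)   (- v3) (v1 - v2) v4   (- v2) v4 v3
  | IV_1_ii => mx3 v4 v5 0   v5 v2 0   (v2 - v3) (v0 - v4) (v1 - v5)
  | IV_1_iii => mx3 v4 v5 (v2 - v3)   v5 v2 (v0 - v4)   0 0 (v1 - v5)
  | IV_2_i => mx3 (v0 - v4) 0 0   (- v3) v1 v4   (- v2) v4 v3
  | IV_2_iii => mx3 v4 0 0   v5 v2 0   (v2 - v3) v0 v1
  | IV_2_vi => mx3 v3 v4 (- v2)   v4 v1 (- v3)   0 0 (v0 - v4)
  | IV_4_i => mx3 (- v0 + v3) 0 0   0 v1 v0   0 v0 v2
  | IV_4_ii => mx3 v3 0 0   v4 v1 0   (- v2) 0 v0
  | IV_4_iii => mx3 v3 v4 (- v2)   0 v1 0   0 0 v0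
  | IV_5_i => mx3 v0 (- v3) (- v2)   0 v1 0   0 v4 v3
  | IV_5_ii => mx3 v3 v4 0   0 v1 0   (- v2) (- v3) v0
  | IV_7_i => mx3 v3 0 0   0 v1 0   0 v0 v2
  | IV_ps => mx3 v0 0 0   0 v1 0   0 0 v2
  | V_1 => mx3 (v0 - v3) (- v1 - v3) (v2 - 2 * v4)   (- v1 + v3) v3 (- v0 + v1 - v4)   (v2 + 2 * v4) (v0 + v1 - v4) (v2 + v5)
  | V_2 => mx3 (v0 - v3) (- v1 - v3) (- v0 + v1 + v2 - 2 * v4)   (- v1 + v3) v3 (- 2 * v1 + v3 - v4)   (v0 + v1 + v2 + 2 * v4) (2 * v1 + v3 - v4) (- v0 + v4 + v5)
  | V_3 => mx3 v0 (- v1) (v2 - v3)   (- v1) v3 (- v0 - v4)   (v2 + v3) (v0 - v4) (v1 + v5)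
  | V_4 => mx3 v0 (- v1) (- v0 + v2)   (- v1) v3 (- 2 * v1 - v4)   (v0 + v2) (2 * v1 - v4) (- v0 + v5)
  | V_5 => mx3 v0 (- v1) v2   (- v1) v3 (- v0 - v4)   v2 (v0 - v4) v5
  | V_ps => mx3 v0 (- v1) v2   (- v1) v3 (- v4)   v2 (- v4) v5
  | I_1_i => mx3 (- v4) (- v3) (- v2)   (- v3) (- v2) v1   (- v2) v1 v0
  | I_1_ii => mx3 0 (- v0) (- v1)   0 (- v1) (- v2)   (v2 - v3) (- v4) (- v5)
  | I_2_i => mx3 (- v4) 0 v3   (- v3) 0 v1   (- v2) (v1 - v2) v0
  | I_2_iii => mx3 0 0 (- v0 - v1)   0 (- v1) (- v2)   (- v1 - v3) (- v4) (- v5)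
  | I_3_i => mx3 0 (- v3) (- v4)   0 (- v4) (- v3)   (v2 - v4) v0 v1
  | I_3_iii => mx3 0 0 (- v1 / 2 - v2 / 2)   0 (- v0) (- v1 / 2 + v2 / 2)   (- v1 / 2 - v2 / 2) (- v1 / 2 + v2 / 2) v3
  | I_4_i => mx3 0 0 (- v1)   0 (- v1) (- v0)   (- v4) (- v3) (- v2)
  | I_4_iii => mx3 v0 v1 0   v1 v3 0   0 0 (- v2 + v3)
  | I_5_i => mx3 0 0 v2   (- v0) (- v0) (- v1)   0 (- v2) (- v3)
  | I_5_iii => mx3 0 0 (- v1)   0 (- v1 - v2) 0   (- v0 - v1) 0 v3
  | I_6_i => mx3 0 0 (- v3)   0 (- v3) (- v2)   (- v4) (- v1) (- v0)
  | I_6_iii => mx3 (- v0) 0 v1   0 0 v3   v1 v3 (- v2)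
  | I_7_i => mx3 0 0 (- v0)   0 (- v0) (- v2)   (- v0) (- v1) (- v3)
  | I_7_ii => mx3 0 0 (- v1)   0 (- v1) (- v2)   (- v0) 0 v3
  | I_8 => mx3 0 0 (- v1)   0 (- v0) 0   (- v1) 0 v2
  | I_10 => mx3 0 0 (- v0)   0 (- v0) (- v1)   (- v0) (- v1) v2
  | I_11_i => mx3 0 0 0   0 (- v0) (- v2)   0 (- v1) (- v3)
  | I_11_ii => mx3 0 0 (- v1)   0 (- v1) 0   (- v0) 0 v2
  | I_14_i => mx3 0 0 v0   (- v0) 0 v1   0 (- v0) (- v2)
  | I_14_iii => mx3 0 0 0   0 (- v2) (- v1)   0 (- v1) (- v0)
  end.

Definition minors_coord (lam : K) (l : label) (m00 m01 m02 m10 m11 m12 m20 m21 m22 : K) : seq K :=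
  match l with
  | III_1 => [:: m21 / lam; m22; m11 - m02; - m02 / lam; m00 + m21; (m10 + m22) / lam]
  | III_2 => [:: m21 / lam; m22; m11; - m02 / lam; m00 + m21; m10 / lam]
  | III_ps => [:: m21 / lam; m22; m11; - m02 / lam; m00; m10 / lam]
  | IV_1_i => [:: m00 + m12; - m02 + m11; - m02; - m01; m12]
  | IV_1_ii => [:: m00 + m21; m01 + m22; m11; m11 - m20; m00; m01]
  | IV_1_iii => [:: m00 + m12; m01 + m22; m11; - m02 + m11; m00; m01]
  | IV_2_i => [:: m00 + m12; m11; - m20; - m10; m12]
  | IV_2_iii => [:: m21; m22; m11; m11 - m20; m00; m10]
  | IV_2_vi => [:: m01 + m22; m11; - m02; m00; m01]
  | IV_4_i => [:: m12; m11; m22; m00 + m12]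
  | IV_4_ii => [:: m22; m11; - m20; m00; m10]
  | IV_4_iii => [:: m22; m11; - m02; m00; m01]
  | IV_5_i => [:: m00; m11; - m02; - m01; m21]
  | IV_5_ii => [:: m22; m11; - m20; m00; m01]
  | IV_7_i => [:: m21; m11; m22; m00]
  | IV_ps => [:: m00; m11; m22]
  | V_1 => [:: m00 + m11; - m01 / 2 - m10 / 2; m02 / 2 + m20 / 2; m11; m00 - m01 - m21; - m02 / 2 - m20 / 2 + m22]
  | V_2 => [:: m00 + m11; - m01 / 2 - m10 / 2; m00 + m01 + m02 + 4 * m10 - 2 * m12; m11; - 2 * m01 - m11 - m21; m00 - m01 - m10 + m12 + m22]
  | V_3 => [:: m00; - m01; m02 + m11; m11; - m00 - m12; m01 + m22]
  | V_4 => [:: m00; - m01; m00 + m02; m11; 2 * m01 - m12; m00 + m22]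
  | V_5 => [:: m00; - m01; m02; m11; - m00 - m12; m22]
  | V_ps => [:: m00; - m01; m02; m11; - m12; m22]
  | I_1_i => [:: m22; m12; - m02; - m01; - m00]
  | I_1_ii => [:: - m01; - m02; - m12; - m12 - m20; - m21; - m22]
  | I_2_i => [:: m22; m12; - m20; m02; - m00]
  | I_2_iii => [:: - m02 + m11; - m11; - m12; m11 - m20; - m21; - m22]
  | I_3_i => [:: m21; m22; - m02 + m20; - m01; - m02]
  | I_3_iii => [:: - m11; - m02 - m12; - m02 + m12; m22]
  | I_4_i => [:: - m12; - m02; - m22; - m21; - m20]
  | I_4_iii => [:: m00; m01; m11 - m22; m11]
  | I_5_i => [:: - m10; - m12; m02; - m22]
  | I_5_iii => [:: m02 - m20; - m02; m02 - m11; m22]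
  | I_6_i => [:: - m22; - m21; - m12; - m02; - m20]
  | I_6_iii => [:: - m00; m02; - m22; m12]
  | I_7_i => [:: - m02; - m21; - m12; - m22]
  | I_7_ii => [:: - m20; - m02; - m12; m22]
  | I_8 => [:: - m11; - m02; m22]
  | I_10 => [:: - m02; - m12; m22]
  | I_11_i => [:: - m11; - m21; - m12; - m22]
  | I_11_ii => [:: - m20; - m02; m22]
  | I_14_i => [:: m02; m12; - m22]
  | I_14_iii => [:: - m22; - m12; - m11]
  end.

Lemma minors_span_linear lam l t u0 u1 u2 u3 u4 u5 v0 v1 v2 v3 v4 v5 :
  minors_span lam l (t * u0 + v0) (t * u1 + v1) (t * u2 + v2) (t * u3 + v3) (t * u4 + v4) (t * u5 + v5) =
  t *: minors_span lam l u0 u1 u2 u3 u4 u5 + minors_span lam l v0 v1 v2 v3 v4 v5.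
Proof. by case: l => /=; rewrite scale_mx3 add_mx3; congr mx3; ring. Qed.

(* For n < 5 the coordinates with index beyond n are junk, ignored by [minors_span]. *)
Definition span_fun n lam l (v : 'rV[K]_n.+1) : 'M[K]_3 :=
  minors_span lam l (v 0 (inord 0)) (v 0 (inord 1)) (v 0 (inord 2))
    (v 0 (inord 3)) (v 0 (inord 4)) (v 0 (inord 5)).

Lemma span_fun_linear n lam l : linear (fun v : 'rV[K]_n.+1 => mxvec (span_fun lam l v)).
Proof.
by move=> t u v; rewrite /span_fun !mxE minors_span_linear linearP.
Qed.

(** Each entry of the table is reduced to polynomial identities: the minors are linear in the
    parametrizing coordinates, and these are recovered from the minors, which gives injectivity. *)
Lemma recorded_param n (X : 'rV[K]_n.+1 -> Prop) (phi : 'rV[K]_3 -> 'rV[K]_n.+1) Q lam l T :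
  parametrized X phi -> Q \in unitmx ->
  (forall x0 x1 x2, compound (nf_mx lam l x0 x1 x2) = span_fun lam l (phi (row3 x0 x1 x2 *m Q))) ->
  (forall v0 v1 v2 v3 v4 v5 k, (k < n.+1)%N ->
     let M := minors_span lam l v0 v1 v2 v3 v4 v5 in
     (minors_coord lam l (M 0 0) (M 0 1) (M 0 2) (M 1 0) (M 1 1) (M 1 2) (M 2 0) (M 2 1) (M 2 2))`_k =
     [:: v0; v1; v2; v3; v4; v5]`_k) ->
  (n < 6)%N ->
  equiv_up_to_swap T (normal_form lam l) -> linearly_isomorphic X (collineation_variety T).
Proof.
move=> pX uQ hspan hcoord n6 /minors_equiv[P [L [L' [uP LL hT]]]].
pose f : {linear 'rV[K]_n.+1 -> 'rV[K]_(3 * 3)} :=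
  HB.pack (fun v : 'rV[K]_n.+1 => mxvec (span_fun lam l v))
    (GRing.isLinear.Build _ _ _ _ _ (@span_fun_linear n lam l)).
have /row_freeP[B AB] : row_free (lin1_mx f).
  rewrite -kermx_eq0; apply/eqP/row_matrixP => i; rewrite row0.
  set v := row i _; have : v *m lin1_mx f = 0 by rewrite -row_mul mulmx_ker row0.
  rewrite mul_rV_lin1 => /(congr1 vec_mx); rewrite linear0 mxvecK => e.
  have e0 : span_fun lam l (0 : 'rV[K]_n.+1) = 0.
    by apply: (can_inj mxvecK); rewrite linear0; exact: (linear0 f).
  apply: row_inordP => k kn; rewrite [RHS]mxE.
  have vk (w : 'rV[K]_n.+1) : [:: w 0 (inord 0); w 0 (inord 1); w 0 (inord 2); w 0 (inord 3); w 0 (inord 4);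
      w 0 (inord 5)]`_k = w 0 (inord k) :> K.
    by have := leq_trans kn n6; case: (k) => [|[|[|[|[|[|]]]]]].
  by rewrite -(vk v) -(hcoord _ _ _ _ _ _ k kn) -/(span_fun lam l v) e -e0 /span_fun hcoord // vk mxE.
apply: (linearly_isomorphic_param (Q := P *m Q) (A := lin1_mx f *m L) (B := L' *m B) pX).
- by rewrite unitmx_mul uP.
- by rewrite mulmxA -(mulmxA _ L) LL mulmx1.
move=> x; rewrite hT mulmxA; congr (_ *m L).
by rewrite minorsE contr1_nf hspan -row3E mulmxA mul_rV_lin1.
Qed.

(** The minors of the five forms whose variety is a plane: the standard quadratic transformation,
    two degenerations of it, and the identity multiplied by x0. *)
Definition cremona_map (x : 'rV[K]_3) := row3 (x 0 1 * x 0 2) (x 0 0 * x 0 2) (x 0 0 * x 0 1).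
Definition degenerate_cremona_map (x : 'rV[K]_3) :=
  row3 (x 0 0 ^+ 2) (x 0 0 * x 0 1) (x 0 1 * x 0 2).
Definition osculating_cremona_map (x : 'rV[K]_3) :=
  row3 (x 0 0 ^+ 2) (x 0 0 * x 0 1) (x 0 0 * x 0 2 - x 0 1 ^+ 2).
Definition line_times_map (x : 'rV[K]_3) :=
  row3 (x 0 0 ^+ 2) (x 0 0 * x 0 1) (x 0 0 * x 0 2).

Lemma cremona_param : parametrized (@plane K) cremona_map.
Proof.
apply: (@plane_param K _ cremona_map 1 1 1) => z.
by apply/rowP; elim/ord3P; rewrite !mxE /=; ring.
Qed.

Lemma degenerate_cremona_param : parametrized (@plane K) degenerate_cremona_map.
Proof.
apply: (@plane_param K _ (fun z => row3 (z 0 0 * z 0 1) (z 0 1 ^+ 2) (z 0 0 * z 0 2)) 1 2 0) => z.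
by apply/rowP; elim/ord3P; rewrite !mxE /=; ring.
Qed.

Lemma osculating_cremona_param : parametrized (@plane K) osculating_cremona_map.
Proof.
apply: (@plane_param K _ (fun z => row3 (z 0 0 ^+ 2) (z 0 0 * z 0 1) (z 0 0 * z 0 2 + z 0 1 ^+ 2)) 3 0 0) => z.
by apply/rowP; elim/ord3P; rewrite !mxE /=; ring.
Qed.

Lemma line_times_param : parametrized (@plane K) line_times_map.
Proof.
apply: (@plane_param K _ id 1 0 0) => z.
by apply/rowP; elim/ord3P; rewrite !mxE /=; ring.
Qed.

Ltac span_check :=
  move=> x0 x1 x2; rewrite /nf_mx compound_mx3 /span_fun ?mulmx1 ?mul_row3 /minors_span;
  rewrite !mxE ?inordK //=; congr mx3; first [ring | field; nonzero].
Ltac coord_check :=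
  move=> v0 v1 v2 v3 v4 v5; rewrite /minors_span /minors_coord !mxE /=;
  case=> [|[|[|[|[|[|//]]]]]] //= _; first [ring | field; nonzero].
Ltac table param Q :=
  apply: (recorded_param param (Q := Q));
  [first [exact: unitmx1 | unit3] | span_check | coord_check | done].

Theorem recorded lam l T : lam != 0 -> equiv_up_to_swap T (normal_form lam l) ->
  recorded_variety l (collineation_variety T).
Proof.
move=> lam0; case: l; rewrite /recorded_variety.
- by table (veronese_param K) (1%:M : 'M[K]_3).
- by table (veronese_param K) (1%:M : 'M[K]_3).
- by table (veronese_param K) (1%:M : 'M[K]_3).
- by table (scroll_param K) (pmx 2 1 0 : 'M[K]_3).
- by table (veronese_param K) (1%:M : 'M[K]_3).
- by table (veronese_param K) (1%:M : 'M[K]_3).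
- by table (scroll_param K) (pmx 2 1 0 : 'M[K]_3).
- by table (veronese_param K) (1%:M : 'M[K]_3).
- by table (scroll_param K) (1%:M : 'M[K]_3).
- by table (segre_param K) (1%:M : 'M[K]_3).
- by table (scroll_param K) (1%:M : 'M[K]_3).
- by table (scroll_param K) (1%:M : 'M[K]_3).
- by table (scroll_param K) (pmx 2 1 0 : 'M[K]_3).
- by table (scroll_param K) (1%:M : 'M[K]_3).
- by table (segre_param K) (1%:M : 'M[K]_3).
- by table cremona_param (1%:M : 'M[K]_3).
- by table (veronese_param K) (1%:M : 'M[K]_3).
- by table (veronese_param K) (1%:M : 'M[K]_3).
- by table (veronese_param K) (1%:M : 'M[K]_3).
- by table (veronese_param K) (1%:M : 'M[K]_3).
- by table (veronese_param K) (1%:M : 'M[K]_3).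
- by table (veronese_param K) (1%:M : 'M[K]_3).
- by table (scroll_param K) (pmx 2 1 0 : 'M[K]_3).
- by table (veronese_param K) (1%:M : 'M[K]_3).
- by table (scroll_param K) (pmx 2 1 0 : 'M[K]_3).
- by table (veronese_param K) (1%:M : 'M[K]_3).
- by table (scroll_param K) (pmx 2 1 0 : 'M[K]_3).
(* The minor x2^2 - x1^2 is a product; its factors x2 - x1 and x2 + x1 are the new coordinates. *)
- apply: (recorded_param (segre_param K) (Q := mx3 1 0 0  0 (-1) 1  0 1 1));
    [|span_check|coord_check|done].
  by apply: mx3_unit; rewrite [X in X != 0](_ : _ = - 2); [nonzero | ring].
- by table (scroll_param K) (pmx 2 1 0 : 'M[K]_3).
- by table (cone_param K) (1%:M : 'M[K]_3).
- by table (segre_param K) (1%:M : 'M[K]_3).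
- by table (cone_param K) (1%:M : 'M[K]_3).
- by table (scroll_param K) (pmx 2 1 0 : 'M[K]_3).
- by table (cone_param K) (1%:M : 'M[K]_3).
- by table (segre_param K) (1%:M : 'M[K]_3).
- by table (cone_param K) (1%:M : 'M[K]_3).
- by table degenerate_cremona_param (1%:M : 'M[K]_3).
- by table osculating_cremona_param (1%:M : 'M[K]_3).
- by table (segre_param K) (1%:M : 'M[K]_3).
- by table line_times_param (1%:M : 'M[K]_3).
- by table line_times_param (1%:M : 'M[K]_3).
- by table (conic_param K) (1%:M : 'M[K]_3).
Qed.

End RecordedVarieties.

(** * One-parameter subgroups *)

Section Unstable.
Variable K : numClosedFieldType.
Implicit Types (T S : tensor K) (A B C : 'M[K]_3).

Lemma gact_comp A B C A' B' C' T :
  gact A B C (gact A' B' C' T) = gact (A *m A') (B *m B') (C *m C') T.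
Proof. by apply: contr1_inj => x; rewrite !contr1_gact trmx_mul !mulmxA. Qed.

Lemma gact1 T : gact 1%:M 1%:M 1%:M T = T.
Proof. by apply: contr1_inj => x; rewrite contr1_gact trmx1 !mulmx1 mul1mx. Qed.

Lemma gact_swap A B C T : gact A B C (swap23 T) = swap23 (gact A C B T).
Proof.
apply: contr1_inj => x; rewrite contr1_swap23 !contr1_gact contr1_swap23.
by rewrite !trmx_mul trmxK mulmxA.
Qed.

Lemma swap23K T : swap23 (swap23 T) = T.
Proof. by apply/ffunP => -[[i j] k]; rewrite !ffunE. Qed.

Lemma equiv_gact T S : equiv_up_to_swap T S -> exists A B C,
  [/\ A \in unitmx, B \in unitmx, C \in unitmx & T = gact A B C S \/ T = gact A B C (swap23 S)].
Proof.
have inv A B C T' S' : A \in unitmx -> B \in unitmx -> C \in unitmx -> S' = gact A B C T' ->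
    T' = gact (invmx A) (invmx B) (invmx C) S'.
  by move=> uA uB uC ->; rewrite gact_comp !mulVmx // gact1.
move=> [A [B [C [uA uB uC [e|e]]]]].
  by exists (invmx A), (invmx B), (invmx C); rewrite !unitmx_inv; split=> //; left; apply: inv.
exists (invmx A), (invmx C), (invmx B); rewrite !unitmx_inv; split=> //; right.
rewrite gact_swap; apply: (can_inj swap23K); rewrite swap23K.
exact: inv.
Qed.

(* The limit of T under a one-parameter subgroup of the product of the SL_3. *)
Definition degenerates T S := exists a b c : 'I_3 -> int,
  [/\ \sum_i a i = 0, \sum_i b i = 0, \sum_i c i = 0 &
    forall i j k, S (i, j, k) = (a i + b j + c k == 0)%:R * T (i, j, k) /\
      (T (i, j, k) != 0 -> 0 <= a i + b j + c k)].

Lemma degenerates_swap T S : degenerates T S -> degenerates (swap23 T) (swap23 S).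
Proof.
move=> [a [b [c [sa sb sc h]]]]; exists a, c, b; split=> // i j k.
by rewrite !ffunE /= addrAC; apply: h.
Qed.

Definition psg (a : 'I_3 -> int) (t : K) : 'M[K]_3 := diag_mx (\row_i t ^ a i).

Lemma det_psg a t : t != 0 -> \sum_i a i = 0 -> \det (psg a t) = 1.
Proof.
move=> t0 sa; rewrite det_diag; under eq_bigr => i _ do rewrite mxE.
by rewrite -(big_morph (fun z => t ^ z) (fun m n => expfzDr m n t0) (expr0z t)) sa.
Qed.

Lemma gact_psg a b c t T (i j k : 'I_3) : t != 0 ->
  gact (psg a t) (psg b t) (psg c t) T (i, j, k) = t ^ (a i + b j + c k) * T (i, j, k).
Proof.
move=> t0; have diag d (F : 'I_3 -> K) i0 : \sum_i1 psg d t i0 i1 * F i1 = t ^ d i0 * F i0.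
  rewrite (bigD1 i0) //= big1 ?addr0 => [|i1 ne]; first by rewrite !mxE eqxx mulr1n.
  by rewrite !mxE eq_sym (negPf ne) mulr0n mul0r.
rewrite ffunE /= !expfzDr // -!mulrA -(diag a (fun i1 => t ^ b j * (t ^ c k * T (i1, j, k)))).
apply: eq_bigr => i1 _; rewrite -(diag b (fun j1 => t ^ c k * T (i1, j1, k))) mulr_sumr.
apply: eq_bigr => j1 _; rewrite -(diag c (fun k1 => T (i1, j1, k1))) !mulr_sumr.
by apply: eq_bigr => k1 _; rewrite !mulrA.
Qed.

Lemma curve_poly n (p : {mpoly K[n]}) (g : 'I_n -> {poly K}) :
  exists P : {poly K}, forall t, P.[t] = p.@[fun i => (g i).[t]].
Proof.
exists (\sum_(m <- msupp p) (p@_m)%:P * \prod_i g i ^+ m i) => t.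
rewrite mevalE horner_sum; apply: eq_bigr => m' _.
rewrite hornerM hornerC horner_prod; congr (_ * _).
by apply: eq_bigr => i _; rewrite horner_exp.
Qed.

Lemma poly_const (P : {poly K}) c : (forall t, t != 0 -> P.[t] = c) -> P.[0] = c.
Proof.
move=> h; have : 'X * (P - c%:P) = 0.
  apply: poly_eq0_everywhere => t; rewrite hornerM hornerX hornerD hornerN hornerC.
  by have [->|/h ->] := eqVneq t 0; rewrite ?mul0r // subrr mulr0.
by move/eqP; rewrite mulf_eq0 polyX_eq0 subr_eq0 => /eqP ->; rewrite hornerC.
Qed.

(** An invariant is constant along the orbit of the one-parameter subgroup, and it is a polynomial
    in t there because only nonnegative weights occur; so the constant is its value at t = 0. *)
Lemma invariant_degeneration p A B C T S : A \in unitmx -> B \in unitmx -> C \in unitmx ->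
  SL_invariant p -> degenerates T S -> teval p (gact A B C T) = teval p (gact A B C S).
Proof.
move=> uA uB uC inv [a [b [c [sa sb sc lim]]]].
(* The absolute value differs from the weight only where T vanishes. *)
pose w i j k := absz (a i + b j + c k).
pose g (n : 'I_#|{: 'I_3 * 'I_3 * 'I_3}|) : {poly K} := let: (i0, j0, k0) := enum_val n in
  \sum_i \sum_j \sum_k (A i0 i * B j0 j * C k0 k * T (i, j, k))%:P * 'X^(w i j k).
have [P hP] := curve_poly p g.
have gE t n : t != 0 -> (g n).[t] = gact A B C (gact (psg a t) (psg b t) (psg c t) T) (enum_val n).
  move=> t0; rewrite /g; case: (enum_val n) => [[i0 j0] k0]; rewrite ffunE /= horner_sum.
  apply: eq_bigr => i _; rewrite horner_sum; apply: eq_bigr => j _; rewrite horner_sum.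
  apply: eq_bigr => k _; rewrite hornerM hornerC hornerXn gact_psg //.
  have [->|Tn] := eqVneq (T (i, j, k)) 0; first by rewrite !mulr0 mul0r.
  rewrite /w [in RHS](_ : a i + b j + c k = w i j k :> int); last first.
    by rewrite /w gez0_abs //; case: (lim i j k) => _; apply.
  by rewrite -exprnP; ring.
have Pt t : t != 0 -> P.[t] = teval p (gact A B C T).
  move=> t0; rewrite hP (meval_eq _ (fun n => gE t n t0)) -/(teval p _).
  (* The subgroup is conjugated by A, B, C: determinants stay 1, although A, B, C are merely
     invertible. *)
  have cj D X : X \in unitmx -> \det (X *m D *m invmx X) = \det D :> K.
    by move=> uX; rewrite !det_mulmx det_inv mulrAC mulfV ?mul1r // -unitfE -unitmxE.
  rewrite -[RHS](inv (A *m psg a t *m invmx A) (B *m psg b t *m invmx B) (C *m psg c t *m invmx C)).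
  - by rewrite !gact_comp !mulmxKV.
  - by rewrite cj // det_psg.
  - by rewrite cj // det_psg.
  - by rewrite cj // det_psg.
rewrite -(poly_const Pt) hP; apply: meval_eq => n.
rewrite /g; case: (enum_val n) => [[i0 j0] k0]; rewrite ffunE /= horner_sum.
apply: eq_bigr => i _; rewrite horner_sum; apply: eq_bigr => j _; rewrite horner_sum.
apply: eq_bigr => k _; rewrite hornerM hornerC hornerXn expr0n /w absz_eq0.
by case: (lim i j k) => -> _; rewrite [in RHS]mulrC !mulrA [in RHS]mulrC -!mulrA; ring.
Qed.

(** Every triple has sum zero. The weights vanish on u, w in family III, on u in IV, on v in V, and
    are positive on the remaining terms; for unstable labels they are positive on all terms. *)
Definition weights (l : label) : seq int * seq int * seq int :=
  match l with
  | III_1 => ([:: 1; 1; (- 2)], [:: 1; (- 2); 1], [:: (- 2); 1; 1])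
  | III_2 => ([:: 1; (- 1); 0], [:: (- 1); 0; 1], [:: 0; 1; (- 1)])
  | III_ps => ([:: 0; 0; 0], [:: 0; 0; 0], [:: 0; 0; 0])
  | IV_1_i => ([:: 1; 1; (- 2)], [:: (- 1); 0; 1], [:: 0; (- 1); 1])
  | IV_1_ii => ([:: (- 1); 0; 1], [:: 1; 1; (- 2)], [:: 0; (- 1); 1])
  | IV_1_iii => ([:: (- 1); 0; 1], [:: 0; (- 1); 1], [:: 1; 1; (- 2)])
  | IV_2_i => ([:: 1; (- 1); 0], [:: 1; 0; (- 1)], [:: (- 2); 1; 1])
  | IV_2_iii => ([:: 0; 0; 0], [:: 1; 0; (- 1)], [:: (- 1); 0; 1])
  | IV_2_vi => ([:: (- 1); 0; 1], [:: 0; 0; 0], [:: 1; 0; (- 1)])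
  | IV_4_i => ([:: 1; (- 1); 0], [:: 0; 0; 0], [:: (- 1); 1; 0])
  | IV_4_ii => ([:: 0; 0; 0], [:: 1; (- 1); 0], [:: (- 1); 1; 0])
  | IV_4_iii => ([:: 0; 0; 0], [:: (- 1); 0; 1], [:: 1; 0; (- 1)])
  | IV_5_i => ([:: 0; 0; 0], [:: (- 1); 1; 0], [:: 1; (- 1); 0])
  | IV_5_ii => ([:: 0; 0; 0], [:: 0; 1; (- 1)], [:: 0; (- 1); 1])
  | IV_7_i => ([:: 0; 0; 0], [:: (- 1); 1; 0], [:: 1; (- 1); 0])
  | IV_ps => ([:: 0; 0; 0], [:: 0; 0; 0], [:: 0; 0; 0])
  | V_1 => ([:: 1; 2; (- 3)], [:: 1; 2; (- 3)], [:: 1; 2; (- 3)])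
  | V_2 => ([:: 0; 1; (- 1)], [:: 0; 1; (- 1)], [:: 0; 1; (- 1)])
  | V_3 => ([:: 1; 1; (- 2)], [:: 1; 1; (- 2)], [:: 1; 1; (- 2)])
  | V_4 => ([:: 0; 1; (- 1)], [:: 0; 1; (- 1)], [:: 0; 1; (- 1)])
  | V_5 => ([:: 1; (- 1); 0], [:: 1; (- 1); 0], [:: 1; (- 1); 0])
  | V_ps => ([:: 0; 0; 0], [:: 0; 0; 0], [:: 0; 0; 0])
  | I_1_i => ([:: 4; 1; (- 5)], [:: 3; 0; (- 3)], [:: 3; 0; (- 3)])
  | I_1_ii => ([:: 3; 0; (- 3)], [:: 4; 1; (- 5)], [:: 3; 0; (- 3)])
  | I_2_i => ([:: 3; 0; (- 3)], [:: 3; 0; (- 3)], [:: 1; 1; (- 2)])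
  | I_2_iii => ([:: 1; 1; (- 2)], [:: 3; 0; (- 3)], [:: 3; 0; (- 3)])
  | I_3_i => ([:: 1; 1; (- 2)], [:: 1; 1; (- 2)], [:: 2; (- 1); (- 1)])
  | I_3_iii => ([:: 2; (- 1); (- 1)], [:: 1; 1; (- 2)], [:: 1; 1; (- 2)])
  | I_4_i => ([:: 2; (- 1); (- 1)], [:: 2; (- 1); (- 1)], [:: 3; 0; (- 3)])
  | I_4_iii => ([:: 3; 0; (- 3)], [:: 1; (- 2); 1], [:: 3; 0; (- 3)])
  | I_5_i => ([:: 1; 1; (- 2)], [:: 2; (- 1); (- 1)], [:: 1; 1; (- 2)])
  | I_5_iii => ([:: 1; 1; (- 2)], [:: 1; 1; (- 2)], [:: 2; (- 1); (- 1)])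
  | I_6_i => ([:: 1; 1; (- 2)], [:: 1; 1; (- 2)], [:: 2; (- 1); (- 1)])
  | I_6_iii => ([:: 2; (- 1); (- 1)], [:: 1; 1; (- 2)], [:: 1; 1; (- 2)])
  | I_7_i => ([:: 1; (- 1); 0], [:: 2; 0; (- 2)], [:: 2; 0; (- 2)])
  | I_7_ii => ([:: 1; 1; (- 2)], [:: 1; 1; (- 2)], [:: 2; (- 1); (- 1)])
  | I_8 => ([:: 1; 1; (- 2)], [:: 1; 1; (- 2)], [:: 2; (- 1); (- 1)])
  | I_10 => ([:: 1; 0; (- 1)], [:: 1; 0; (- 1)], [:: 1; 0; (- 1)])
  | I_11_i => ([:: 0; 0; 0], [:: 2; (- 1); (- 1)], [:: 2; (- 1); (- 1)])
  | I_11_ii => ([:: 1; 1; (- 2)], [:: 1; 1; (- 2)], [:: 2; (- 1); (- 1)])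
  | I_14_i => ([:: 1; (- 1); 0], [:: 1; (- 1); 0], [:: 1; 0; (- 1)])
  | I_14_iii => ([:: 0; 1; (- 1)], [:: 1; 0; (- 1)], [:: 1; 0; (- 1)])
  end.

(** The tensor u is encoded as the member lam = 0 of III.ps, so that one evaluation of the sextic
    serves families III and IV. *)
Definition limit (lam : K) (l : label) : tensor K :=
  match l with
  | III_1 | III_2 | III_ps => normal_form lam III_ps
  | V_1 | V_2 | V_3 | V_4 | V_5 | V_ps => normal_form lam V_ps
  | _ => if semistable_label l then normal_form 0 III_ps else 0
  end.

(* [wlim w T S]: the one-parameter subgroup of weights [w] has the limit S on T. *)
Definition wt (w : seq int * seq int * seq int) (i j k : nat) : int := w.1.1`_i + w.1.2`_j + w.2`_k.

Definition wlim w T S := forall i j k : 'I_3, S (i, j, k) = (wt w i j k == 0)%:R * T (i, j, k) /\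
  (T (i, j, k) != 0 -> 0 <= wt w i j k).

Lemma wlim_add w T S T' S' : wlim w T S -> wlim w T' S' -> wlim w (T + T') (S + S').
Proof.
move=> h h' i j k; have [e p] := h i j k; have [e' p'] := h' i j k.
rewrite !ffunE e e' mulrDr; split=> // n; have [z|] := eqVneq (T (i, j, k)) 0; last exact: p.
by apply: p'; move: n; rewrite z add0r.
Qed.

Lemma wlim_opp w T S : wlim w T S -> wlim w (- T) (- S).
Proof.
move=> h i j k; have [e p] := h i j k; rewrite !ffunE e mulrN; split=> // n.
by apply: p; rewrite -oppr_eq0.
Qed.

Lemma wlim_scale w c T S : wlim w T S -> wlim w (tscale c T) (tscale c S).
Proof.
move=> h i j k; have [e p] := h i j k; rewrite !ffunE e mulrCA; split=> // n.
by apply: p; apply: contraNneq n => ->; rewrite mulr0.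
Qed.

Lemma wlim_keep w i j k : wt w i j k = 0 -> wlim w (abc i j k) (abc i j k).
Proof.
move=> e i' j' k'; rewrite !ffunE /=.
case: (boolP [&& _, _ & _]) => [/and3P[/eqP -> /eqP -> /eqP ->]|_].
  by rewrite e eqxx mulr1.
by rewrite mulr0 eqxx.
Qed.

Lemma wlim_kill w i j k : 0 < wt w i j k -> wlim w (abc i j k) 0.
Proof.
move=> e i' j' k'; rewrite !ffunE /=.
case: (boolP [&& _, _ & _]) => [/and3P[/eqP -> /eqP -> /eqP ->]|_].
  by rewrite gt_eqF // mul0r ltW.
by rewrite mulr0 eqxx.
Qed.

Lemma wlim_drop w T S i j k : wlim w T S -> 0 < wt w i j k -> wlim w (T + abc i j k) S.
Proof. by move=> h p; rewrite -[S]addr0; apply: wlim_add => //; apply: wlim_kill. Qed.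

Lemma nf_degenerates lam l : degenerates (normal_form lam l) (limit lam l).
Proof.
suff h : wlim (weights l) (normal_form lam l) (limit lam l).
  exists (fun i => (weights l).1.1`_i), (fun i => (weights l).1.2`_i), (fun i => (weights l).2`_i).
  by split; [case: l {h} | case: l {h} | case: l {h} | exact: h]; rewrite big_ord3.
have u0 w : wt w 0 0 0 = 0 -> wt w 1 1 1 = 0 -> wt w 2 2 2 = 0 -> wlim w (tensor_u K) (tensor_u K).
  by move=> *; apply: wlim_add; [apply: wlim_add|]; apply: wlim_keep.
have w0 w : wt w 0 1 2 = 0 -> wt w 2 0 1 = 0 -> wt w 1 2 0 = 0 -> wlim w (tensor_w K) (tensor_w K).
  by move=> *; apply: wlim_add; [apply: wlim_add|]; apply: wlim_keep.
have v0 w : wt w 0 1 2 = 0 -> wt w 1 2 0 = 0 -> wt w 2 0 1 = 0 -> wt w 0 2 1 = 0 -> wt w 1 0 2 = 0 ->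
    wt w 2 1 0 = 0 -> wlim w (tensor_v K) (tensor_v K).
  by move=> *; apply: wlim_add; [|apply: wlim_opp]; (apply: wlim_add; [apply: wlim_add|]); apply: wlim_keep.
have u_w : tensor_u K + tscale 0 (tensor_w K) = tensor_u K.
  by apply/ffunP => t; rewrite !ffunE mul0r addr0.
by case: l; rewrite /limit /normal_form /= ?u_w; do ?[apply: wlim_drop; last by []];
  first [exact: wlim_kill | exact: u0 | exact: v0 |
    by apply: wlim_add; [apply: u0 | apply: wlim_scale; apply: w0]].
Qed.

(** The easy half of the Hilbert-Mumford criterion: the limit is 0, where homogeneous invariants of
    positive degree vanish. *)
Theorem unstable_labels lam l T : ~~ semistable_label l ->
  equiv_up_to_swap T (normal_form lam l) -> unstable T.
Proof.
move=> ul eT [d [p [d0 hp inv]]]; apply/negP; rewrite negbK.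
have p0 : teval p 0 = 0.
  rewrite /teval (meval_eq (v2 := fun _ => 0 * 0)) => [|n]; last by rewrite ffunE mulr0.
  by rewrite (meval_homogZ 0 (fun=> 0) hp) expr0n gtn_eqF // mul0r.
have lim : degenerates (normal_form lam l) 0.
  by have := nf_degenerates lam l; case: l ul {eT}.
have g0 A B C : gact A B C (0 : tensor K) = 0.
  apply/ffunP => -[[i j] k]; rewrite !ffunE /=.
  by do 3![apply: big1 => ? _]; rewrite ffunE mulr0.
have s0 : swap23 (0 : tensor K) = 0 by apply/ffunP => -[[i j] k]; rewrite !ffunE.
have [A [B [C [uA uB uC [] ->]]]] := equiv_gact eT.
  by rewrite (invariant_degeneration uA uB uC inv lim) g0 p0.
by rewrite (invariant_degeneration uA uB uC inv (degenerates_swap lim)) s0 g0 p0.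
Qed.
End Unstable.

(** * Invariants *)

Section SexticInvariant.

Section Ring.
Variable R : comNzRingType.
Implicit Types P Q M N : 'M[R]_3.

(* The polarization of the cofactor matrix (indices modulo 3). *)
Definition polar P Q : 'M[R]_3 := \matrix_(j, k)
  (P (j + 1) (k + 1) * Q (j + 2) (k + 2) + Q (j + 1) (k + 1) * P (j + 2) (k + 2)
   - P (j + 1) (k + 2) * Q (j + 2) (k + 1) - Q (j + 1) (k + 2) * P (j + 2) (k + 1)).

(** Antisymmetrization over the three slices: by [alt3_linear], a change of slices by A multiplies
    the result by det A when H is trilinear. *)
Definition alt3 (H : 'M[R]_3 -> 'M[R]_3 -> 'M[R]_3 -> R) P Q M : R :=
  H P Q M - H P M Q - H Q P M + H Q M P + H M P Q - H M Q P.

(** Matrices alternate with polarized cofactor matrices, so that under P |-> B P C^T the adjacent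
    factors B^T and cofactor of B, and likewise for C, collapse to determinants. *)
Definition chain P Q M P' Q' M' : R :=
  \tr (P^T *m polar Q Q' *m (P'^T *m polar M M')).

(* The invariant of degree 6 of the tensor with slices P, Q, M. *)
Definition sextic P Q M : R :=
  alt3 (fun P1 Q1 M1 => alt3 (fun P2 Q2 M2 => chain P1 Q1 M1 P2 Q2 M2) P Q M) P Q M.

End Ring.

Section Field.
Variable K : fieldType.
Implicit Types P Q M N B C : 'M[K]_3.

Lemma polar_mx3 (a b c d e f g h i a' b' c' d' e' f' g' h' i' : K) :
  polar (mx3 a b c d e f g h i) (mx3 a' b' c' d' e' f' g' h' i') =
  mx3 (e * i' + e' * i - f * h' - f' * h) (f * g' + f' * g - d * i' - d' * i) (d * h' + d' * h - e * g' - e' * g)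
      (h * c' + h' * c - i * b' - i' * b) (i * a' + i' * a - g * c' - g' * c) (g * b' + g' * b - h * a' - h' * a)
      (b * f' + b' * f - c * e' - c' * e) (c * d' + c' * d - a * f' - a' * f) (a * e' + a' * e - b * d' - b' * d).
Proof. by apply/matrixP; do 2!elim/ord3P; rewrite !mxE. Qed.

Definition cofactor_mx B : 'M[K]_3 := \matrix_(j, k)
  (B (j + 1) (k + 1) * B (j + 2) (k + 2) - B (j + 1) (k + 2) * B (j + 2) (k + 1)).

Lemma cofactor_mx3 (a b c d e f g h i : K) : cofactor_mx (mx3 a b c d e f g h i) =
  mx3 (e * i - f * h) (f * g - d * i) (d * h - e * g)
      (h * c - i * b) (i * a - g * c) (g * b - h * a)
      (b * f - c * e) (c * d - a * f) (a * e - b * d).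
Proof. by apply/matrixP; do 2!elim/ord3P; rewrite !mxE. Qed.

Lemma polar_mull B P Q : polar (B *m P) (B *m Q) = cofactor_mx B *m polar P Q.
Proof.
rewrite (mx3E B) (mx3E P) (mx3E Q) !mul_mx3 !polar_mx3 cofactor_mx3 mul_mx3.
by congr mx3; ring.
Qed.

Lemma polar_tr P Q : polar P^T Q^T = (polar P Q)^T.
Proof. by rewrite (mx3E P) (mx3E Q) !tr_mx3 !polar_mx3 tr_mx3; congr mx3; ring. Qed.

Lemma tr_cofactor B : B^T *m cofactor_mx B = (\det B)%:M.
Proof.
rewrite (mx3E B) tr_mx3 cofactor_mx3 mul_mx3 det_mx3 [RHS]mx3E !mxE /=.
by congr mx3; ring.
Qed.

Lemma polar_mul B C P Q : polar (B *m P *m C^T) (B *m Q *m C^T) =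
  cofactor_mx B *m polar P Q *m (cofactor_mx C)^T.
Proof.
have r X Y : polar (X *m C^T) (Y *m C^T) = polar X Y *m (cofactor_mx C)^T.
  by apply: trmx_inj; rewrite -polar_tr !trmx_mul !trmxK polar_mull polar_tr.
by rewrite r polar_mull.
Qed.

Lemma chain_mul B C P Q M P' Q' M' : let f X := B *m X *m C^T in
  chain (f P) (f Q) (f M) (f P') (f Q') (f M') = (\det B * \det C) ^+ 2 * chain P Q M P' Q' M'.
Proof.
have key X Y Z : (B *m X *m C^T)^T *m polar (B *m Y *m C^T) (B *m Z *m C^T) =
    \det B *: (C *m (X^T *m polar Y Z) *m (cofactor_mx C)^T).
  rewrite polar_mul !trmx_mul trmxK -!mulmxA (mulmxA B^T) tr_cofactor.
  by rewrite mul_scalar_mx -!scalemxAr.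
have cC : (cofactor_mx C)^T *m C = (\det C)%:M.
  by apply: trmx_inj; rewrite trmx_mul trmxK tr_cofactor tr_scalar_mx.
have cyc X Y : \tr (C *m X *m (cofactor_mx C)^T *m (C *m Y *m (cofactor_mx C)^T)) =
    \det C ^+ 2 * \tr (X *m Y).
  rewrite !mulmxA -(mulmxA _ _ C) cC mul_mx_scalar -!scalemxAl mxtraceZ.
  by rewrite mxtrace_mulC !mulmxA cC mul_scalar_mx -scalemxAl mxtraceZ mulrA.
rewrite /chain !key -scalemxAl -scalemxAr !mxtraceZ cyc; ring.
Qed.

Definition trilinear (H : 'M[K]_3 -> 'M[K]_3 -> 'M[K]_3 -> K) := forall a b c P Q M X Y,
  [/\ H (a *: P + b *: Q + c *: M) X Y = a * H P X Y + b * H Q X Y + c * H M X Y,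
      H X (a *: P + b *: Q + c *: M) Y = a * H X P Y + b * H X Q Y + c * H X M Y &
      H X Y (a *: P + b *: Q + c *: M) = a * H X Y P + b * H X Y Q + c * H X Y M].

Definition combine (A : 'M[K]_3) P Q M i := A i 0 *: P + A i 1 *: Q + A i 2 *: M.

Lemma alt3_linear H A P Q M : trilinear H -> let f := combine A P Q M in
  alt3 H (f 0) (f 1) (f 2) = \det A * alt3 H P Q M.
Proof.
move=> lin f; have e1 i X Y : H (f i) X Y = A i 0 * H P X Y + A i 1 * H Q X Y + A i 2 * H M X Y.
  by case: (lin (A i 0) (A i 1) (A i 2) P Q M X Y).
have e2 i X Y : H X (f i) Y = A i 0 * H X P Y + A i 1 * H X Q Y + A i 2 * H X M Y.
  by case: (lin (A i 0) (A i 1) (A i 2) P Q M X Y).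
have e3 i X Y : H X Y (f i) = A i 0 * H X Y P + A i 1 * H X Y Q + A i 2 * H X Y M.
  by case: (lin (A i 0) (A i 1) (A i 2) P Q M X Y).
by rewrite /alt3 !e1 !e2 !e3 det3; ring.
Qed.

Lemma polar_linl a b c P Q M X : polar (a *: P + b *: Q + c *: M) X =
  a *: polar P X + b *: polar Q X + c *: polar M X.
Proof. by apply/matrixP => j k; rewrite !mxE; ring. Qed.

Lemma polar_linr a b c P Q M X : polar X (a *: P + b *: Q + c *: M) =
  a *: polar X P + b *: polar X Q + c *: polar X M.
Proof. by apply/matrixP => j k; rewrite !mxE; ring. Qed.

Lemma trmx_lin a b c P Q M : (a *: P + b *: Q + c *: M)^T = a *: P^T + b *: Q^T + c *: M^T.
Proof. by rewrite !linearD !linearZ. Qed.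

Lemma chain_trilinearl P' Q' M' : trilinear (fun P Q M => chain P Q M P' Q' M').
Proof.
move=> a b c P Q M X Y; rewrite /chain.
by split; rewrite ?polar_linl ?trmx_lin !(mulmxDl, mulmxDr) -!(scalemxAl, scalemxAr)
  !mxtraceD !mxtraceZ.
Qed.

Lemma chain_trilinearr P Q M : trilinear (chain P Q M).
Proof.
move=> a b c P' Q' M' X Y; rewrite /chain.
by split; rewrite ?polar_linr ?trmx_lin !(mulmxDl, mulmxDr) -!(scalemxAl, scalemxAr)
  !mxtraceD !mxtraceZ.
Qed.

Lemma alt3_map (f : 'M[K]_3 -> 'M[K]_3) c H H' P Q M :
  (forall X Y Z, H (f X) (f Y) (f Z) = c * H' X Y Z) -> alt3 H (f P) (f Q) (f M) = c * alt3 H' P Q M.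
Proof. by move=> h; rewrite /alt3 !h -!(mulrDr, mulrBr). Qed.

Lemma sextic_act A B C P Q M : let f i := B *m combine A P Q M i *m C^T in
  sextic (f 0) (f 1) (f 2) = (\det A * \det B * \det C) ^+ 2 * sextic P Q M.
Proof.
have /= linA H lH := @alt3_linear H A P Q M lH.
set P' := combine _ _ _ _ 0; set Q' := combine _ _ _ _ 1; set M' := combine _ _ _ _ 2.
(* B and C pass through both alternations at once; A then contributes one factor det A for each
   alternation. *)
transitivity ((\det B * \det C) ^+ 2 * sextic P' Q' M').
  apply: (alt3_map (f := fun X => B *m X *m C^T)) => X Y Z.
  by apply: (alt3_map (f := fun X => B *m X *m C^T)) => X' Y' Z'; apply: chain_mul.
pose H P1 Q1 M1 := alt3 (chain P1 Q1 M1) P Q M.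
have lH : trilinear H.
  move=> a b c P1 Q1 M1 X Y; rewrite /H /alt3.
  have l1 U V W := let: And3 h _ _ := chain_trilinearl U V W a b c P1 Q1 M1 X Y in h.
  have l2 U V W := let: And3 _ h _ := chain_trilinearl U V W a b c P1 Q1 M1 X Y in h.
  have l3 U V W := let: And3 _ _ h := chain_trilinearl U V W a b c P1 Q1 M1 X Y in h.
  by move: l1 l2 l3 => /= l1 l2 l3; split; rewrite ?l1 ?l2 ?l3; ring.
have e : sextic P' Q' M' = \det A * alt3 H P' Q' M'.
  apply: (@alt3_map id _ (fun P1 Q1 M1 => alt3 (chain P1 Q1 M1) P' Q' M')) => X Y Z.
  by apply: linA; apply: chain_trilinearr.
by rewrite e (linA _ lH) -[alt3 H P Q M]/(sextic P Q M); ring.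
Qed.

End Field.
End SexticInvariant.

(** * Strassen's invariant of degree 9 *)

Section Strassen.

Definition skew_basis (R : comNzRingType) (i : 'I_3) : 'M[R]_3 :=
  delta_mx (i + 1) (i + 2) - delta_mx (i + 2) (i + 1).

(** The Koszul flattening of the tensor with slices P, Q, M, the skew-symmetric matrices being the
    exterior multiplication on V_1. Its determinant is Strassen's invariant. *)
Definition strassen_mx (R : comNzRingType) (P Q M : 'M[R]_3) : 'M[R]_(3 * 3) :=
  skew_basis R 0 *t P + skew_basis R 1 *t Q + skew_basis R 2 *t M.

Variable K : fieldType.
Implicit Types P Q M A B C : 'M[K]_3.

Lemma det_castmx (m n : nat) (e : m = n) (A : 'M[K]_m) : \det (castmx (e, e) A) = \det A.
Proof. by case: _ / e. Qed.

Lemma det_tens1mx m n (A : 'M[K]_n) : \det ((1%:M : 'M_m) *t A) = \det A ^+ m.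
Proof.
elim: m => [|m IH]; first by rewrite expr0 (_ : _ *t _ = 1%:M) ?det1 //; apply/matrixP; case.
have {1}-> : 1%:M = block_mx (1%:M : 'M[K]_1) 0 0 (1%:M : 'M_m) by rewrite -scalar_mx_block.
rewrite tens_block_mx (eq_irrelevance (esym (mulnDl 1 m n)) (esym (mulnDl 1 m n))) det_castmx.
rewrite !tens0mx det_ublock IH exprS; congr (_ * _).
by rewrite tens_scalar1mx det_castmx.
Qed.

(** Exchanging the tensor factors permutes rows and columns by the same permutation, and the two
    signs cancel. *)
Lemma det_tensC n (A B : 'M[K]_n) : \det (A *t B) = \det (B *t A).
Proof.
pose f (i : 'I_(n * n)) : 'I_(n * n) := let: (i1, i2) := mxtens_unindex i in mxtens_index (i2, i1).
have fK : involutive f.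
  by move=> i; rewrite /f; case: (mxtens_indexP i) => i1 i2; rewrite !mxtens_indexK.
pose s := perm (inv_inj fK).
have -> : A *t B = row_perm s (col_perm s (B *t A)).
  apply/matrixP => i j; case: (mxtens_indexP i) => i1 i2; case: (mxtens_indexP j) => j1 j2.
  by rewrite tensmxE !mxE !permE /f !mxtens_indexK /= mulrC.
rewrite row_permE col_permE !det_mulmx !det_perm odd_permV mulrCA mulrA -mulrA.
by rewrite -signr_addb addbb mulr1.
Qed.

Lemma tensmxZl m n p q a (X : 'M[K]_(m, n)) (Z : 'M[K]_(p, q)) : (a *: X) *t Z = a *: (X *t Z).
Proof. by apply/matrixP => i j; rewrite !mxE mulrA. Qed.

Lemma skew_basis0 : skew_basis K 0 = mx3 0 0 0 0 0 1 0 (- 1) 0.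
Proof. by apply/matrixP; do 2!elim/ord3P; rewrite !mxE /= ?subrr ?subr0 ?sub0r. Qed.

Lemma skew_basis1 : skew_basis K 1 = mx3 0 0 (- 1) 0 0 0 1 0 0.
Proof. by apply/matrixP; do 2!elim/ord3P; rewrite !mxE /= ?subrr ?subr0 ?sub0r. Qed.

Lemma skew_basis2 : skew_basis K 2 = mx3 0 1 0 (- 1) 0 0 0 0 0.
Proof. by apply/matrixP; do 2!elim/ord3P; rewrite !mxE /= ?subrr ?subr0 ?sub0r. Qed.

(** Up to sign, [skew_basis] is the matrix [v] of the cross product with a basis vector v, and this
    is A^T [A v] A = det A [v]. *)
Lemma skew_basis_act A (i : 'I_3) :
  A^T *m (A 0 i *: skew_basis K 0 + A 1 i *: skew_basis K 1 + A 2 i *: skew_basis K 2) *m A =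
  \det A *: skew_basis K i.
Proof.
rewrite (mx3E A) !skew_basis0 !skew_basis1 !skew_basis2 tr_mx3 det_mx3.
by elim/ord3P: i; rewrite !mxE /= ?(skew_basis0, skew_basis1, skew_basis2) !scale_mx3 !add_mx3 !mul_mx3;
  congr mx3; ring.
Qed.

Lemma det_strassen_act A B C P Q M : A \in unitmx -> let f i := B *m combine A P Q M i *m C^T in
  \det (strassen_mx (f 0) (f 1) (f 2)) = (\det A * \det B * \det C) ^+ 3 * \det (strassen_mx P Q M).
Proof.
rewrite unitmxE unitfE => uA; set g := combine A P Q M => /=.
have -> X Y Z : strassen_mx (B *m X *m C^T) (B *m Y *m C^T) (B *m Z *m C^T) =
    1%:M *t B *m strassen_mx X Y Z *m (1%:M *t C^T).
  by rewrite /strassen_mx !mulmxDr !mulmxDl !tensmx_mul !mul1mx !mulmx1.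
pose X i : 'M[K]_3 := A 0 i *: skew_basis K 0 + A 1 i *: skew_basis K 1 + A 2 i *: skew_basis K 2.
have eX : strassen_mx (g 0) (g 1) (g 2) = X 0 *t P + X 1 *t Q + X 2 *t M.
  rewrite /strassen_mx /g /combine /X.
  move: (skew_basis K 0) (skew_basis K 1) (skew_basis K 2) => E0 E1 E2.
  by apply/matrixP => i j; rewrite !mxE; ring.
have e : A^T *t 1%:M *m strassen_mx (g 0) (g 1) (g 2) *m (A *t 1%:M) = \det A *: strassen_mx P Q M.
  rewrite eX !mulmxDr !mulmxDl !tensmx_mul !mulmx1 !mul1mx !skew_basis_act !tensmxZl.
  by rewrite -!scalerDr.
move/(congr1 determinant): e; rewrite !det_mulmx detZ !det_tens1mx !(det_tensC _ 1%:M) !det_tens1mx !det_tr => e.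
(* The outer tensor factors contribute det A ^ 6 and the scalar on the right det A ^ 9; the exponent
   3 is left. *)
apply: (@mulfI _ (\det A ^+ 6)); first by rewrite expf_neq0.
transitivity (\det A ^+ 3 * \det (strassen_mx (g 0) (g 1) (g 2)) * \det A ^+ 3 * (\det B * \det C) ^+ 3).
  by ring.
by rewrite e; ring.
Qed.

Lemma mul_tens n p (v : 'rV[K]_(n * p)) (X : 'M[K]_n) (Y : 'M[K]_p) k l :
  (v *m (X *t Y)) 0 (mxtens_index (k, l)) = \sum_i \sum_j v 0 (mxtens_index (i, j)) * X i k * Y j l.
Proof.
rewrite mxE pair_big /=; rewrite (reindex (@mxtens_index n p)) /=; last first.
  by exists (@mxtens_unindex n p) => i _; [exact: mxtens_indexK | exact: mxtens_unindexK].
by apply: eq_bigr => -[i j] _; rewrite tensmxE mulrA.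
Qed.

(** Of the nine equations for a kernel vector, six kill a coordinate each; the others form the cycle
    x10 = lam x02, x02 = lam x21, x21 = lam x10, so that (1 - lam^3) x10 = 0. *)
Lemma det_strassen_uw (lam : K) : lam != 0 -> lam ^+ 3 != 1 ->
  \det (strassen_mx (mx3 1 0 0 0 0 lam 0 0 0) (mx3 0 0 0 0 1 0 lam 0 0) (mx3 0 lam 0 0 0 0 0 0 1)) != 0.
Proof.
move=> l0 l3; rewrite -unitfE -unitmxE -row_free_unit -kermx_eq0.
apply/eqP/row_matrixP => r; rewrite row0; set v := row r _.
have : v *m strassen_mx (mx3 1 0 0 0 0 lam 0 0 0) (mx3 0 0 0 0 1 0 lam 0 0) (mx3 0 lam 0 0 0 0 0 0 1) = 0.
  by rewrite -row_mul mulmx_ker row0.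
move: v => v /rowP vW.
pose x i j := v 0 (mxtens_index (i, j)).
have {vW} e k l : \sum_i \sum_j x i j * skew_basis K 0 i k * mx3 1 0 0 0 0 lam 0 0 0 j l
    + \sum_i \sum_j x i j * skew_basis K 1 i k * mx3 0 0 0 0 1 0 lam 0 0 j l
    + \sum_i \sum_j x i j * skew_basis K 2 i k * mx3 0 lam 0 0 0 0 0 0 1 j l = 0.
  by have := vW (mxtens_index (k, l)); rewrite /strassen_mx !mulmxDr 2!mxE !mul_tens => h; rewrite [LHS]h mxE.
suff x0 i j : x i j = 0.
  by apply/rowP => ij; case: (mxtens_indexP ij) => i j; rewrite mxE; apply: x0.
have cancel_lam y : lam * y = 0 -> y = 0 by move/eqP; rewrite mulf_eq0 (negPf l0) => /eqP.
move: e; rewrite skew_basis0 skew_basis1 skew_basis2 => e.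
have x22 : x 2 2 = 0 by apply: cancel_lam; rewrite -(e 0 0) !big_ord3 !mxE /=; ring.
have x21 : x 2 1 = lam * x 1 0 by apply/eqP; rewrite -subr_eq0 -(e 0 1) !big_ord3 !mxE /=; apply/eqP; ring.
have x12 : x 1 2 = 0 by apply/eqP; rewrite -oppr_eq0 -(e 0 2) !big_ord3 !mxE /=; apply/eqP; ring.
have x20 : x 2 0 = 0 by apply/eqP; rewrite -oppr_eq0 -(e 1 0) !big_ord3 !mxE /=; apply/eqP; ring.
have x00 : x 0 0 = 0 by apply: cancel_lam; rewrite -(e 1 1) !big_ord3 !mxE /=; ring.
have x02 : x 0 2 = lam * x 2 1 by apply/eqP; rewrite -subr_eq0 -(e 1 2) !big_ord3 !mxE /=; apply/eqP; ring.
have x10 : x 1 0 = lam * x 0 2 by apply/eqP; rewrite -subr_eq0 -(e 2 0) !big_ord3 !mxE /=; apply/eqP; ring.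
have x01 : x 0 1 = 0 by apply/eqP; rewrite -oppr_eq0 -(e 2 1) !big_ord3 !mxE /=; apply/eqP; ring.
have x11 : x 1 1 = 0 by apply: cancel_lam; rewrite -(e 2 2) !big_ord3 !mxE /=; ring.
have x10_0 : x 1 0 = 0.
  have : (1 - lam ^+ 3) * x 1 0 = 0 by rewrite mulrBl mul1r {1}x10 x02 x21; ring.
  by move/eqP; rewrite mulf_eq0 subr_eq0 eq_sym (negPf l3) => /eqP.
have x21_0 : x 2 1 = 0 by rewrite x21 x10_0 mulr0.
have x02_0 : x 0 2 = 0 by rewrite x02 x21_0 mulr0.
by move: i j; do 2!elim/ord3P.
Qed.
End Strassen.

(** * Degrees of the invariants as polynomials *)

Section Homogeneous.
Variables (K : numClosedFieldType) (n : nat).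
Implicit Types P Q M : 'M[{mpoly K[n]}]_3.

Definition homog_mx d p q (P : 'M[{mpoly K[n]}]_(p, q)) := forall i j, P i j \is d.-homog.

Lemma homog_add d p q (P Q : 'M_(p, q)) : homog_mx d P -> homog_mx d Q -> homog_mx d (P + Q).
Proof. by move=> hP hQ i j; rewrite mxE rpredD. Qed.

Lemma homog_tr d p q (P : 'M_(p, q)) : homog_mx d P -> homog_mx d P^T.
Proof. by move=> h i j; rewrite mxE. Qed.

Lemma homog_mul d e p q r (P : 'M_(p, q)) (Q : 'M_(q, r)) :
  homog_mx d P -> homog_mx e Q -> homog_mx (d + e) (P *m Q).
Proof. by move=> hP hQ i j; rewrite mxE rpred_sum // => k _; apply: dhomogM. Qed.

Lemma homog_polar d P Q : homog_mx d P -> homog_mx d Q -> homog_mx (d + d) (polar P Q).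
Proof. by move=> hP hQ i j; rewrite mxE !(rpredB, rpredD) //; apply: dhomogM. Qed.

Lemma homog_trace d P : homog_mx d P -> \tr P \is d.-homog.
Proof. by move=> h; apply: rpred_sum => i _; apply: h. Qed.

Lemma homog_det d p (P : 'M_p) : homog_mx d P -> \det P \is (p * d).-homog.
Proof.
move=> h; apply: rpred_sum => s _; rewrite -signr_odd.
suff hs : \prod_i P i (s i) \is (p * d).-homog by case: (odd _); rewrite ?mulN1r ?rpredN ?mul1r.
rewrite (_ : p * d = \sum_(i < p) d)%N; last by rewrite sum_nat_const card_ord.
elim/big_rec2: _ => [|i x y _ hy]; first exact: dhomog1.
exact: dhomogM.
Qed.

Lemma homog_sextic P Q M : homog_mx 1 P -> homog_mx 1 Q -> homog_mx 1 M -> sextic P Q M \is 6.-homog.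
Proof.
move=> hP hQ hM; rewrite /sextic.
have ma H : (forall X Y Z, homog_mx 1 X -> homog_mx 1 Y -> homog_mx 1 Z -> H X Y Z \is 6.-homog) ->
    alt3 H P Q M \is 6.-homog by move=> h; rewrite /alt3 !(rpredB, rpredD) //; apply: h.
apply: (ma) => X Y Z hX hY hZ; apply: (ma) => X' Y' Z' hX' hY' hZ'.
have hc U V W : homog_mx 1 U -> homog_mx 1 V -> homog_mx 1 W -> homog_mx 3 (U^T *m polar V W).
  by move=> hU hV hW; apply: (homog_mul (d := 1) (e := 2)); [apply: homog_tr | apply: (homog_polar (d := 1))].
by apply: homog_trace; apply: (homog_mul (d := 3) (e := 3)); apply: hc.
Qed.

Lemma homog_tens P Q : homog_mx 0 P -> homog_mx 1 Q -> homog_mx 1 (P *t Q).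
Proof. by move=> hP hQ i j; rewrite mxE; apply: (dhomogM (d := 0) (e := 1)). Qed.

Lemma homog_strassen P Q M : homog_mx 1 P -> homog_mx 1 Q -> homog_mx 1 M ->
  \det (strassen_mx P Q M) \is 9.-homog.
Proof.
move=> hP hQ hM; have hs i : homog_mx 0 (skew_basis {mpoly K[n]} i).
  by move=> j k; rewrite !mxE rpredB // rpredMn // dhomog1.
apply: (homog_det (d := 1)); rewrite /strassen_mx.
by apply: homog_add; [apply: homog_add |]; apply: homog_tens.
Qed.

End Homogeneous.

(** * Nonvanishing invariants and semistability *)

Section Semistable.
Variable K : numClosedFieldType.
Implicit Types (T S : tensor K) (A B C P Q M : 'M[K]_3).

Definition slice (R : Type) (t : 'I_3 * 'I_3 * 'I_3 -> R) i : 'M[R]_3 := \matrix_(j, k) t (i, j, k).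

Lemma contr1_slice T x : contr1 T x = x 0 0 *: slice T 0 + x 0 1 *: slice T 1 + x 0 2 *: slice T 2.
Proof. by apply/matrixP => j k; rewrite !mxE big_ord3. Qed.

Lemma slice_gact A B C T i : slice (gact A B C T) i =
  B *m combine A (slice T 0) (slice T 1) (slice T 2) i *m C^T.
Proof.
have -> : slice (gact A B C T) i = contr1 (gact A B C T) (delta_mx 0 i).
  apply/matrixP => j k; rewrite !mxE (bigD1 i) //= big1 ?addr0 => [|i' ne].
    by rewrite !mxE !eqxx mul1r.
  by rewrite !mxE (negPf ne) mul0r.
by rewrite contr1_gact -rowE contr1_slice !mxE.
Qed.

Lemma slice_swap T i : slice (swap23 T) i = (slice T i)^T.
Proof. by apply/matrixP => j k; rewrite !mxE ffunE. Qed.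

Definition generic i : 'M[{mpoly K[#|{: 'I_3 * 'I_3 * 'I_3}|]}]_3 :=
  slice (fun t => 'X_(enum_rank t)) i.

Definition sextic_poly := sextic (generic 0) (generic 1) (generic 2).
Definition strassen_poly := \det (strassen_mx (generic 0) (generic 1) (generic 2)).

Lemma eval_generic T i : map_mx (meval (fun n => T (enum_val n))) (generic i) = slice T i.
Proof. by apply/matrixP => j k; rewrite !mxE mevalXU enum_rankK. Qed.

Lemma map_sextic (R S : comNzRingType) (f : {rmorphism R -> S}) (P Q M : 'M[R]_3) :
  f (sextic P Q M) = sextic (map_mx f P) (map_mx f Q) (map_mx f M).
Proof.
have mp X Y : map_mx f (polar X Y) = polar (map_mx f X) (map_mx f Y).
  by apply/matrixP => j k; rewrite !mxE !(rmorphB, rmorphD, rmorphM).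
have mc X Y Z X' Y' Z' : f (chain X Y Z X' Y' Z') =
    chain (map_mx f X) (map_mx f Y) (map_mx f Z) (map_mx f X') (map_mx f Y') (map_mx f Z').
  by rewrite /chain -trace_map_mx !map_mxM !map_trmx !mp.
have ma H H' : (forall X Y Z, f (H X Y Z) = H' (map_mx f X) (map_mx f Y) (map_mx f Z)) ->
    f (alt3 H P Q M) = alt3 H' (map_mx f P) (map_mx f Q) (map_mx f M).
  by move=> h; rewrite /alt3 !(rmorphB, rmorphD) !h.
by apply: (ma) => X Y Z; apply: (ma) => X' Y' Z'; apply: mc.
Qed.

Lemma map_strassen (R S : comNzRingType) (f : {rmorphism R -> S}) (P Q M : 'M[R]_3) :
  map_mx f (strassen_mx P Q M) = strassen_mx (map_mx f P) (map_mx f Q) (map_mx f M).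
Proof. by rewrite /strassen_mx !map_mxD !map_mxT /skew_basis !map_mxB !map_delta_mx. Qed.

Lemma teval_sextic T : teval sextic_poly T = sextic (slice T 0) (slice T 1) (slice T 2).
Proof. by rewrite /teval map_sextic !eval_generic. Qed.

Lemma teval_strassen T :
  teval strassen_poly T = \det (strassen_mx (slice T 0) (slice T 1) (slice T 2)).
Proof.
by rewrite /teval -det_map_mx map_strassen !eval_generic.
Qed.

Lemma sextic_invariant A B C T :
  teval sextic_poly (gact A B C T) = (\det A * \det B * \det C) ^+ 2 * teval sextic_poly T.
Proof. by rewrite !teval_sextic !slice_gact; apply: sextic_act. Qed.

Lemma strassen_invariant A B C T : A \in unitmx ->
  teval strassen_poly (gact A B C T) = (\det A * \det B * \det C) ^+ 3 * teval strassen_poly T.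
Proof. by move=> uA; rewrite !teval_strassen !slice_gact; apply: det_strassen_act. Qed.

Lemma alt3_swap (H : 'M[K]_3 -> 'M[K]_3 -> 'M[K]_3 -> K) P Q M :
  alt3 (fun X Y Z => H X Z Y) P Q M = - alt3 H P Q M.
Proof. by rewrite /alt3; ring. Qed.

(** Transposition reverses the product under the trace, which amounts to exchanging the last two
    slices in both triples of [chain]; the two signs cancel. *)
Lemma sextic_tr P Q M : sextic P^T Q^T M^T = sextic P Q M.
Proof.
have e (X Y Z X' Y' Z' : 'M[K]_3) : chain X^T Y^T Z^T X'^T Y'^T Z'^T = chain X Z Y X' Z' Y'.
  rewrite /chain -mxtrace_tr !trmx_mul !trmxK !polar_tr !trmxK.
  by rewrite mulmxA mxtrace_mulC !mulmxA.
rewrite /sextic (alt3_map (c := - 1) (f := trmx) (H' := fun X Y Z => alt3 (chain X Z Y) P Q M)).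
  by rewrite (alt3_swap (fun X Y Z => alt3 (chain X Y Z) P Q M)) mulN1r opprK.
move=> X Y Z; rewrite mulN1r -alt3_swap.
rewrite (alt3_map (c := 1) (f := trmx) (H' := fun X' Y' Z' => chain X Z Y X' Z' Y')) ?mul1r //.
by move=> *; rewrite e mul1r.
Qed.

(** Transposing the 9 x 9 matrix transposes the slices and negates the skew factors, with sign
    (-1)^9. *)
Lemma det_strassen_tr P Q M : \det (strassen_mx P^T Q^T M^T) = - \det (strassen_mx P Q M).
Proof.
have tE i : (skew_basis K i)^T = - skew_basis K i by rewrite /skew_basis linearB /= !trmx_delta opprB.
have NE X Y : (- X) *t Y = - (X *t Y) :> 'M[K]_(3 * 3) by apply/matrixP => i j; rewrite !mxE mulNr.
rewrite -[in RHS]det_tr /strassen_mx !linearD /= !trmx_tens !tE !NE -!opprD.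
by rewrite -[- (_ + _ + _)]scaleN1r detZ -signr_odd mulN1r opprK.
Qed.

Lemma generic_homog i : homog_mx 1 (generic i).
Proof. by move=> j k; rewrite mxE; apply: dhomog_var. Qed.

Lemma trace_mx3 (a b c d e f g h i : K) : \tr (mx3 a b c d e f g h i) = a + e + i.
Proof. by rewrite /mxtrace big_ord3 !mxE. Qed.

(** Expanded beforehand so that the 36 terms of the sextic can be evaluated by substitution. *)
Lemma trace_chain_mx3 (a b c d e f g h i a1 b1 c1 d1 e1 f1 g1 h1 i1 a2 b2 c2 d2 e2 f2 g2 h2 i2 a3 b3 c3 d3 e3 f3 g3 h3 i3 : K) :
  \tr ((mx3 a b c d e f g h i)^T *m mx3 a1 b1 c1 d1 e1 f1 g1 h1 i1 *m ((mx3 a2 b2 c2 d2 e2 f2 g2 h2 i2)^T *m mx3 a3 b3 c3 d3 e3 f3 g3 h3 i3)) =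
    (a * a1 + d * d1 + g * g1) * (a2 * a3 + d2 * d3 + g2 * g3)
    + (a * b1 + d * e1 + g * h1) * (b2 * a3 + e2 * d3 + h2 * g3)
    + (a * c1 + d * f1 + g * i1) * (c2 * a3 + f2 * d3 + i2 * g3)
    + (b * a1 + e * d1 + h * g1) * (a2 * b3 + d2 * e3 + g2 * h3)
    + (b * b1 + e * e1 + h * h1) * (b2 * b3 + e2 * e3 + h2 * h3)
    + (b * c1 + e * f1 + h * i1) * (c2 * b3 + f2 * e3 + i2 * h3)
    + (c * a1 + f * d1 + i * g1) * (a2 * c3 + d2 * f3 + g2 * i3)
    + (c * b1 + f * e1 + i * h1) * (b2 * c3 + e2 * f3 + h2 * i3)
    + (c * c1 + f * f1 + i * i1) * (c2 * c3 + f2 * f3 + i2 * i3).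
Proof. by rewrite !tr_mx3 !mul_mx3 trace_mx3; ring. Qed.

Lemma sextic_uw (lam : K) :
  sextic (mx3 1 0 0 0 0 lam 0 0 0) (mx3 0 0 0 0 1 0 lam 0 0) (mx3 0 lam 0 0 0 0 0 0 1) =
  - 6 * (1 - 10 * lam ^+ 3 + lam ^+ 6).
Proof.
set P := mx3 1 _ _ _ _ _ _ _ _; set Q := mx3 0 0 0 0 1 _ _ _ _; set M := mx3 0 lam _ _ _ _ _ _ _.
have e00 : polar P P = mx3 0 0 0 0 0 0 0 (- (2 * lam)) 0 by rewrite polar_mx3; congr mx3; ring.
have e01 : polar P Q = mx3 0 (lam ^+ 2) 0 0 0 0 0 0 1 by rewrite polar_mx3; congr mx3; ring.
have e02 : polar P M = mx3 0 0 0 0 1 0 (lam ^+ 2) 0 0 by rewrite polar_mx3; congr mx3; ring.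
have e10 : polar Q P = mx3 0 (lam ^+ 2) 0 0 0 0 0 0 1 by rewrite polar_mx3; congr mx3; ring.
have e11 : polar Q Q = mx3 0 0 (- (2 * lam)) 0 0 0 0 0 0 by rewrite polar_mx3; congr mx3; ring.
have e12 : polar Q M = mx3 1 0 0 0 0 (lam ^+ 2) 0 0 0 by rewrite polar_mx3; congr mx3; ring.
have e20 : polar M P = mx3 0 0 0 0 1 0 (lam ^+ 2) 0 0 by rewrite polar_mx3; congr mx3; ring.
have e21 : polar M Q = mx3 1 0 0 0 0 (lam ^+ 2) 0 0 0 by rewrite polar_mx3; congr mx3; ring.
have e22 : polar M M = mx3 0 0 0 (- (2 * lam)) 0 0 0 0 0 by rewrite polar_mx3; congr mx3; ring.
rewrite /sextic /alt3 /chain !(e00, e01, e02, e10, e11, e12, e20, e21, e22).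
rewrite /P /Q /M !trace_chain_mx3.
by ring.
Qed.

Lemma sextic_v :
  sextic (mx3 0 0 0 0 0 1 0 (- 1) 0) (mx3 0 0 (- 1) 0 0 0 1 0 0) (mx3 0 1 0 (- 1) 0 0 0 0 0) = - 72 :> K.
Proof.
set P := mx3 _ _ _ _ _ 1 _ _ _; set Q := mx3 _ _ (- 1) _ _ _ 1 _ _; set M := mx3 0 1 _ _ _ _ _ _ _.
have e00 : polar P P = mx3 2 0 0 0 0 0 0 0 0 by rewrite polar_mx3; congr mx3; ring.
have e01 : polar P Q = mx3 0 1 0 1 0 0 0 0 0 by rewrite polar_mx3; congr mx3; ring.
have e02 : polar P M = mx3 0 0 1 0 0 0 1 0 0 by rewrite polar_mx3; congr mx3; ring.
have e10 : polar Q P = mx3 0 1 0 1 0 0 0 0 0 by rewrite polar_mx3; congr mx3; ring.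
have e11 : polar Q Q = mx3 0 0 0 0 2 0 0 0 0 by rewrite polar_mx3; congr mx3; ring.
have e12 : polar Q M = mx3 0 0 0 0 0 1 0 1 0 by rewrite polar_mx3; congr mx3; ring.
have e20 : polar M P = mx3 0 0 1 0 0 0 1 0 0 by rewrite polar_mx3; congr mx3; ring.
have e21 : polar M Q = mx3 0 0 0 0 0 1 0 1 0 by rewrite polar_mx3; congr mx3; ring.
have e22 : polar M M = mx3 0 0 0 0 0 0 0 0 2 by rewrite polar_mx3; congr mx3; ring.
rewrite /sextic /alt3 /chain !(e00, e01, e02, e10, e11, e12, e20, e21, e22).
rewrite /P /Q /M !trace_chain_mx3.
by ring.
Qed.

Lemma slice_uw (lam : K) : let S := normal_form lam III_ps in
  [/\ slice S 0 = mx3 1 0 0 0 0 lam 0 0 0, slice S 1 = mx3 0 0 0 0 1 0 lam 0 0 &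
      slice S 2 = mx3 0 lam 0 0 0 0 0 0 1].
Proof.
split; apply/matrixP; do 2!elim/ord3P; rewrite !mxE !ffunE /=;
  by rewrite ?(mulr0, mulr1, addr0, add0r).
Qed.

Lemma slice_v (lam : K) : let S := normal_form lam V_ps in
  [/\ slice S 0 = mx3 0 0 0 0 0 1 0 (- 1) 0, slice S 1 = mx3 0 0 (- 1) 0 0 0 1 0 0 &
      slice S 2 = mx3 0 1 0 (- 1) 0 0 0 0 0].
Proof.
split; apply/matrixP; do 2!elim/ord3P; rewrite !mxE !ffunE /=;
  by ring.
Qed.

Lemma semistable_criterion p d T S A B C : (0 < d)%N -> p \is d.-homog -> SL_invariant p ->
  A \in unitmx -> B \in unitmx -> C \in unitmx ->
  degenerates T S -> teval p (gact A B C S) != 0 -> semistable (gact A B C T).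
Proof.
move=> d0 hp inv uA uB uC deg ne; exists d, p; split=> //.
by rewrite (invariant_degeneration uA uB uC inv deg).
Qed.

(** Invertible matrices only multiply the two invariants by powers of nonzero determinants, so
    nonvanishing at the limit S is enough for every translate of T. *)
Lemma semistable_limit T S A B C : degenerates T S ->
  A \in unitmx -> B \in unitmx -> C \in unitmx ->
  teval sextic_poly S != 0 \/ teval strassen_poly S != 0 -> semistable (gact A B C T).
Proof.
move=> deg uA uB uC; have u : \det A * \det B * \det C != 0.
  by rewrite !mulf_neq0 // -unitfE -unitmxE.
case=> ne.
  apply: (semistable_criterion (p := sextic_poly) (d := 6)) deg _ => //.
  - by apply: homog_sextic; apply: generic_homog.
  - by move=> A' B' C' T' dA dB dC; rewrite sextic_invariant dA dB dC !mulr1 expr1n mul1r.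
  - by rewrite sextic_invariant mulf_neq0 // expf_neq0.
apply: (semistable_criterion (p := strassen_poly) (d := 9)) deg _ => //.
- by apply: homog_strassen; apply: generic_homog.
- move=> A' B' C' T' dA dB dC; rewrite strassen_invariant ?dA ?dB ?dC ?mulr1 ?expr1n ?mul1r //.
  by rewrite unitmxE dA unitr1.
- by rewrite strassen_invariant // mulf_neq0 // expf_neq0.
Qed.

Lemma invariant_swap S : teval sextic_poly S != 0 \/ teval strassen_poly S != 0 ->
  teval sextic_poly (swap23 S) != 0 \/ teval strassen_poly (swap23 S) != 0.
Proof. by rewrite !teval_sextic !teval_strassen !slice_swap sextic_tr det_strassen_tr oppr_eq0. Qed.

Lemma invariant_neq0 lam l : semistable_label l -> lam != 0 ->
  teval sextic_poly (limit lam l) != 0 \/ teval strassen_poly (limit lam l) != 0.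
Proof.
move=> sl l0.
have num m : (m.+1)%:R != 0 :> K by rewrite pnatr_eq0.
have uw c : teval sextic_poly (normal_form c III_ps) = - 6 * (1 - 10 * c ^+ 3 + c ^+ 6).
  by rewrite teval_sextic; case: (slice_uw c) => -> -> ->; apply: sextic_uw.
have case3 : teval sextic_poly (normal_form lam III_ps) != 0 \/
    teval strassen_poly (normal_form lam III_ps) != 0.
  (* For lam^3 = 1, excluded in [det_strassen_uw], the sextic takes the value -6 (1 - 10 + 1) =
     48. *)
  have [e|ne] := eqVneq (lam ^+ 3) 1; [left|right].
    rewrite uw (exprM lam 3 2) e (_ : _ * _ = 48); last by ring.
    exact: num.
  by rewrite teval_strassen; case: (slice_uw lam) => -> -> ->; apply: det_strassen_uw.
have case4 : teval sextic_poly (normal_form 0 III_ps) != 0.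
  by rewrite uw (_ : _ * _ = - 6) ?oppr_eq0 ?num // ; ring.
have case5 : teval sextic_poly (normal_form lam V_ps) != 0.
  by rewrite teval_sextic; case: (slice_v lam) => -> -> ->; rewrite sextic_v oppr_eq0 num.
by case: l sl => // _; first [exact: case3 | left; exact: case4 | left; exact: case5].
Qed.

Theorem semistable_labels lam l T : semistable_label l -> lam != 0 ->
  equiv_up_to_swap T (normal_form lam l) -> semistable T.
Proof.
move=> sl l0 /equiv_gact[A [B [C [uA uB uC [->|->]]]]].
  exact: (semistable_limit (nf_degenerates lam l)) (invariant_neq0 sl l0).
exact: (semistable_limit (degenerates_swap (nf_degenerates lam l))) (invariant_swap (invariant_neq0 sl l0)).
Qed.

End Semistable.

Theorem theorem4p5 (R : realType) (T : tensor (complex R)) :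
  concise T -> E1_singular T ->
  (exists (lam : complex R) (l : label),
     lam != 0 /\ equiv_up_to_swap T (normal_form lam l)) /\
  (forall (lam : complex R) (l : label),
     lam != 0 -> equiv_up_to_swap T (normal_form lam l) ->
     recorded_variety l (collineation_variety T) /\
     (if semistable_label l then semistable T else unstable T)).
Proof.
move=> conc sing; split; first exact: classification.
move=> lam l l0 e; split; first exact: recorded l0 e.
have [sl|ul] := boolP (semistable_label l); first exact: semistable_labels e.
exact: unstable_labels e.
Qed.
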